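(* Let $\overline f=(f_n)_{n\in\mathbb N}$, $f_n\in\mathrm{Diff}^2(\mathbb T^2)$, be a sequence such that $\{f_n\}$ satisfies a common cone condition and $$\max\left\{\sup_n\|f_n\|_{C^2},\ \sup_n\|f_n^{-1}\|_{C^2}\right\}<\infty.$$ Then the non-stationary stable bundle $E^s(\overline f)$ is $C^1$. If moreover $f_n\in\mathrm{Diff}^3(\mathbb T^2)$ for all $n$ and $$\max\left\{\sup_n\|f_n\|_{C^3},\ \sup_n\|f_n^{-1}\|_{C^3}\right\}<\infty,$$ then $E^s(\overline f)$ is $C^{1+\beta}$ for some $\beta\in(0,1)$.
   Context: $\mathbb T^2$ carries its standard flat Riemannian metric. A collection $\mathcal F\subset \mathrm{Diff}^1(\mathbb T^2)$ satisfies a common cone condition if there are constants $0<\mu<1<\eta$ and, for each $x\in\mathbb T^2$, one-dimensional subspaces $H_x,V_x\subset T_x\mathbb T^2$ depending continuously on $x$ with $T_x\mathbb T^2=H_x\oplus V_x$, such that, writing $K^s(x)=\{(v_1,v_2)\in H_x\oplus V_x:|v_1|\le\mu|v_2|\}$ and $K^u(x)=\{(v_1,v_2)\in H_x\oplus V_x:|v_2|\le\mu|v_1|\}$, every $f\in\mathcal F$ satisfies: (1) $D_xf(K^u(x))\subseteq \mathrm{int}\,K^u(f(x))$ and $D_xf^{-1}(K^s(x))\subseteq\mathrm{int}\,K^s(f^{-1}(x))$, and the angle between any vector of $D_xf(K^u(x))$ and $\partial K^u(f(x))$, and the angle between any vector of $D_xf^{-1}(K^s(x))$ and $\partial K^s(f^{-1}(x))$,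 are bounded away from zero uniformly; (2) $\|D_xf\,v\|\ge\eta\|v\|$ for $v\in K^u(x)$; (3) $\|D_xf^{-1}v\|\ge\eta\|v\|$ for $v\in K^s(x)$. For $x\in\mathbb T^2$, the stable direction is $E^s(x,\overline f)=\bigcap_{n=1}^\infty D_{f_n\circ\cdots\circ f_1(x)}(f_1^{-1}\circ\cdots\circ f_n^{-1})\left[K^s(f_n\circ\cdots\circ f_1(x))\right]$, which under the common cone condition is a one-dimensional subspace of $T_x\mathbb T^2$ depending continuously on $x$; the non-stationary stable bundle is $E^s(\overline f)=\bigsqcup_{x\in\mathbb T^2}E^s(x,\overline f)$. Regularity of the bundle means regularity of the corresponding section $x\mapsto E^s(x,\overline f)$ of the Grassmannian bundle $\mathrm{Gr}_1(T\mathbb T^2)$. *)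

(* Defs.v *)
From Stdlib Require Import Reals ZArith.
From Coquelicot Require Import Coquelicot.
Open Scope R_scope.

(* The torus T^2 = R^2 / Z^2 is handled through lifts to R^2; its tangent
   bundle is trivial, T_x T^2 = R^2, with the standard (flat) Euclidean metric. *)
Definition vec := (R * R)%type.
Definition vadd (u w : vec) : vec := (fst u + fst w, snd u + snd w).
Definition vsub (u w : vec) : vec := (fst u - fst w, snd u - snd w).
Definition vscal (c : R) (u : vec) : vec := (c * fst u, c * snd u).
Definition vzero : vec := (0, 0).
Definition enorm (u : vec) : R := sqrt (fst u ^ 2 + snd u ^ 2).
Definition vdot (u w : vec) : R := fst u * fst w + snd u * snd w.
Definition vangle (u w : vec) : R := acos (vdot u w / (enorm u * enorm w)).
Definition zv (k : Z * Z) : vec := (IZR (fst k), IZR (snd k)).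

Definition d1 (g : vec -> R) : vec -> R :=
  fun p => Derive (fun t => g (t, snd p)) (fst p).
Definition d2 (g : vec -> R) : vec -> R :=
  fun p => Derive (fun t => g (fst p, t)) (snd p).

Fixpoint Ck (k : nat) (g : vec -> R) : Prop :=
  match k with
  | O => forall p, continuous g p
  | S k' =>
      (forall p, ex_derive (fun t => g (t, snd p)) (fst p)) /\
      (forall p, ex_derive (fun t => g (fst p, t)) (snd p)) /\
      Ck k' (d1 g) /\ Ck k' (d2 g) /\ (forall p, continuous g p)
  end.

Definition comp1 (F : vec -> vec) : vec -> R := fun p => fst (F p).
Definition comp2 (F : vec -> vec) : vec -> R := fun p => snd (F p).

Definition CkV (k : nat) (F : vec -> vec) : Prop := Ck k (comp1 F) /\ Ck k (comp2 F).

Fixpoint DerivBound (k : nat) (M : R) (g : vec -> R) : Prop :=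
  match k with
  | O => True
  | S k' =>
      (forall p, Rabs (d1 g p) <= M /\ Rabs (d2 g p) <= M) /\
      DerivBound k' M (d1 g) /\ DerivBound k' M (d2 g)
  end.

Definition DerivBoundV (k : nat) (M : R) (F : vec -> vec) : Prop :=
  DerivBound k M (comp1 F) /\ DerivBound k M (comp2 F).

Definition Dmap (F : vec -> vec) (x u : vec) : vec :=
  (d1 (comp1 F) x * fst u + d2 (comp1 F) x * snd u,
   d1 (comp2 F) x * fst u + d2 (comp2 F) x * snd u).

Definition torus_lift (F : vec -> vec) : Prop :=
  forall x (k : Z * Z), exists m : Z * Z, F (vadd x (zv k)) = vadd (F x) (zv m).

Definition torus_Ck_diffeo (k : nat) (F G : vec -> vec) : Prop :=
  torus_lift F /\ torus_lift G /\
  (forall x, F (G x) = x) /\ (forall x, G (F x) = x) /\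
  CkV k F /\ CkV k G.

(* A field of subspaces of the tangent spaces: L x u  <->  u lies in L_x *)
Definition subfield := vec -> vec -> Prop.

Definition spans (L : subfield) (x w : vec) : Prop :=
  forall u, L x u <-> exists c : R, u = vscal c w.

Definition periodic_field (L : subfield) : Prop :=
  forall x (k : Z * Z) u, L (vadd x (zv k)) u <-> L x u.

Definition in_ball (x0 : vec) (r : R) (y : vec) : Prop := enorm (vsub y x0) < r.

Definition cont_line_field (L : subfield) : Prop :=
  periodic_field L /\
  forall x0, exists r, 0 < r /\ exists w : vec -> vec,
    (forall y, continuous w y) /\
    forall y, in_ball x0 r y -> w y <> vzero /\ spans L y (w y).

Definition C1_line_field (L : subfield) : Prop :=
  forall x0, exists r, 0 < r /\ exists w : vec -> vec,
    CkV 1 w /\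
    forall y, in_ball x0 r y -> w y <> vzero /\ spans L y (w y).

Definition holder_on (x0 : vec) (r beta : R) (g : vec -> R) : Prop :=
  exists C : R, forall y z, in_ball x0 r y -> in_ball x0 r z -> y <> z ->
    Rabs (g y - g z) <= C * Rpower (enorm (vsub y z)) beta.

Definition C1beta_line_field (beta : R) (L : subfield) : Prop :=
  forall x0, exists r, 0 < r /\ exists w : vec -> vec,
    CkV 1 w /\
    holder_on x0 r beta (d1 (comp1 w)) /\ holder_on x0 r beta (d2 (comp1 w)) /\
    holder_on x0 r beta (d1 (comp2 w)) /\ holder_on x0 r beta (d2 (comp2 w)) /\
    forall y, in_ball x0 r y -> w y <> vzero /\ spans L y (w y).

Definition Ks (H V : subfield) (mu : R) (x v : vec) : Prop :=
  exists v1 v2, H x v1 /\ V x v2 /\ v = vadd v1 v2 /\ enorm v1 <= mu * enorm v2.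
Definition Ku (H V : subfield) (mu : R) (x v : vec) : Prop :=
  exists v1 v2, H x v1 /\ V x v2 /\ v = vadd v1 v2 /\ enorm v2 <= mu * enorm v1.
(* interior (apex 0 included, by convention) *)
Definition intKs (H V : subfield) (mu : R) (x v : vec) : Prop :=
  v = vzero \/
  exists v1 v2, H x v1 /\ V x v2 /\ v = vadd v1 v2 /\ enorm v1 < mu * enorm v2.
Definition intKu (H V : subfield) (mu : R) (x v : vec) : Prop :=
  v = vzero \/
  exists v1 v2, H x v1 /\ V x v2 /\ v = vadd v1 v2 /\ enorm v2 < mu * enorm v1.
Definition bdKs (H V : subfield) (mu : R) (x v : vec) : Prop :=
  exists v1 v2, H x v1 /\ V x v2 /\ v = vadd v1 v2 /\ enorm v1 = mu * enorm v2.
Definition bdKu (H V : subfield) (mu : R) (x v : vec) : Prop :=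
  exists v1 v2, H x v1 /\ V x v2 /\ v = vadd v1 v2 /\ enorm v2 = mu * enorm v1.

Definition line_splitting (H V : subfield) : Prop :=
  cont_line_field H /\ cont_line_field V /\
  forall x,
    (exists h, h <> vzero /\ spans H x h) /\
    (exists w, w <> vzero /\ spans V x w) /\
    (forall u, H x u -> V x u -> u = vzero) /\
    (forall u, exists v1 v2, H x v1 /\ V x v2 /\ u = vadd v1 v2).

(* Common cone condition for the family {f_n} (given by lifts F n of f_n and
   G n of f_n^{-1}). *)
Definition cone_condition_with (F G : nat -> vec -> vec) (mu eta : R)
    (H V : subfield) : Prop :=
  0 < mu < 1 /\ 1 < eta /\ line_splitting H V /\
  (exists alpha : R, 0 < alpha /\
    forall n x,
      (forall v, Ku H V mu x v ->
         intKu H V mu (F n x) (Dmap (F n) x v) /\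
         (Dmap (F n) x v <> vzero ->
            forall b, bdKu H V mu (F n x) b -> b <> vzero ->
              alpha <= vangle (Dmap (F n) x v) b)) /\
      (forall v, Ks H V mu x v ->
         intKs H V mu (G n x) (Dmap (G n) x v) /\
         (Dmap (G n) x v <> vzero ->
            forall b, bdKs H V mu (G n x) b -> b <> vzero ->
              alpha <= vangle (Dmap (G n) x v) b))) /\
  (forall n x v, Ku H V mu x v -> eta * enorm v <= enorm (Dmap (F n) x v)) /\
  (forall n x v, Ks H V mu x v -> eta * enorm v <= enorm (Dmap (G n) x v)).

Definition common_cone_condition (F G : nat -> vec -> vec) : Prop :=
  exists mu eta H V, cone_condition_with F G mu eta H V.

(* F_n ∘ ... ∘ F_1 (with f_1 = F 0) and f_1^{-1} ∘ ... ∘ f_n^{-1} *)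
Fixpoint Fcomp (F : nat -> vec -> vec) (n : nat) : vec -> vec :=
  match n with
  | O => fun x => x
  | S m => fun x => F m (Fcomp F m x)
  end.
Fixpoint Gcomp (G : nat -> vec -> vec) (n : nat) : vec -> vec :=
  match n with
  | O => fun x => x
  | S m => fun x => Gcomp G m (G m x)
  end.

Definition Es (H V : subfield) (mu : R) (F G : nat -> vec -> vec) : subfield :=
  fun x u => forall n : nat, (1 <= n)%nat ->
    exists w, Ks H V mu (Fcomp F n x) w /\ u = Dmap (Gcomp G n) (Fcomp F n x) w.

(* Main.v *)
Require Import Defs.
From Stdlib Require Import Reals ZArith.
From Coquelicot Require Import Coquelicot.
From Stdlib Require Import List Lra Lia Psatz ClassicalEpsilon FunctionalExtensionality.
(* [d1] and [d2] also name fields of records of the Stdlib. *)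
Import Defs.
Open Scope R_scope.

(** Let [s n x] be a unit vector on the stable line at [x] of the sequence that
    starts at time [n], let [P] be a block of [k] consecutive maps, [A = DP], and
    [A_x s(x) = nu_x s'(P x)].  Taking the
    wedge product of [A_x s(x)] and [A_y s(y)],
      [det A_x * (s(x) ^ s(y)) =
         nu_x nu_y * (s'(P x) ^ s'(P y)) - A_x s(x) ^ (A_y - A_x) s(y)].
    The images of unstable vectors are uniformly transverse to the stable cone, so
    [|nu_x| |A_x| <= C |det A_x|] with [C] independent of [k]; since
    [|nu_y| <= eta^-k], a long block contracts slopes by a factor that even beats
    its own expansion of distances: [|nu_x nu_y| |A_x| <= |det A_x| / 8].  Hence
    [s] is Lipschitz, uniformly in [n].  The slope [t] of [s(y)] in the frame of
    [s(x)] obeys the same recursion, so that linear approximations of [t] at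
    [(n + k, P x)] are carried to linear approximations at [(n, x)] whose relative
    error is halved, up to the second-order remainder of [P].  Iterating from the
    approximation [0], valid by the Lipschitz bound, yields expansions of [t] with
    error [o(|y - x|)] locally uniformly in [x] in the C^2 case, and with error
    [O(|y - x|^(1 + beta))] in the C^3 case, where [beta] is so small that a block
    expands [|y - x|^beta] by at most a factor 2. *)

(** [s] is picked point by point by choice, so its sign may jump. Every estimate therefore concerns
    a quantity blind to this sign: the absolute value of a wedge product, the tangent [tg] of an
    angle, and finally the coefficients of the orthogonal projection onto the stable line.
    Approximate derivatives are iterated instead of derivatives, so no formula for the derivative of
    the bundle is needed: a function that has, uniformly near each point, linear approximations of
    arbitrarily small relative error is [C^1]. In the [C^2] case the radius of validity may depend
    on the starting time and on the number of iterations, because the second derivatives of the maps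
    share a bound but no modulus of continuity. A Hoelder estimate needs one radius for all numbers
    of iterations; pairs of points that a block throws too far apart are then handled by the
    Lipschitz bound alone. *)

Definition cross (u w : vec) : R := fst u * snd w - snd u * fst w.
(** The l1 norm and the entrywise norms built on it are submultiplicative and free of square roots;
    passing to and from the Euclidean norm costs only the factors 1 and 2. *)
Definition nrm (u : vec) : R := Rabs (fst u) + Rabs (snd u).

Definition mat := (vec * vec)%type.
Definition mv (A : mat) (u : vec) : vec := (vdot (fst A) u, vdot (snd A) u).
Definition mm (A B : mat) : mat :=
  ((fst (fst A) * fst (fst B) + snd (fst A) * fst (snd B),
    fst (fst A) * snd (fst B) + snd (fst A) * snd (snd B)),
   (fst (snd A) * fst (fst B) + snd (snd A) * fst (snd B),
    fst (snd A) * snd (fst B) + snd (snd A) * snd (snd B))).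
Definition madd (A B : mat) : mat := (vadd (fst A) (fst B), vadd (snd A) (snd B)).
Definition msub (A B : mat) : mat := (vsub (fst A) (fst B), vsub (snd A) (snd B)).
Definition mscal (c : R) (A : mat) : mat := (vscal c (fst A), vscal c (snd A)).
Definition mone : mat := ((1, 0), (0, 1)).
Definition mdet (A : mat) : R := cross (fst A) (snd A).
Definition mnrm (A : mat) : R := nrm (fst A) + nrm (snd A).

(** The derivative of a matrix field: one matrix for each of the two variables. [tv E h] below is
    then the derivative in the direction [h]. *)
Definition ten := (mat * mat)%type.
Definition tv (E : ten) (h : vec) : mat :=
  madd (mscal (fst h) (fst E)) (mscal (snd h) (snd E)).
Definition tnrm (E : ten) : R := mnrm (fst E) + mnrm (snd E).

Ltac unfold_vec :=
  unfold tnrm, tv, mnrm, mdet, mscal, msub, madd, mm, mv, mone, nrm, cross,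
    vdot, vadd, vsub, vscal, vzero in *; cbn [fst snd] in *.
Ltac vec_ring :=
  intros; repeat match goal with x : vec |- _ => destruct x
                 | x : mat |- _ => destruct x | x : ten |- _ => destruct x
                 | x : (_ * _)%type |- _ => destruct x end;
  cbv [tnrm tv mnrm mdet mscal msub madd mm mv mone nrm cross vdot vadd vsub vscal vzero fst snd];
  repeat match goal with |- (_, _) = (_, _) => f_equal end; ring.

(** * Norms, wedge products and determinants in the plane *)

Lemma nrm_pos u : 0 <= nrm u.
Proof. unfold nrm; generalize (Rabs_pos (fst u)) (Rabs_pos (snd u)); lra. Qed.

Lemma nrm_add u w : nrm (vadd u w) <= nrm u + nrm w.
Proof.
  unfold nrm, vadd; cbn.
  generalize (Rabs_triang (fst u) (fst w)) (Rabs_triang (snd u) (snd w)); lra.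
Qed.

Lemma nrm_scal c u : nrm (vscal c u) = Rabs c * nrm u.
Proof. unfold nrm, vscal; cbn; rewrite !Rabs_mult; ring. Qed.

Lemma nrm_sub_sym u w : nrm (vsub u w) = nrm (vsub w u).
Proof.
  unfold nrm, vsub; cbn; rewrite (Rabs_minus_sym (fst u)), (Rabs_minus_sym (snd u)); ring.
Qed.

Lemma nrm_sub_triang u w z : nrm (vsub u z) <= nrm (vsub u w) + nrm (vsub w z).
Proof.
  replace (vsub u z) with (vadd (vsub u w) (vsub w z)) by vec_ring; apply nrm_add.
Qed.

Lemma nrm_eq0 u : nrm u = 0 -> u = vzero.
Proof.
  destruct u as [a b]; unfold nrm, vzero; cbn; intros E.
  generalize (Rabs_pos a) (Rabs_pos b); intros.
  f_equal; apply Rabs_eq_0; lra.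
Qed.

Lemma vsub_eq0 u w : vsub u w = vzero -> u = w.
Proof.
  destruct u, w; unfold vsub, vzero; cbn; intros E; injection E; intros.
  f_equal; lra.
Qed.

Lemma vdot_le u w : Rabs (vdot u w) <= nrm u * nrm w.
Proof.
  unfold vdot, nrm; eapply Rle_trans; [apply Rabs_triang |].
  rewrite !Rabs_mult.
  generalize (Rabs_pos (fst u)) (Rabs_pos (snd u)) (Rabs_pos (fst w)) (Rabs_pos (snd w)); nra.
Qed.

Lemma cross_le u w : Rabs (cross u w) <= nrm u * nrm w.
Proof.
  replace (cross u w) with (vdot u (snd w, - fst w)) by vec_ring.
  eapply Rle_trans; [apply vdot_le |].
  apply Req_le; unfold nrm; cbn; rewrite Rabs_Ropp; ring.
Qed.

Lemma mnrm_pos A : 0 <= mnrm A.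
Proof. unfold mnrm; generalize (nrm_pos (fst A)) (nrm_pos (snd A)); lra. Qed.

Lemma mnrm_add A B : mnrm (madd A B) <= mnrm A + mnrm B.
Proof.
  unfold mnrm, madd; cbn.
  generalize (nrm_add (fst A) (fst B)) (nrm_add (snd A) (snd B)); lra.
Qed.

Lemma mnrm_scal c A : mnrm (mscal c A) = Rabs c * mnrm A.
Proof. unfold mnrm, mscal; cbn; rewrite !nrm_scal; ring. Qed.

Lemma nrm_mv A u : nrm (mv A u) <= mnrm A * nrm u.
Proof.
  unfold mnrm; change (nrm (mv A u)) with (Rabs (vdot (fst A) u) + Rabs (vdot (snd A) u)).
  generalize (vdot_le (fst A) u) (vdot_le (snd A) u); lra.
Qed.

Lemma mnrm_mm A B : mnrm (mm A B) <= mnrm A * mnrm B.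
Proof.
  destruct A as [[a b] [c d]], B as [[a' b'] [c' d']]; unfold_vec.
  assert (T : forall x y z w, Rabs (x * y + z * w) <= Rabs x * Rabs y + Rabs z * Rabs w).
  { intros; rewrite <- !Rabs_mult; apply Rabs_triang. }
  generalize (T a a' b c') (T a b' b d') (T c a' d c') (T c b' d d').
  generalize (Rabs_pos a) (Rabs_pos b) (Rabs_pos c) (Rabs_pos d)
    (Rabs_pos a') (Rabs_pos b') (Rabs_pos c') (Rabs_pos d').
  generalize (Rabs a) (Rabs b) (Rabs c) (Rabs d) (Rabs a') (Rabs b') (Rabs c') (Rabs d').
  intros. nra.
Qed.

Lemma tnrm_pos E : 0 <= tnrm E.
Proof. unfold tnrm; generalize (mnrm_pos (fst E)) (mnrm_pos (snd E)); lra. Qed.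

Lemma mnrm_tv E h : mnrm (tv E h) <= tnrm E * nrm h.
Proof.
  unfold tv, tnrm, nrm; eapply Rle_trans; [apply mnrm_add |].
  rewrite !mnrm_scal.
  generalize (mnrm_pos (fst E)) (mnrm_pos (snd E)) (Rabs_pos (fst h)) (Rabs_pos (snd h)); nra.
Qed.

Lemma mdet_le A : Rabs (mdet A) <= mnrm A * mnrm A.
Proof.
  unfold mdet; eapply Rle_trans; [apply cross_le |].
  unfold mnrm; generalize (nrm_pos (fst A)) (nrm_pos (snd A)); nra.
Qed.

Lemma mdet_mm A B : mdet (mm A B) = mdet A * mdet B.
Proof. vec_ring. Qed.

Lemma mv_mm A B u : mv (mm A B) u = mv A (mv B u).
Proof. vec_ring. Qed.

Lemma mv_add A u w : mv A (vadd u w) = vadd (mv A u) (mv A w).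
Proof. vec_ring. Qed.

Lemma mv_scal A c u : mv A (vscal c u) = vscal c (mv A u).
Proof. vec_ring. Qed.

Lemma cross_mv A u w : cross (mv A u) (mv A w) = mdet A * cross u w.
Proof. vec_ring. Qed.

Lemma sqr_le_inv a b : 0 <= b -> a ^ 2 <= b ^ 2 -> a <= b.
Proof. intros b0 H; apply Rnot_lt_le; intros L; nra. Qed.

Lemma enorm_pos u : 0 <= enorm u.
Proof. apply sqrt_pos. Qed.

Lemma enorm_sqr u : enorm u ^ 2 = vdot u u.
Proof.
  unfold enorm; rewrite pow2_sqrt; [unfold vdot; ring |].
  generalize (pow2_ge_0 (fst u)) (pow2_ge_0 (snd u)); lra.
Qed.

Lemma enorm_unique u r : 0 <= r -> r ^ 2 = vdot u u -> enorm u = r.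
Proof.
  intros r0 E; unfold enorm; rewrite <- (sqrt_pow2 r r0), E; f_equal; unfold vdot; ring.
Qed.

Lemma enorm_scal c u : enorm (vscal c u) = Rabs c * enorm u.
Proof.
  apply enorm_unique; [apply Rmult_le_pos; [apply Rabs_pos | apply enorm_pos] |].
  rewrite Rpow_mult_distr, pow2_abs, enorm_sqr; vec_ring.
Qed.

Lemma enorm_le_nrm u : enorm u <= nrm u.
Proof.
  assert (n0 := nrm_pos u); assert (e0 := enorm_pos u).
  assert (enorm u ^ 2 <= nrm u ^ 2).
  { rewrite enorm_sqr; unfold vdot, nrm.
    rewrite <- (Rabs_right (fst u * fst u)), <- (Rabs_right (snd u * snd u)) by (apply Rle_ge, Rle_0_sqr).
    rewrite !Rabs_mult; generalize (Rabs_pos (fst u)) (Rabs_pos (snd u)); nra. }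
  nra.
Qed.

Lemma nrm_le_enorm u : nrm u <= 2 * enorm u.
Proof.
  assert (e0 := enorm_pos u); assert (E := enorm_sqr u); unfold vdot in E.
  assert (Rabs (fst u) <= enorm u) by (apply Rabs_le; nra).
  assert (Rabs (snd u) <= enorm u) by (apply Rabs_le; nra).
  unfold nrm; lra.
Qed.

Lemma enorm_eq0 u : enorm u = 0 -> u = vzero.
Proof.
  intros E; apply nrm_eq0; generalize (nrm_le_enorm u) (nrm_pos u); rewrite E; lra.
Qed.

Lemma enorm_neq0 u : u <> vzero -> 0 < enorm u.
Proof.
  intros H; destruct (Rle_lt_or_eq_dec 0 (enorm u) (enorm_pos u)) as [L | E]; [exact L |].
  symmetry in E; apply enorm_eq0 in E; contradiction.
Qed.

Lemma enorm_zero : enorm vzero = 0.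
Proof. apply enorm_unique; [lra |]; vec_ring. Qed.

(** * First- and second-order expansions *)

(** Two one-variable mean values along the corner path from [x] vertically, then horizontally to
    [y]. Both intermediate points stay in the l1 ball around [x] of radius [nrm (vsub y x)]. *)
Lemma mvt2 g x y : Ck 1 g -> exists p q,
  nrm (vsub p x) <= nrm (vsub y x) /\ nrm (vsub q x) <= nrm (vsub y x) /\
  g y - g x = d1 g p * (fst y - fst x) + d2 g q * (snd y - snd x).
Proof.
  intros (D1 & D2 & _); destruct x as [x1 x2], y as [y1 y2]; cbn [fst snd].
  destruct (MVT_gen (fun t => g (t, y2)) x1 y1 (fun t => d1 g (t, y2))) as (c & Hc & Ec).
  { intros t _; apply Derive_correct, (D1 (t, y2)). }
  { intros t _; apply continuity_pt_filterlim, @ex_derive_continuous, (D1 (t, y2)). }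
  destruct (MVT_gen (fun t => g (x1, t)) x2 y2 (fun t => d2 g (x1, t))) as (d & Hd & Ed).
  { intros t _; apply Derive_correct, (D2 (x1, t)). }
  { intros t _; apply continuity_pt_filterlim, @ex_derive_continuous, (D2 (x1, t)). }
  exists (c, y2), (x1, d); unfold_vec.
  assert (B : forall a b e, Rmin a b <= e <= Rmax a b -> Rabs (e - a) <= Rabs (b - a)).
  { intros a b e; unfold Rmin, Rmax; destruct (Rle_dec a b); intros;
      unfold Rabs; repeat destruct Rcase_abs; lra. }
  generalize (B _ _ _ Hc) (B _ _ _ Hd); intros.
  replace (x1 - x1) with 0 by ring; rewrite Rabs_R0.
  generalize (Rabs_pos (y1 - x1)) (Rabs_pos (y2 - x2)); repeat split; lra.
Qed.

Lemma DerivBound_lip g M x y : Ck 1 g -> DerivBound 1 M g ->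
  Rabs (g y - g x) <= M * nrm (vsub y x).
Proof.
  intros C (B & _); destruct (mvt2 g x y C) as (p & q & _ & _ & ->).
  eapply Rle_trans; [apply Rabs_triang |]; rewrite !Rabs_mult; unfold nrm, vsub; cbn.
  generalize (proj1 (B p)) (proj2 (B q)) (Rabs_pos (fst y - fst x)) (Rabs_pos (snd y - snd x)).
  nra.
Qed.

Lemma DerivBound_taylor g M x y : Ck 2 g -> DerivBound 2 M g ->
  Rabs (g y - g x - vdot (d1 g x, d2 g x) (vsub y x)) <= M * nrm (vsub y x) ^ 2.
Proof.
  intros C (_ & B1 & B2); pose proof C as (X1 & X2 & C1 & C2 & X3).
  destruct (mvt2 g x y) as (p & q & Hp & Hq & E).
  { exact (conj X1 (conj X2 (conj (proj2 (proj2 (proj2 (proj2 C1)))) (conj (proj2 (proj2 (proj2 (proj2 C2)))) X3)))). }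
  rewrite E.
  replace (_ - _) with ((d1 g p - d1 g x) * (fst y - fst x) + (d2 g q - d2 g x) * (snd y - snd x)) by vec_ring.
  eapply Rle_trans; [apply Rabs_triang |]; rewrite !Rabs_mult.
  generalize (DerivBound_lip _ M x p C1 B1) (DerivBound_lip _ M x q C2 B2).
  assert (M0 : 0 <= M).
  { destruct B1 as [B1 _]; generalize (proj1 (B1 x)) (Rabs_pos (d1 (d1 g) x)); lra. }
  generalize (Rmult_le_compat_l M _ _ M0 Hp) (Rmult_le_compat_l M _ _ M0 Hq).
  set (N := nrm (vsub y x)); intros.
  replace (M * N ^ 2) with (M * N * Rabs (fst y - fst x) + M * N * Rabs (snd y - snd x))
    by (unfold N, nrm, vsub; cbn; ring).
  apply Rplus_le_compat; apply Rmult_le_compat_r; try apply Rabs_pos; lra.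
Qed.

Lemma ball_vec (x0 x : vec) d :
  ball x0 d x <-> Rabs (fst x - fst x0) < d /\ Rabs (snd x - snd x0) < d.
Proof. reflexivity. Qed.

Lemma continuous_nrm (g : vec -> R) (x0 : vec) : continuous g x0 ->
  forall e, 0 < e -> exists d, 0 < d /\ forall x, nrm (vsub x x0) <= d -> Rabs (g x - g x0) <= e.
Proof.
  intros C e He.
  destruct (proj1 (filterlim_locally g (g x0)) C (mkposreal e He)) as [d Hd].
  assert (d0 := cond_pos d).
  exists (d / 2); split; [lra |]; intros x Hx; left; apply (Hd x).
  unfold nrm, vsub in Hx; cbn in Hx.
  generalize (Rabs_pos (fst x - fst x0)) (Rabs_pos (snd x - snd x0)); intros.
  apply ball_vec; split; lra.
Qed.

Lemma nrm_continuous (g : vec -> R) (x0 : vec) :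
  (forall e, 0 < e -> exists d, 0 < d /\ forall x, nrm (vsub x x0) <= d -> Rabs (g x - g x0) <= e) ->
  continuous g x0.
Proof.
  intros C; apply filterlim_locally; intros e.
  assert (e0 := cond_pos e).
  destruct (C (e / 2)) as (d & d0 & Hd); [lra |].
  assert (d20 : 0 < d / 2) by lra.
  exists (mkposreal _ d20); refine (fun (x : vec) Hx => _); destruct (proj1 (ball_vec _ _ _) Hx) as [H H0]; cbn in H, H0.
  apply Rle_lt_trans with (e / 2); [| lra].
  apply Hd; unfold nrm, vsub; cbn; lra.
Qed.

(** Strict differentiability: one radius serves all base points near [x0], because the partial
    derivatives oscillate little on a whole ball. *)
Lemma Ck1_expand g (x0 : vec) e : Ck 1 g -> 0 < e -> exists d, 0 < d /\
  forall x y, nrm (vsub x x0) <= d -> nrm (vsub y x) <= d ->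
  Rabs (g y - g x - vdot (d1 g x, d2 g x) (vsub y x)) <= e * nrm (vsub y x).
Proof.
  intros C He; pose proof C as (_ & _ & C1 & C2 & _).
  destruct (continuous_nrm _ x0 (C1 x0) (e / 2)) as (r & r0 & Hr); [lra |].
  destruct (continuous_nrm _ x0 (C2 x0) (e / 2)) as (r' & r0' & Hr'); [lra |].
  exists (Rmin r r' / 2).
  assert (m0 : 0 < Rmin r r') by (apply Rmin_glb_lt; lra).
  generalize (Rmin_l r r') (Rmin_r r r'); intros Ml Mr.
  split; [lra |]; intros x y Hx Hy.
  destruct (mvt2 g x y C) as (p & q & Hp & Hq & E); rewrite E.
  replace (_ - _) with ((d1 g p - d1 g x) * (fst y - fst x) + (d2 g q - d2 g x) * (snd y - snd x)) by vec_ring.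
  eapply Rle_trans; [apply Rabs_triang |]; rewrite !Rabs_mult.
  assert (P1 : Rabs (d1 g p - d1 g x) <= e).
  { replace (_ - _) with ((d1 g p - d1 g x0) - (d1 g x - d1 g x0)) by ring.
    eapply Rle_trans; [apply Rabs_triang |]; rewrite Rabs_Ropp.
    generalize (Hr p) (Hr x) (nrm_sub_triang p x x0); lra. }
  assert (P2 : Rabs (d2 g q - d2 g x) <= e).
  { replace (_ - _) with ((d2 g q - d2 g x0) - (d2 g x - d2 g x0)) by ring.
    eapply Rle_trans; [apply Rabs_triang |]; rewrite Rabs_Ropp.
    generalize (Hr' q) (Hr' x) (nrm_sub_triang q x x0); lra. }
  unfold nrm, vsub; cbn.
  generalize (Rabs_pos (fst y - fst x)) (Rabs_pos (snd y - snd x)); nra.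
Qed.

(** * Uniformly controlled maps, their Jacobians and composites *)

Definition jac (P : vec -> vec) (x : vec) : mat :=
  ((d1 (comp1 P) x, d2 (comp1 P) x), (d1 (comp2 P) x, d2 (comp2 P) x)).

(** Uniform [C^{1,1}] control. The matrix field [A] is a separate argument, so that composites are
    handled by multiplying matrices; [tame_jac_eq] shows afterwards that [A] can only be the
    Jacobian. *)
Definition tame (K : R) (P : vec -> vec) (A : vec -> mat) : Prop :=
  (forall x, mnrm (A x) <= K) /\
  (forall x y, nrm (vsub (P y) (P x)) <= K * nrm (vsub y x)) /\
  (forall x y, mnrm (msub (A y) (A x)) <= K * nrm (vsub y x)) /\
  (forall x y, nrm (vsub (vsub (P y) (P x)) (mv (A x) (vsub y x))) <= K * nrm (vsub y x) ^ 2).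

(* First-order expansions of a matrix field, with a remainder that is either
   [o(h)] locally uniformly in the base point, or [O(h^2)] uniformly. *)
Definition loc2 (K : R) (A : vec -> mat) : Prop :=
  forall x0 e, 0 < e -> exists d, 0 < d /\ forall x, nrm (vsub x x0) <= d ->
  exists E, tnrm E <= K /\ forall y, nrm (vsub y x) <= d ->
  mnrm (msub (msub (A y) (A x)) (tv E (vsub y x))) <= e * nrm (vsub y x).

Definition glob2 (K : R) (A : vec -> mat) : Prop :=
  forall x, exists E, tnrm E <= K /\ forall y,
  mnrm (msub (msub (A y) (A x)) (tv E (vsub y x))) <= K * nrm (vsub y x) ^ 2.

Lemma tame_mono K L P A : K <= L -> tame K P A -> tame L P A.
Proof.
  intros H (T1 & T2 & T3 & T4); repeat split.
  - intros x; generalize (T1 x); lra.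
  - intros x y; generalize (T2 x y) (nrm_pos (vsub y x)); nra.
  - intros x y; generalize (T3 x y) (nrm_pos (vsub y x)); nra.
  - intros x y; generalize (T4 x y) (pow2_ge_0 (nrm (vsub y x))); nra.
Qed.

Lemma loc2_mono K L A : K <= L -> loc2 K A -> loc2 L A.
Proof.
  intros H T x0 e He; destruct (T x0 e He) as (d & d0 & Hd).
  exists d; split; [exact d0 |]; intros x Hx; destruct (Hd x Hx) as (E & HE & Hy).
  exists E; split; [lra | exact Hy].
Qed.

Lemma glob2_mono K L A : K <= L -> glob2 K A -> glob2 L A.
Proof.
  intros H T x; destruct (T x) as (E & HE & Hy).
  exists E; split; [lra |]; intros y.
  generalize (Hy y) (pow2_ge_0 (nrm (vsub y x))); nra.
Qed.

Lemma tame_comp K L P Q A B : 1 <= K -> 1 <= L -> tame K P A -> tame L Q B ->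
  tame (2 * L * K ^ 2) (fun x => Q (P x)) (fun x => mm (B (P x)) (A x)).
Proof.
  intros K1 L1 (T1 & T2 & T3 & T4) (S1 & S2 & S3 & S4).
  assert (HKL : L * K <= L * K ^ 2) by (apply Rmult_le_compat_l; nra).
  assert (HK0 : 0 <= L * K) by nra.
  split; [| split; [| split]]; intros x; [| intros y ..].
  - eapply Rle_trans; [apply mnrm_mm |].
    generalize (T1 x) (S1 (P x)) (mnrm_pos (A x)) (mnrm_pos (B (P x))); intros.
    assert (mnrm (B (P x)) * mnrm (A x) <= L * K) by (apply Rmult_le_compat; lra).
    lra.
  - generalize (S2 (P x) (P y)) (T2 x y) (nrm_pos (vsub y x)); intros.
    assert (L * nrm (vsub (P y) (P x)) <= L * (K * nrm (vsub y x))) by (apply Rmult_le_compat_l; lra).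
    assert (L * K * nrm (vsub y x) <= 2 * L * K ^ 2 * nrm (vsub y x)) by (apply Rmult_le_compat_r; lra).
    lra.
  - replace (msub _ _) with (madd (mm (msub (B (P y)) (B (P x))) (A y))
        (mm (B (P x)) (msub (A y) (A x)))).
    2:{ generalize (B (P y)) (B (P x)) (A y) (A x); vec_ring. }
    eapply Rle_trans; [apply mnrm_add |].
    set (h := nrm (vsub y x)); assert (h0 : 0 <= h) by apply nrm_pos.
    assert (mnrm (mm (msub (B (P y)) (B (P x))) (A y)) <= (L * (K * h)) * K).
    { eapply Rle_trans; [apply mnrm_mm |].
      apply Rmult_le_compat; auto using mnrm_pos.
      eapply Rle_trans; [apply S3 |]; apply Rmult_le_compat_l; [lra | apply T2]. }
    assert (mnrm (mm (B (P x)) (msub (A y) (A x))) <= L * (K * h)).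
    { eapply Rle_trans; [apply mnrm_mm |].
      apply Rmult_le_compat; auto using mnrm_pos; apply T3. }
    nra.
  - replace (vsub _ _) with (vadd
      (vsub (vsub (Q (P y)) (Q (P x))) (mv (B (P x)) (vsub (P y) (P x))))
      (mv (B (P x)) (vsub (vsub (P y) (P x)) (mv (A x) (vsub y x))))).
    2:{ generalize (B (P x)) (A x) (Q (P y)) (Q (P x)) (P y) (P x); vec_ring. }
    eapply Rle_trans; [apply nrm_add |].
    set (h := nrm (vsub y x)); assert (h0 : 0 <= h) by apply nrm_pos.
    assert (nrm (vsub (vsub (Q (P y)) (Q (P x))) (mv (B (P x)) (vsub (P y) (P x)))) <= L * (K * h) ^ 2).
    { eapply Rle_trans; [apply S4 |]; apply Rmult_le_compat_l; [lra |].
      apply pow_incr; split; [apply nrm_pos | apply T2]. }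
    assert (nrm (mv (B (P x)) (vsub (vsub (P y) (P x)) (mv (A x) (vsub y x)))) <= L * (K * h ^ 2)).
    { eapply Rle_trans; [apply nrm_mv |].
      apply Rmult_le_compat; auto using mnrm_pos, nrm_pos; apply T4. }
    generalize (pow2_ge_0 h); nra.
Qed.

Lemma tv_comp E E' A B h :
  tv (madd (mm (tv E' (mv A (1, 0))) A) (mm B (fst E)),
      madd (mm (tv E' (mv A (0, 1))) A) (mm B (snd E))) h =
  madd (mm (tv E' (mv A h)) A) (mm B (tv E h)).
Proof. vec_ring. Qed.

Lemma tv_add_sub E u w : tv E u = madd (tv E (vsub u w)) (tv E w).
Proof. vec_ring. Qed.

(** Product and chain rule for [B (P x) * A x], with the remainder split into the remainders of [A]
    and [B] and a quadratic term. The local and the global expansions of composites both follow from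
    it. *)
Lemma mm_expand K L P Q A B x E E' :
  1 <= K -> 1 <= L -> tame K P A -> tame L Q B -> tnrm E <= K -> tnrm E' <= L ->
  exists E2, tnrm E2 <= 2 * L * K ^ 2 /\ forall y,
  mnrm (msub (msub (mm (B (P y)) (A y)) (mm (B (P x)) (A x))) (tv E2 (vsub y x))) <=
  K * mnrm (msub (msub (B (P y)) (B (P x))) (tv E' (vsub (P y) (P x)))) +
  L * mnrm (msub (msub (A y) (A x)) (tv E (vsub y x))) +
  2 * L * K ^ 2 * nrm (vsub y x) ^ 2.
Proof.
  intros K1 L1 (T1 & T2 & T3 & T4) (S1 & S2 & S3 & S4) HE HE'.
  exists (madd (mm (tv E' (mv (A x) (1, 0))) (A x)) (mm (B (P x)) (fst E)),
          madd (mm (tv E' (mv (A x) (0, 1))) (A x)) (mm (B (P x)) (snd E))).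
  split.
  - unfold tnrm at 1; cbn [fst snd].
    eapply Rle_trans; [apply Rplus_le_compat; (eapply Rle_trans; [apply mnrm_add |]);
      apply Rplus_le_compat; apply mnrm_mm |].
    assert (B1 : forall e, mnrm (tv E' (mv (A x) e)) * mnrm (A x) <= L * nrm (mv (A x) e) * K).
    { intros e; apply Rmult_le_compat; auto using mnrm_pos.
      eapply Rle_trans; [apply mnrm_tv |]; apply Rmult_le_compat_r; auto using nrm_pos. }
    generalize (B1 (1, 0)) (B1 (0, 1)).
    assert (nrm (mv (A x) (1, 0)) + nrm (mv (A x) (0, 1)) = mnrm (A x)).
    { destruct (A x) as [[a b] [c d]]; unfold_vec.
      replace (a * 1 + b * 0) with a by ring; replace (c * 1 + d * 0) with c by ring.
      replace (a * 0 + b * 1) with b by ring; replace (c * 0 + d * 1) with d by ring; ring. }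
    assert (mnrm (B (P x)) * mnrm (fst E) + mnrm (B (P x)) * mnrm (snd E) <= L * K).
    { rewrite <- Rmult_plus_distr_l; fold (tnrm E).
      apply Rmult_le_compat; auto using mnrm_pos, tnrm_pos. }
    generalize (T1 x) (mnrm_pos (A x)).
    generalize (nrm_pos (mv (A x) (1, 0))) (nrm_pos (mv (A x) (0, 1))).
    intros.
    assert (L * nrm (mv (A x) (1, 0)) * K + L * nrm (mv (A x) (0, 1)) * K <= L * K * K).
    { replace (_ + _) with (L * K * (nrm (mv (A x) (1, 0)) + nrm (mv (A x) (0, 1)))) by ring.
      rewrite H; apply Rmult_le_compat_l; [nra | lra]. }
    assert (L * K <= L * K * K) by (assert (1 <= L * K) by nra; nra).
    nra.
  - intros y; set (k := vsub (P y) (P x)); set (h := vsub y x).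
    (* The first two terms carry the remainders of [B] and [A]; the last two are quadratic, coming
       from the Taylor remainder of [P] and from replacing [A y] by [A x]. *)
    replace (msub _ _) with (madd
      (madd (mm (msub (msub (B (P y)) (B (P x))) (tv E' k)) (A y))
            (mm (B (P x)) (msub (msub (A y) (A x)) (tv E h))))
      (madd (mm (tv E' (vsub k (mv (A x) h))) (A y))
            (mm (tv E' (mv (A x) h)) (msub (A y) (A x))))).
    2:{ rewrite tv_comp, (tv_add_sub E' k (mv (A x) h)).
        generalize (tv E' (vsub k (mv (A x) h))) (tv E' (mv (A x) h)) (tv E h)
          (B (P y)) (B (P x)) (A y) (A x); clear; vec_ring. }
    set (n := nrm h); assert (n0 : 0 <= n) by apply nrm_pos.
    eapply Rle_trans; [apply mnrm_add |]; apply Rplus_le_compat;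
      (eapply Rle_trans; [apply mnrm_add |]).
    + apply Rplus_le_compat; (eapply Rle_trans; [apply mnrm_mm |]).
      * rewrite Rmult_comm; apply Rmult_le_compat_r; auto using mnrm_pos.
      * apply Rmult_le_compat_r; auto using mnrm_pos.
    + assert (mnrm (mm (tv E' (vsub k (mv (A x) h))) (A y)) <= L * (K * n ^ 2) * K).
      { eapply Rle_trans; [apply mnrm_mm |]; apply Rmult_le_compat; auto using mnrm_pos.
        eapply Rle_trans; [apply mnrm_tv |]; apply Rmult_le_compat; auto using tnrm_pos, nrm_pos.
        apply T4. }
      assert (mnrm (mm (tv E' (mv (A x) h)) (msub (A y) (A x))) <= L * (K * n) * (K * n)).
      { eapply Rle_trans; [apply mnrm_mm |]; apply Rmult_le_compat; auto using mnrm_pos.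
        eapply Rle_trans; [apply mnrm_tv |]; apply Rmult_le_compat; auto using tnrm_pos, nrm_pos.
        eapply Rle_trans; [apply nrm_mv |]; apply Rmult_le_compat; auto using mnrm_pos; apply Rle_refl. }
      nra.
Qed.

Lemma loc2_comp K L P Q A B : 1 <= K -> 1 <= L -> tame K P A -> tame L Q B ->
  loc2 K A -> loc2 L B -> loc2 (2 * L * K ^ 2) (fun x => mm (B (P x)) (A x)).
Proof.
  intros K1 L1 TA TB HA HB x0 e He.
  assert (LK : 0 < 2 * L * K ^ 2) by nra.
  destruct (HA x0 (e / (3 * L))) as (r & r0 & Hr). { apply Rdiv_lt_0_compat; lra. }
  destruct (HB (P x0) (e / (3 * K ^ 2))) as (q & q0 & Hq). { apply Rdiv_lt_0_compat; nra. }
  set (d := Rmin r (Rmin (q / K) (e / (3 * (2 * L * K ^ 2))))).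
  assert (d0 : 0 < d).
  { repeat apply Rmin_glb_lt; [lra | apply Rdiv_lt_0_compat; lra ..]. }
  assert (dr : d <= r) by apply Rmin_l.
  assert (dq : d <= q / K) by (eapply Rle_trans; [apply Rmin_r | apply Rmin_l]).
  assert (de : d <= e / (3 * (2 * L * K ^ 2))) by (eapply Rle_trans; [apply Rmin_r | apply Rmin_r]).
  assert (Kd : K * d <= q).
  { replace q with (K * (q / K)) by (field; lra); apply Rmult_le_compat_l; lra. }
  assert (PL : forall y z, nrm (vsub y z) <= d -> nrm (vsub (P y) (P z)) <= q).
  { intros y z Hyz; destruct TA as (_ & T2 & _).
    eapply Rle_trans; [apply T2 |]; eapply Rle_trans; [apply Rmult_le_compat_l, Hyz; lra | exact Kd]. }
  exists d; split; [exact d0 |]; intros x Hx.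
  destruct (Hr x) as (E & HE & Ey); [lra |].
  destruct (Hq (P x)) as (E' & HE' & Ey'); [auto |].
  destruct (mm_expand K L P Q A B x E E' K1 L1 TA TB HE HE') as (E2 & HE2 & Hy).
  exists E2; split; [exact HE2 |]; intros y Hyx.
  eapply Rle_trans; [apply Hy |].
  specialize (Ey y); specialize (Ey' (P y) (PL _ _ Hyx)).
  set (h := nrm (vsub y x)) in *; assert (h0 : 0 <= h) by apply nrm_pos.
  assert (X1 : K * mnrm (msub (msub (B (P y)) (B (P x))) (tv E' (vsub (P y) (P x)))) <= e / 3 * h).
  { replace (e / 3 * h) with (K * (e / (3 * K ^ 2) * (K * h))) by (field; nra).
    apply Rmult_le_compat_l; [lra |]; eapply Rle_trans; [apply Ey' |].
    apply Rmult_le_compat_l; [| apply TA]; left; apply Rdiv_lt_0_compat; nra. }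
  assert (X2 : L * mnrm (msub (msub (A y) (A x)) (tv E (vsub y x))) <= e / 3 * h).
  { replace (e / 3 * h) with (L * (e / (3 * L) * h)) by (field; nra).
    apply Rmult_le_compat_l; [lra |]; apply Ey; lra. }
  assert (X3 : 2 * L * K ^ 2 * h ^ 2 <= e / 3 * h).
  { replace (e / 3 * h) with (2 * L * K ^ 2 * (e / (3 * (2 * L * K ^ 2)) * h)) by (field; nra).
    apply Rmult_le_compat_l; [lra |]; replace (h ^ 2) with (h * h) by ring.
    apply Rmult_le_compat_r; lra. }
  lra.
Qed.

Lemma glob2_comp K L P Q A B : 1 <= K -> 1 <= L -> tame K P A -> tame L Q B ->
  glob2 K A -> glob2 L B -> glob2 (4 * L * K ^ 3) (fun x => mm (B (P x)) (A x)).
Proof.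
  intros K1 L1 TA TB HA HB x.
  destruct (HA x) as (E & HE & Ey), (HB (P x)) as (E' & HE' & Ey').
  destruct (mm_expand K L P Q A B x E E' K1 L1 TA TB HE HE') as (E2 & HE2 & Hy).
  assert (LK : L * K <= L * K ^ 2) by (apply Rmult_le_compat_l; nra).
  assert (LK2 : L * K ^ 2 <= L * K ^ 3).
  { apply Rmult_le_compat_l; [lra |]; apply Rle_pow; [lra | lia]. }
  assert (LK3 : 0 <= L * K) by nra.
  exists E2; split; [lra |]; intros y.
  eapply Rle_trans; [apply Hy |].
  specialize (Ey y); specialize (Ey' (P y)).
  set (h := nrm (vsub y x)) in *; assert (h0 : 0 <= h) by apply nrm_pos.
  assert (h2 := pow2_ge_0 h).
  assert (K * mnrm (msub (msub (B (P y)) (B (P x))) (tv E' (vsub (P y) (P x)))) <= K * (L * (K * h) ^ 2)).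
  { apply Rmult_le_compat_l; [lra |]; eapply Rle_trans; [apply Ey' |].
    apply Rmult_le_compat_l; [lra |]; apply pow_incr; split; [apply nrm_pos | apply TA]. }
  assert (L * mnrm (msub (msub (A y) (A x)) (tv E (vsub y x))) <= L * (K * h ^ 2)).
  { apply Rmult_le_compat_l; lra. }
  replace (K * (L * (K * h) ^ 2)) with (L * K ^ 3 * h ^ 2) in H by ring.
  replace (L * (K * h ^ 2)) with (L * K * h ^ 2) in H0 by ring.
  assert (L * K * h ^ 2 <= L * K ^ 3 * h ^ 2) by (apply Rmult_le_compat_r; lra).
  assert (L * K ^ 2 * h ^ 2 <= L * K ^ 3 * h ^ 2) by (apply Rmult_le_compat_r; lra).
  lra.
Qed.

Lemma is_derive_quad f a l K :
  (forall t, Rabs (f t - f a - l * (t - a)) <= K * Rabs (t - a) ^ 2) -> is_derive f a l.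
Proof.
  intros H; apply is_derive_Reals; intros e He.
  assert (K' : 0 < Rabs K + 1) by (generalize (Rabs_pos K); lra).
  exists (mkposreal (e / (Rabs K + 1)) (Rdiv_lt_0_compat _ _ He K')); intros h h0 Hh; cbn in Hh.
  specialize (H (a + h)); replace (a + h - a) with h in H by ring.
  replace (_ - l) with ((f (a + h) - f a - l * h) / h) by (field; exact h0).
  assert (hp : 0 < Rabs h) by (apply Rabs_pos_lt, h0).
  unfold Rdiv; rewrite Rabs_mult, Rabs_inv; apply (Rmult_lt_reg_r (Rabs h)); [exact hp |].
  rewrite Rmult_assoc, Rinv_l, Rmult_1_r by lra.
  eapply Rle_lt_trans; [apply H |].
  assert (Rabs h * (Rabs K + 1) < e).
  { apply (Rmult_lt_compat_r _ _ _ K') in Hh; field_simplify in Hh; [lra | lra]. }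
  assert (K * Rabs h ^ 2 <= (Rabs K + 1) * Rabs h * Rabs h).
  { generalize (Rle_abs K); nra. }
  nra.
Qed.

(** The quadratic Taylor bound, restricted to the two axes through [x], determines the partial
    derivatives. Applied to a composite, it yields the chain rule. *)
Lemma tame_jac_eq K P A x : tame K P A -> jac P x = A x.
Proof.
  intros (_ & _ & _ & T4).
  assert (D1 : forall t, nrm (vsub (vsub (P (t, snd x)) (P x)) (mv (A x) (t - fst x, 0))) <= K * Rabs (t - fst x) ^ 2).
  { intros t; specialize (T4 x (t, snd x)).
    replace (vsub (t, snd x) x) with (t - fst x, 0) in T4 by vec_ring.
    replace (Rabs (t - fst x)) with (nrm (t - fst x, 0)); [exact T4 |].
    unfold nrm; cbn; rewrite Rabs_R0; ring. }
  assert (D2 : forall t, nrm (vsub (vsub (P (fst x, t)) (P x)) (mv (A x) (0, t - snd x))) <= K * Rabs (t - snd x) ^ 2).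
  { intros t; specialize (T4 x (fst x, t)).
    replace (vsub (fst x, t) x) with (0, t - snd x) in T4 by vec_ring.
    replace (Rabs (t - snd x)) with (nrm (0, t - snd x)); [exact T4 |].
    unfold nrm; cbn; rewrite Rabs_R0; ring. }
  clear T4; destruct (A x) as [[a b] [c d]], x as [x1 x2]; unfold_vec; unfold jac, d1, d2, comp1, comp2; cbn [fst snd].
  repeat f_equal; apply is_derive_unique, (is_derive_quad _ _ _ K); intros t.
  - eapply Rle_trans; [| exact (D1 t)]; rewrite Rmult_0_r, Rplus_0_r.
    match goal with |- _ <= _ + Rabs ?z => generalize (Rabs_pos z) end; lra.
  - eapply Rle_trans; [| exact (D2 t)]; rewrite Rmult_0_r, Rplus_0_l.
    match goal with |- _ <= _ + Rabs ?z => generalize (Rabs_pos z) end; lra.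
  - eapply Rle_trans; [| exact (D1 t)]; rewrite (Rmult_0_r d), Rplus_0_r.
    match goal with |- _ <= Rabs ?z + _ => generalize (Rabs_pos z) end; lra.
  - eapply Rle_trans; [| exact (D2 t)]; rewrite (Rmult_0_r c), Rplus_0_l.
    match goal with |- _ <= Rabs ?z + _ => generalize (Rabs_pos z) end; lra.
Qed.

Lemma Ck_pred k g : Ck (S k) g -> Ck k g.
Proof.
  revert g; induction k as [| k IH]; intros g.
  - intros (_ & _ & _ & _ & C); exact C.
  - intros (X1 & X2 & C1 & C2 & C); repeat split; auto.
Qed.

Lemma DerivBound_pred k M g : DerivBound (S k) M g -> DerivBound k M g.
Proof.
  revert g; induction k as [| k IH]; intros g; [easy |].
  intros (B & B1 & B2); exact (conj B (conj (IH _ B1) (IH _ B2))).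
Qed.

Lemma DerivBoundV_pred k M P : DerivBoundV (S k) M P -> DerivBoundV k M P.
Proof. intros [B1 B2]; split; apply DerivBound_pred; assumption. Qed.

Lemma DerivBound_pos k M g : DerivBound (S k) M g -> 0 <= M.
Proof. intros [B _]; generalize (proj1 (B (0, 0))) (Rabs_pos (d1 g (0, 0))); lra. Qed.

Lemma tame_jac P M : CkV 2 P -> DerivBoundV 2 M P -> tame (4 * M) P (jac P).
Proof.
  intros [C1 C2] [B1 B2]; assert (M0 := DerivBound_pos _ _ _ B1).
  pose proof C1 as (_ & _ & C11 & C12 & _); pose proof C2 as (_ & _ & C21 & C22 & _).
  pose proof B1 as (B10 & B11 & B12); pose proof B2 as (B20 & B21 & B22).
  assert (B1' : DerivBound 1 M (comp1 P)) by (repeat split; apply B10).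
  assert (B2' : DerivBound 1 M (comp2 P)) by (repeat split; apply B20).
  repeat split.
  - intros x; unfold mnrm, nrm, jac; cbn.
    generalize (proj1 (B10 x)) (proj2 (B10 x)) (proj1 (B20 x)) (proj2 (B20 x)); lra.
  - intros x y; generalize (DerivBound_lip _ _ x y (Ck_pred _ _ C1) B1')
      (DerivBound_lip _ _ x y (Ck_pred _ _ C2) B2') (nrm_pos (vsub y x)).
    unfold comp1, comp2; intros.
    change (Rabs (fst (P y) - fst (P x)) + Rabs (snd (P y) - snd (P x)) <= 4 * M * nrm (vsub y x)).
    nra.
  - intros x y; generalize (DerivBound_lip _ _ x y C11 B11) (DerivBound_lip _ _ x y C12 B12)
      (DerivBound_lip _ _ x y C21 B21) (DerivBound_lip _ _ x y C22 B22).
    set (h := nrm (vsub y x)); unfold mnrm, jac, nrm; cbn [fst snd msub vsub]; lra.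
  - intros x y; generalize (DerivBound_taylor _ _ x y C1 B1) (DerivBound_taylor _ _ x y C2 B2)
      (pow2_ge_0 (nrm (vsub y x))).
    set (h := nrm (vsub y x) ^ 2); set (v := vsub y x); intros.
    assert (0 <= M * h) by (apply Rmult_le_pos; lra).
    change (Rabs (comp1 P y - comp1 P x - vdot (d1 (comp1 P) x, d2 (comp1 P) x) v) +
      Rabs (comp2 P y - comp2 P x - vdot (d1 (comp2 P) x, d2 (comp2 P) x) v) <= 4 * M * h).
    lra.
Qed.

Definition jac2 (P : vec -> vec) (x : vec) : ten :=
  (((d1 (d1 (comp1 P)) x, d1 (d2 (comp1 P)) x), (d1 (d1 (comp2 P)) x, d1 (d2 (comp2 P)) x)),
   ((d2 (d1 (comp1 P)) x, d2 (d2 (comp1 P)) x), (d2 (d1 (comp2 P)) x, d2 (d2 (comp2 P)) x))).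

Lemma tnrm_jac2 P M x : DerivBoundV 2 M P -> tnrm (jac2 P x) <= 8 * M.
Proof.
  intros [(_ & B11 & B12) (_ & B21 & B22)].
  generalize (proj1 B11 x) (proj1 B12 x) (proj1 B21 x) (proj1 B22 x).
  unfold tnrm, mnrm, nrm, jac2; cbn; intros; lra.
Qed.

Lemma mnrm_jac_rem P x y c :
  (forall g, In g (d1 (comp1 P) :: d2 (comp1 P) :: d1 (comp2 P) :: d2 (comp2 P) :: nil) ->
    Rabs (g y - g x - vdot (d1 g x, d2 g x) (vsub y x)) <= c) ->
  mnrm (msub (msub (jac P y) (jac P x)) (tv (jac2 P x) (vsub y x))) <= 4 * c.
Proof.
  intros H.
  pose (r := fun g => g y - g x - vdot (d1 g x, d2 g x) (vsub y x)).
  replace (msub _ _) with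
    ((r (d1 (comp1 P)), r (d2 (comp1 P))), (r (d1 (comp2 P)), r (d2 (comp2 P)))).
  2:{ unfold r, jac, jac2; clear; vec_ring. }
  generalize (H (d1 (comp1 P))) (H (d2 (comp1 P))) (H (d1 (comp2 P))) (H (d2 (comp2 P))).
  fold (r (d1 (comp1 P))) (r (d2 (comp1 P))) (r (d1 (comp2 P))) (r (d2 (comp2 P))).
  clear H; cbn [In]; unfold mnrm, nrm; cbn [fst snd]; intros A1 A2 A3 A4.
  specialize (A1 ltac:(tauto)); specialize (A2 ltac:(tauto)).
  specialize (A3 ltac:(tauto)); specialize (A4 ltac:(tauto)).
  lra.
Qed.

Lemma loc2_jac P M : CkV 2 P -> DerivBoundV 2 M P -> loc2 (8 * M) (jac P).
Proof.
  intros [(_ & _ & C11 & C12 & _) (_ & _ & C21 & C22 & _)] B x0 e He.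
  assert (e4 : 0 < e / 4) by lra.
  destruct (Ck1_expand _ x0 _ C11 e4) as (r1 & R1 & H1).
  destruct (Ck1_expand _ x0 _ C12 e4) as (r2 & R2 & H2).
  destruct (Ck1_expand _ x0 _ C21 e4) as (r3 & R3 & H3).
  destruct (Ck1_expand _ x0 _ C22 e4) as (r4 & R4 & H4).
  exists (Rmin (Rmin r1 r2) (Rmin r3 r4)); split; [repeat apply Rmin_glb_lt; lra |].
  intros x Hx; exists (jac2 P x); split; [apply tnrm_jac2, B |]; intros y Hy.
  replace (e * nrm (vsub y x)) with (4 * (e / 4 * nrm (vsub y x))) by field.
  generalize (Rmin_l (Rmin r1 r2) (Rmin r3 r4)) (Rmin_r (Rmin r1 r2) (Rmin r3 r4))
    (Rmin_l r1 r2) (Rmin_r r1 r2) (Rmin_l r3 r4) (Rmin_r r3 r4); intros.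
  apply mnrm_jac_rem; cbn [In].
  intros g [<- | [<- | [<- | [<- | []]]]]; [apply H1 | apply H2 | apply H3 | apply H4]; lra.
Qed.

Lemma glob2_jac P M : CkV 3 P -> DerivBoundV 3 M P -> glob2 (8 * M) (jac P).
Proof.
  intros [(_ & _ & C11 & C12 & _) (_ & _ & C21 & C22 & _)] B x.
  exists (jac2 P x); pose proof B as B'.
  destruct B' as [(B10 & B11 & B12) (B20 & B21 & B22)].
  assert (M0 := DerivBound_pos _ _ _ B11).
  split.
  - apply tnrm_jac2, DerivBoundV_pred, B.
  - intros y; apply Rle_trans with (4 * (M * nrm (vsub y x) ^ 2)).
    + apply mnrm_jac_rem; cbn [In].
      intros g [<- | [<- | [<- | [<- | []]]]]; apply DerivBound_taylor; assumption.
    + generalize (pow2_ge_0 (nrm (vsub y x))); nra.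
Qed.

(** * Regularity from first-order expansions *)

(** The passage to the limit in every iteration below: an additive error is halved at each step and
    thus disappears. *)
Lemma le_half_pow a b c : (forall m, a <= b + c * (1 / 2) ^ m) -> a <= b.
Proof.
  intros H; apply Rnot_lt_le; intros L.
  assert (c0 : 0 < Rabs c + 1) by (generalize (Rabs_pos c); lra).
  destruct (pow_lt_1_zero (1 / 2)) with (y := (a - b) / (Rabs c + 1)) as (N & HN).
  { rewrite Rabs_right; lra. }
  { apply Rdiv_lt_0_compat; lra. }
  specialize (HN N (le_n N)); specialize (H N).
  assert (p0 : 0 < (1 / 2) ^ N) by (apply pow_lt; lra).
  rewrite Rabs_right in HN by lra.
  apply (Rmult_lt_compat_r _ _ _ c0) in HN; unfold Rdiv in HN at 2.
  rewrite Rmult_assoc, Rinv_l, Rmult_1_r in HN by lra.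
  generalize (Rle_abs c); nra.
Qed.

Lemma half_pow_small c e : 0 < e -> exists m, c * (1 / 2) ^ m <= e.
Proof.
  intros He; apply Classical_Pred_Type.not_all_not_ex; intros H.
  apply (Rlt_irrefl 0), Rlt_le_trans with e; [exact He |].
  apply le_half_pow with c; intros m; specialize (H m); lra.
Qed.

(** The slope [l] may depend on [e]: two difference quotients close to the same [l] are close to
    each other, so the quotients satisfy the Cauchy criterion. *)
Lemma ex_derive_of_slopes (f : R -> R) (a : R) :
  (forall e, 0 < e -> exists d, 0 < d /\ exists l, forall t, Rabs (t - a) <= d ->
    Rabs (f t - f a - l * (t - a)) <= e * Rabs (t - a)) ->
  ex_derive f a.
Proof.
  intros H.
  set (q := fun h => (f (a + h) - f a) / h).
  assert (Q : forall e, 0 < e -> exists d, 0 < d /\ exists l, forall h, h <> 0 -> Rabs h <= d ->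
    Rabs (q h - l) <= e).
  { intros e He; destruct (H e He) as (d & d0 & l & Hl).
    exists d; split; [exact d0 |]; exists l; intros h h0 Hh.
    specialize (Hl (a + h)); replace (a + h - a) with h in Hl by ring.
    unfold q; replace (_ - l) with ((f (a + h) - f a - l * h) / h) by (field; exact h0).
    assert (hp := Rabs_pos_lt _ h0).
    unfold Rdiv; rewrite Rabs_mult, Rabs_inv; apply (Rmult_le_reg_r (Rabs h)); [exact hp |].
    rewrite Rmult_assoc, Rinv_l, Rmult_1_r by lra; apply Hl, Hh. }
  assert (L : exists l : R, filterlim q (locally' 0) (locally l)).
  { apply (proj1 (filterlim_locally_cauchy (F := locally' 0) (FF := Rbar_locally'_filter (Finite 0)) q)); intros e.
    destruct (Q (e / 3)) as (d & d0 & l & Hl). { generalize (cond_pos e); lra. }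
    exists (fun h => h <> 0 /\ Rabs h <= d); split.
    - exists (mkposreal d d0); intros h Hh h0; split; [exact h0 |].
      change (Rabs (h - 0) < d) in Hh; rewrite Rminus_0_r in Hh; lra.
    - intros u v [u0 Hu] [v0 Hv].
      generalize (Hl u u0 Hu) (Hl v v0 Hv) (cond_pos e); intros X Y Z.
      change (Rabs (q v - q u) < e).
      replace (q v - q u) with ((q v - l) - (q u - l)) by ring.
      unfold Rminus at 1; eapply Rle_lt_trans; [apply Rabs_triang |]; rewrite Rabs_Ropp; lra. }
  destruct L as [l Hl]; exists l; apply is_derive_Reals; intros e He.
  destruct (proj1 (filterlim_locally q l) Hl (mkposreal e He)) as [d Hd].
  exists d; intros h h0 Hh.
  apply (Hd h); [| exact h0].
  change (Rabs (h - 0) < d); rewrite Rminus_0_r; exact Hh.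
Qed.

Lemma Derive_of_slope (f : R -> R) (a l e d : R) : ex_derive f a -> 0 < d ->
  (forall t, Rabs (t - a) <= d -> Rabs (f t - f a - l * (t - a)) <= e * Rabs (t - a)) ->
  Rabs (Derive f a - l) <= e.
Proof.
  intros D d0 H; apply le_epsilon; intros e' He'.
  apply Derive_correct, is_derive_Reals in D; destruct (D e' He') as [r Hr].
  assert (r0 := cond_pos r).
  set (h := Rmin d (r / 2)).
  assert (h0 : 0 < h) by (apply Rmin_glb_lt; lra).
  assert (hd : h <= d) by apply Rmin_l.
  assert (hr : h <= r / 2) by apply Rmin_r.
  specialize (Hr h ltac:(lra)); rewrite Rabs_right in Hr by lra; specialize (Hr ltac:(lra)).
  specialize (H (a + h)); replace (a + h - a) with h in H by ring.
  rewrite (Rabs_right h) in H by lra; specialize (H hd).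
  assert (H' : Rabs ((f (a + h) - f a) / h - l) <= e).
  { replace (_ - l) with ((f (a + h) - f a - l * h) / h) by (field; lra).
    unfold Rdiv; rewrite Rabs_mult, Rabs_inv, (Rabs_right h) by lra.
    apply (Rmult_le_reg_r h); [lra |]; rewrite Rmult_assoc, Rinv_l, Rmult_1_r by lra; exact H. }
  replace (Derive f a - l) with (((f (a + h) - f a) / h - l) - ((f (a + h) - f a) / h - Derive f a)) by ring.
  unfold Rminus at 1; eapply Rle_trans; [apply Rabs_triang |]; rewrite Rabs_Ropp; lra.
Qed.

Lemma vsub_e1 (x : vec) t : vsub (t, snd x) x = (t - fst x, 0).
Proof. vec_ring. Qed.

Lemma vsub_e2 (x : vec) t : vsub (fst x, t) x = (0, t - snd x).
Proof. vec_ring. Qed.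

Definition expands (f : vec -> R) (x l : vec) (d e : R) : Prop :=
  forall y, nrm (vsub y x) <= d -> Rabs (f y - f x - vdot l (vsub y x)) <= e * nrm (vsub y x).

Lemma expands_e1 f x l d e t : expands f x l d e -> Rabs (t - fst x) <= d ->
  Rabs (f (t, snd x) - f x - fst l * (t - fst x)) <= e * Rabs (t - fst x).
Proof.
  intros H Ht; specialize (H (t, snd x)); rewrite vsub_e1 in H.
  unfold nrm, vdot in H; cbn [fst snd] in H; rewrite Rabs_R0, Rplus_0_r, Rmult_0_r, Rplus_0_r in H.
  exact (H Ht).
Qed.

Lemma expands_e2 f x l d e t : expands f x l d e -> Rabs (t - snd x) <= d ->
  Rabs (f (fst x, t) - f x - snd l * (t - snd x)) <= e * Rabs (t - snd x).
Proof.
  intros H Ht; specialize (H (fst x, t)); rewrite vsub_e2 in H.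
  unfold nrm, vdot in H; cbn [fst snd] in H; rewrite Rabs_R0, Rplus_0_l, Rmult_0_r, Rplus_0_l in H.
  exact (H Ht).
Qed.

Definition has_partials (f : vec -> R) : Prop := forall p,
  ex_derive (fun t => f (t, snd p)) (fst p) /\ ex_derive (fun t => f (fst p, t)) (snd p).

Lemma partials_close f x l d e : has_partials f -> 0 < d -> expands f x l d e ->
  Rabs (d1 f x - fst l) <= e /\ Rabs (d2 f x - snd l) <= e.
Proof.
  intros D d0 H; split; apply Derive_of_slope with d; try apply D; try exact d0;
    intros t Ht; rewrite <- surjective_pairing.
  - apply expands_e1 with d; assumption.
  - apply expands_e2 with d; assumption.
Qed.

Lemma expands_grad f x l d e : has_partials f -> 0 < d -> expands f x l d e ->
  expands f x (d1 f x, d2 f x) d (2 * e).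
Proof.
  intros D d0 H; destruct (partials_close f x l d e D d0 H) as [P1 P2]; intros y Hy.
  specialize (H y Hy).
  replace (_ - _) with ((f y - f x - vdot l (vsub y x)) - vdot (d1 f x - fst l, d2 f x - snd l) (vsub y x)) by vec_ring.
  unfold Rminus at 1; eapply Rle_trans; [apply Rabs_triang |]; rewrite Rabs_Ropp.
  assert (Rabs (vdot (d1 f x - fst l, d2 f x - snd l) (vsub y x)) <= e * nrm (vsub y x)).
  { unfold vdot, nrm; cbn [fst snd]; eapply Rle_trans; [apply Rabs_triang |]; rewrite !Rabs_mult.
    generalize (Rabs_pos (fst (vsub y x))) (Rabs_pos (snd (vsub y x))); nra. }
  lra.
Qed.

(** Both expansions hold at [y + v] whenever [v] has norm [r]. Subtracting them, and using the first
    one at [y] as well, bounds [(l - m) v] by [e * r + 2 * e * r + e * r]. *)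
Lemma expands_diff f x y l m r e : 0 < r -> nrm (vsub y x) = r ->
  expands f x l (2 * r) e -> expands f y m (2 * r) e ->
  Rabs (fst l - fst m) <= 4 * e /\ Rabs (snd l - snd m) <= 4 * e.
Proof.
  intros r0 Hr Hx Hy.
  assert (X := Hx y ltac:(lra)); rewrite Hr in X.
  assert (T : forall v, nrm v = r -> Rabs (vdot (vsub l m) v) <= 4 * e * r).
  { intros v Hv.
    assert (nz : nrm (vsub (vadd y v) x) <= 2 * r).
    { replace (vsub (vadd y v) x) with (vadd (vsub y x) v) by vec_ring.
      eapply Rle_trans; [apply nrm_add |]; lra. }
    assert (e0 : 0 <= e). { generalize (Rabs_pos (f y - f x - vdot l (vsub y x))); nra. }
    assert (Z := Hx (vadd y v) nz); assert (Z' := Hy (vadd y v)).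
    replace (vsub (vadd y v) y) with v in Z' by vec_ring.
    rewrite Hv in Z'; specialize (Z' ltac:(lra)).
    replace (vdot (vsub l m) v) with ((f (vadd y v) - f y - vdot m v) -
      (f (vadd y v) - f x - vdot l (vsub (vadd y v) x)) + (f y - f x - vdot l (vsub y x))) by vec_ring.
    eapply Rle_trans; [apply Rabs_triang |].
    unfold Rminus at 1; eapply Rle_trans; [apply Rplus_le_compat_r, Rabs_triang |].
    rewrite Rabs_Ropp; nra. }
  assert (N1 : nrm (r, 0) = r) by (unfold nrm; cbn; rewrite Rabs_R0, Rabs_right; lra).
  assert (N2 : nrm (0, r) = r) by (unfold nrm; cbn; rewrite Rabs_R0, Rabs_right; lra).
  assert (T1 := T _ N1); assert (T2 := T _ N2).
  unfold vdot, vsub in T1, T2; cbn [fst snd] in T1, T2.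
  rewrite Rmult_0_r, Rplus_0_r, Rabs_mult, (Rabs_right r) in T1 by lra.
  rewrite Rmult_0_r, Rplus_0_l, Rabs_mult, (Rabs_right r) in T2 by lra.
  split; apply (Rmult_le_reg_r r); lra.
Qed.

(** The partial derivatives exist by the Cauchy criterion. They are continuous because the
    expansions at two nearby points overlap on a ball comparable to their distance. *)
Lemma C1_of_expansions f :
  (forall x0 e, 0 < e -> exists d, 0 < d /\ forall x, nrm (vsub x x0) <= d ->
    exists l, expands f x l d e) ->
  Ck 1 f.
Proof.
  intros H.
  assert (self : forall x : vec, nrm (vsub x x) = 0).
  { intros x; replace (vsub x x) with vzero by vec_ring; unfold nrm, vzero; cbn; rewrite Rabs_R0; ring. }
  assert (D : has_partials f).
  { intros x; split; apply ex_derive_of_slopes; intros e He;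
      destruct (H x e He) as (d & d0 & Hd); destruct (Hd x) as (l & Hl);
      try (rewrite self; lra); exists d; (split; [exact d0 |]).
    - exists (fst l); intros t Ht; rewrite <- surjective_pairing; apply expands_e1 with d; assumption.
    - exists (snd l); intros t Ht; rewrite <- surjective_pairing; apply expands_e2 with d; assumption. }
  assert (G : forall x0 e, 0 < e -> exists d, 0 < d /\ forall x, nrm (vsub x x0) <= d ->
    Rabs (d1 f x - d1 f x0) <= e /\ Rabs (d2 f x - d2 f x0) <= e).
  (* Replacing the approximate slopes by the gradients doubles the error, and comparing two
     gradients multiplies it by 4. *)
  { intros x0 e He; destruct (H x0 (e / 8)) as (d & d0 & Hd); [lra |].
    exists (d / 2); split; [lra |]; intros x Hx.
    destruct (Rle_lt_or_eq_dec 0 (nrm (vsub x x0)) (nrm_pos _)) as [r0 | r0].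
    - destruct (Hd x0) as (l & Hl); [rewrite self; lra |].
      destruct (Hd x) as (m & Hm); [lra |].
      apply expands_grad in Hl; [| exact D | exact d0].
      apply expands_grad in Hm; [| exact D | exact d0].
      destruct (expands_diff f x0 x (d1 f x0, d2 f x0) (d1 f x, d2 f x) (nrm (vsub x x0)) (2 * (e / 8))) as [E1 E2].
      + exact r0.
      + reflexivity.
      + intros y Hy; apply Hl; lra.
      + intros y Hy; apply Hm; lra.
      + cbn [fst snd] in E1, E2; rewrite Rabs_minus_sym in E1, E2; lra.
    - symmetry in r0; apply nrm_eq0, vsub_eq0 in r0; subst x0.
      unfold Rminus; rewrite !Rplus_opp_r, Rabs_R0; lra. }
  split; [intros p; apply D |]; split; [intros p; apply D |]; split; [| split].
  - intros p; apply nrm_continuous; intros e He; destruct (G p e He) as (d & d0 & Hd).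
    exists d; split; [exact d0 |]; intros x Hx; apply Hd, Hx.
  - intros p; apply nrm_continuous; intros e He; destruct (G p e He) as (d & d0 & Hd).
    exists d; split; [exact d0 |]; intros x Hx; apply Hd, Hx.
  - intros p; apply nrm_continuous; intros e He.
    destruct (H p 1) as (d & d0 & Hd); [lra |].
    destruct (Hd p) as (l & Hl); [rewrite self; lra |].
    assert (l1 : 0 < nrm l + 1) by (generalize (nrm_pos l); lra).
    exists (Rmin d (e / (nrm l + 1))); split; [apply Rmin_glb_lt; [lra | apply Rdiv_lt_0_compat; lra] |].
    intros x Hx; generalize (Rmin_l d (e / (nrm l + 1))) (Rmin_r d (e / (nrm l + 1))); intros.
    specialize (Hl x ltac:(lra)).
    replace (f x - f p) with ((f x - f p - vdot l (vsub x p)) + vdot l (vsub x p)) by ring.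
    eapply Rle_trans; [apply Rabs_triang |].
    generalize (vdot_le l (vsub x p)); intros.
    apply Rle_trans with ((nrm l + 1) * nrm (vsub x p)); [lra |].
    replace e with ((nrm l + 1) * (e / (nrm l + 1))) by (field; lra).
    apply Rmult_le_compat_l; lra.
Qed.

(** Since [d] does not depend on [m], the gradient itself gives an expansion with error
    [c * r ^ (1 + b)] in the limit. Comparing the expansions at [x] and [y] on balls of radius twice
    their distance then yields the Hoelder bound. *)
Lemma holder_of_expansions f b c d B : Ck 1 f -> 0 < b -> 0 < d -> 0 <= c ->
  (forall m x, exists l, forall y, 0 < nrm (vsub y x) <= d ->
    Rabs (f y - f x - vdot l (vsub y x)) <=
      (c * Rpower (nrm (vsub y x)) b + B * (1 / 2) ^ m) * nrm (vsub y x)) ->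
  forall x y, 0 < nrm (vsub y x) <= d / 2 ->
  Rabs (d1 f y - d1 f x) <= 4 * c * Rpower (2 * nrm (vsub y x)) b /\
  Rabs (d2 f y - d2 f x) <= 4 * c * Rpower (2 * nrm (vsub y x)) b.
Proof.
  intros Cf b0 d0 c0 H.
  assert (D : has_partials f) by (intros p; split; [apply (proj1 Cf) | apply (proj1 (proj2 Cf))]).
  assert (E : forall x r, 0 < r <= d -> expands f x (d1 f x, d2 f x) r (c * Rpower r b)).
  { intros x r Hr y Hy.
    destruct (Rle_lt_or_eq_dec 0 (nrm (vsub y x)) (nrm_pos _)) as [h0 | h0].
    2:{ symmetry in h0; rewrite h0, Rmult_0_r; apply nrm_eq0 in h0; rewrite h0.
        apply vsub_eq0 in h0; rewrite h0; right.
        unfold vdot, vzero; cbn; rewrite !Rmult_0_r, Rplus_0_r; unfold Rminus.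
        rewrite Rplus_opp_r, Ropp_0, Rplus_0_r; apply Rabs_R0. }
    apply Rle_trans with (c * Rpower (nrm (vsub y x)) b * nrm (vsub y x)).
    2:{ apply Rmult_le_compat_r; [lra |]; apply Rmult_le_compat_l; [lra |].
        apply Rle_Rpower_l; lra. }
    apply le_half_pow with (2 * B * nrm (vsub y x)); intros m.
    destruct (H m x) as (l & Hl).
    assert (P : Rabs (d1 f x - fst l) <= B * (1 / 2) ^ m /\ Rabs (d2 f x - snd l) <= B * (1 / 2) ^ m).
    { assert (P : forall e, 0 < e -> Rabs (d1 f x - fst l) <= B * (1 / 2) ^ m + e /\
        Rabs (d2 f x - snd l) <= B * (1 / 2) ^ m + e).
      { intros e He; set (e' := e / (c + 1)).
        assert (e0 : 0 < e') by (apply Rdiv_lt_0_compat; lra).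
        assert (ce : c * e' <= e).
        { replace e with ((c + 1) * e') by (unfold e'; field; lra); nra. }
        (* Below this radius the Hoelder term [c * r ^ b] is at most [e], so the gradient is within
           [B / 2 ^ m + e] of the approximate slope. *)
        assert (r0 : 0 < Rpower e' (/ b)) by apply exp_pos.
        assert (rb : Rpower (Rpower e' (/ b)) b = e').
        { rewrite Rpower_mult, Rinv_l, Rpower_1; lra. }
        apply partials_close with (Rmin d (Rpower e' (/ b))); [exact D | apply Rmin_glb_lt; lra |].
        generalize (Rmin_l d (Rpower e' (/ b))) (Rmin_r d (Rpower e' (/ b))); intros M1 M2 z Hz.
        destruct (Rle_lt_or_eq_dec 0 (nrm (vsub z x)) (nrm_pos _)) as [z0 | z0].
        - eapply Rle_trans; [apply Hl; lra |]; apply Rmult_le_compat_r; [lra |].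
          assert (Rpower (nrm (vsub z x)) b <= e') by (rewrite <- rb; apply Rle_Rpower_l; lra).
          nra.
        - symmetry in z0; rewrite z0, Rmult_0_r; apply nrm_eq0 in z0; rewrite z0.
          apply vsub_eq0 in z0; rewrite z0; right.
          unfold vdot, vzero; cbn; rewrite !Rmult_0_r, Rplus_0_r; unfold Rminus.
          rewrite Rplus_opp_r, Ropp_0, Rplus_0_r; apply Rabs_R0. }
      split; apply le_epsilon; intros e He; apply P, He. }
    specialize (Hl y ltac:(lra)).
    replace (_ - _) with ((f y - f x - vdot l (vsub y x)) - vdot (d1 f x - fst l, d2 f x - snd l) (vsub y x)) by vec_ring.
    unfold Rminus at 1; eapply Rle_trans; [apply Rabs_triang |]; rewrite Rabs_Ropp.
    assert (Rabs (vdot (d1 f x - fst l, d2 f x - snd l) (vsub y x)) <= B * (1 / 2) ^ m * nrm (vsub y x)).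
    { unfold vdot, nrm; cbn [fst snd]; eapply Rle_trans; [apply Rabs_triang |]; rewrite !Rabs_mult.
      generalize (Rabs_pos (fst (vsub y x))) (Rabs_pos (snd (vsub y x))); nra. }
    lra. }
  intros x y Hr.
  destruct (expands_diff f x y (d1 f x, d2 f x) (d1 f y, d2 f y) (nrm (vsub y x))
    (c * Rpower (2 * nrm (vsub y x)) b)) as [E1 E2].
  - lra.
  - reflexivity.
  - apply E; lra.
  - apply E; lra.
  - cbn [fst snd] in E1, E2; rewrite Rabs_minus_sym in E1, E2; lra.
Qed.

(** * The transfer of slopes of the stable lines *)

Lemma Rpower_ge_base h b : 0 < h <= 1 -> 0 < b < 1 -> h <= Rpower h b.
Proof.
  intros Hh Hb; rewrite <- (Rpower_1 h) at 1 by lra.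
  apply Rnot_lt_le; intros X; apply exp_lt_inv in X.
  assert (ln h <= 0) by (rewrite <- ln_1; apply ln_le; lra).
  nra.
Qed.

(** The tangent of the angle from [u] to [w]; it does not change when either vector is replaced by
    its opposite. *)
Definition tg (u w : vec) : R := cross u w / vdot u w.
Definition rot (u : vec) : vec := (- snd u, fst u).

(** [P n] stands for the block of [k0] maps starting at time [n], and [nu] for its rate along the
    stable line. [ctr_rate] allows two different points because the wedge identity multiplies the
    rates at [x] and at [y]. [ctr_norm] lets the linear part absorb the second-order part of [P n]
    at small distances. *)
Record contracting (k0 : nat) (K : R) (s : nat -> vec -> vec) (nu : nat -> vec -> R)
    (P : nat -> vec -> vec) (A : nat -> vec -> mat) : Prop := {
  ctr_K : 1 <= K;
  ctr_tame : forall n, tame K (P n) (A n);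
  ctr_unit : forall n x, vdot (s n x) (s n x) = 1;
  ctr_inv : forall n x, mv (A n x) (s n x) = vscal (nu n x) (s (n + k0)%nat (P n x));
  ctr_norm : forall n x, 1 <= mnrm (A n x);
  ctr_det : forall n x, 1 <= K * Rabs (mdet (A n x));
  ctr_rate : forall n x y,
    Rabs (nu n x) * Rabs (nu n y) * mnrm (A n x) <= Rabs (mdet (A n x)) / 8 }.

Lemma nrm_unit u : vdot u u = 1 -> nrm u <= 2.
Proof.
  destruct u as [a b]; unfold_vec; intros H.
  assert (Rabs a <= 1) by (apply Rabs_le; nra).
  assert (Rabs b <= 1) by (apply Rabs_le; nra).
  lra.
Qed.

Lemma cross_sqr_vdot_sqr u w :
  cross u w ^ 2 + vdot u w ^ 2 = vdot u u * vdot w w.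
Proof. vec_ring. Qed.

Lemma cross_unit u w : vdot u u = 1 -> vdot w w = 1 -> Rabs (cross u w) <= 1.
Proof.
  intros Hu Hw; generalize (cross_sqr_vdot_sqr u w); rewrite Hu, Hw; intros.
  apply Rabs_le; generalize (pow2_ge_0 (vdot u w)); nra.
Qed.

Lemma tg_spec u w : vdot u u = 1 -> vdot w w = 1 -> Rabs (cross u w) <= 1 / 2 ->
  vdot u w <> 0 /\ Rabs (tg u w) <= 2 * Rabs (cross u w) /\
  w = vscal (vdot u w) (vadd u (vscal (tg u w) (rot u))) /\
  vdot u w ^ 2 * (1 + tg u w ^ 2) = 1.
Proof.
  intros Hu Hw Hc; pose proof (cross_sqr_vdot_sqr u w) as E; rewrite Hu, Hw in E.
  assert (Hc2 : cross u w ^ 2 <= 1 / 4).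
  { apply Rabs_le_between in Hc; nra. }
  assert (Hd : 1 / 2 <= Rabs (vdot u w)).
  { unfold Rabs; destruct Rcase_abs; nra. }
  assert (Hn : vdot u w <> 0).
  { intros Z; rewrite Z, Rabs_R0 in Hd; lra. }
  split; [exact Hn |]; split; [| split].
  - unfold tg, Rdiv; rewrite Rabs_mult, Rabs_inv, Rmult_comm.
    apply Rmult_le_compat_r; [apply Rabs_pos |].
    apply (Rmult_le_reg_r (Rabs (vdot u w))); [lra |]; rewrite Rinv_l; lra.
  - assert (W : vscal (vdot u u) w = vadd (vscal (vdot u w) u) (vscal (cross u w) (rot u))).
    { unfold rot; vec_ring. }
    replace (vscal (vdot u u) w) with w in W by (rewrite Hu; vec_ring).
    rewrite W at 1; unfold tg.
    replace (cross u w) with (vdot u w * (cross u w / vdot u w)) at 1 by (field; exact Hn).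
    unfold rot; generalize (cross u w / vdot u w) (vdot u w); clear; vec_ring.
  - unfold tg; field_simplify; [lra | exact Hn].
Qed.

(** Chosen so that [16 * K ^ 3 * (2 * K * near_radius K) = 1 / 2]: by the Lipschitz bound, stable
    lines at two points this close, and at their images under a block, have wedge product at most
    1/2, so that [tg] is defined. *)
Definition near_radius (K : R) : R := / (64 * K ^ 4).
(** Large enough to dominate the Lipschitz constant [32 * K ^ 3] of [tg] and to be preserved by
    [slope_transport]. *)
Definition slope_bound (K : R) : R := 64 * K ^ 3.

Section Core.
Context {k0 : nat} {K : R} {s : nat -> vec -> vec} {nu : nat -> vec -> R}
  {P : nat -> vec -> vec} {A : nat -> vec -> mat}.
Context (C : contracting k0 K s nu P A).
Let K1 : 1 <= K := ctr_K _ _ _ _ _ _ C.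

Lemma step_dist n x y : K * nrm (vsub y x) <= 1 ->
  nrm (vsub (P n y) (P n x)) <= 2 * mnrm (A n x) * nrm (vsub y x).
Proof.
  intros H; destruct (ctr_tame _ _ _ _ _ _ C n) as (_ & _ & _ & T4); specialize (T4 x y).
  replace (vsub (P n y) (P n x)) with (vadd (mv (A n x) (vsub y x))
    (vsub (vsub (P n y) (P n x)) (mv (A n x) (vsub y x)))) by vec_ring.
  eapply Rle_trans; [apply nrm_add |].
  generalize (nrm_mv (A n x) (vsub y x)) (ctr_norm _ _ _ _ _ _ C n x) (nrm_pos (vsub y x)).
  set (h := nrm (vsub y x)) in *; intros.
  assert (K * h ^ 2 <= 1 * h) by (replace (K * h ^ 2) with (K * h * h) by ring; nra).
  nra.
Qed.

Lemma nrm_s n x : nrm (s n x) <= 2.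
Proof. apply nrm_unit, C. Qed.

Lemma nrm_As n x : nrm (mv (A n x) (s n x)) <= 2 * K.
Proof.
  eapply Rle_trans; [apply nrm_mv |].
  destruct (ctr_tame _ _ _ _ _ _ C n) as (T1 & _).
  generalize (T1 x) (nrm_s n x) (mnrm_pos (A n x)) (nrm_pos (s n x)); nra.
Qed.

Lemma cross_step n x y :
  mdet (A n x) * cross (s n x) (s n y) =
  nu n x * nu n y * cross (s (n + k0)%nat (P n x)) (s (n + k0)%nat (P n y)) -
  cross (mv (A n x) (s n x)) (mv (msub (A n y) (A n x)) (s n y)).
Proof.
  replace (nu n x * nu n y * cross (s (n + k0)%nat (P n x)) (s (n + k0)%nat (P n y)))
    with (cross (mv (A n x) (s n x)) (mv (A n y) (s n y))).
  2:{ rewrite !(ctr_inv _ _ _ _ _ _ C); vec_ring. }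
  rewrite <- cross_mv; vec_ring.
Qed.

Lemma det_pos n x : 0 < Rabs (mdet (A n x)).
Proof. generalize (ctr_det _ _ _ _ _ _ C n x) (Rabs_pos (mdet (A n x))); nra. Qed.

Lemma div_det n x a b : Rabs (mdet (A n x)) * a <= Rabs (mdet (A n x)) * b -> a <= b.
Proof. apply Rmult_le_reg_l, det_pos. Qed.

(** Starting from the trivial bound 1, a block multiplies the additive error by at most 1/8 and the
    Lipschitz part by at most 1/4. The variation of [A] adds at most [4 * K ^ 3], so the constant
    [16 * K ^ 3] reproduces itself. The induction runs over all times and points together. *)
Lemma stable_lipschitz n x y :
  Rabs (cross (s n x) (s n y)) <= 16 * K ^ 3 * nrm (vsub y x).
Proof.
  assert (K3 : K <= K ^ 3).
  { rewrite <- (pow_1 K) at 1; apply Rle_pow; [exact K1 | lia]. }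
  apply le_half_pow with 1; intros m; revert n x y; induction m as [| m IH]; intros n x y.
  - generalize (cross_unit _ _ (ctr_unit _ _ _ _ _ _ C n x) (ctr_unit _ _ _ _ _ _ C n y)) (nrm_pos (vsub y x)).
    simpl; nra.
  - destruct (Rle_lt_dec (K * nrm (vsub y x)) 1) as [H | H].
    + apply (div_det n x); rewrite <- Rabs_mult, cross_step.
      unfold Rminus; eapply Rle_trans; [apply Rabs_triang |]; rewrite Rabs_Ropp, !Rabs_mult.
      pose proof (IH (n + k0)%nat (P n x) (P n y)) as I; pose proof (step_dist n x y H) as SD.
      assert (R := ctr_rate _ _ _ _ _ _ C n x y).
      assert (X : Rabs (cross (mv (A n x) (s n x)) (mv (msub (A n y) (A n x)) (s n y)))
        <= 4 * K ^ 2 * nrm (vsub y x)).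
      { eapply Rle_trans; [apply cross_le |].
        replace (4 * K ^ 2 * nrm (vsub y x)) with (2 * K * ((K * nrm (vsub y x)) * 2)) by ring.
        apply Rmult_le_compat; auto using nrm_pos, nrm_As.
        eapply Rle_trans; [apply nrm_mv |].
        apply Rmult_le_compat; auto using nrm_pos, mnrm_pos, nrm_s.
        apply (ctr_tame _ _ _ _ _ _ C n). }
      generalize (ctr_norm _ _ _ _ _ _ C n x) (ctr_det _ _ _ _ _ _ C n x) (det_pos n x) (nrm_pos (vsub y x)).
      set (D := Rabs (mdet (A n x))) in *; set (a := mnrm (A n x)) in *.
      set (h := nrm (vsub y x)) in *; set (k := nrm (vsub (P n y) (P n x))) in *.
      set (q := Rabs (nu n x) * Rabs (nu n y)) in *.
      set (c := Rabs (cross (s (n + k0)%nat _) _)) in *.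
      assert (q0 : 0 <= q) by (apply Rmult_le_pos; apply Rabs_pos).
      intros a1 D1 D0 h0.
      set (p := (1 / 2) ^ m) in *; replace ((1 / 2) ^ S m) with (p / 2) by (unfold p; simpl; field).
      assert (p0 : 0 < p) by (apply pow_lt; lra).
      assert (qD : q <= D / 8) by nra.
      assert (qp : q * p <= D / 8 * p) by (apply Rmult_le_compat_r; lra).
      assert (qh : q * (16 * K ^ 3 * k) <= D / 4 * (16 * K ^ 3 * h)).
      { replace (D / 4 * (16 * K ^ 3 * h)) with (16 * K ^ 3 * (D / 8 * 2 * h)) by field.
        replace (q * (16 * K ^ 3 * k)) with (16 * K ^ 3 * (q * k)) by ring.
        apply Rmult_le_compat_l; [nra |].
        apply Rle_trans with (q * (2 * a * h)); [nra |].
        replace (q * (2 * a * h)) with (q * a * 2 * h) by ring; nra. }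
      assert (Kh : 4 * K ^ 2 * h <= D * (4 * K ^ 3 * h)).
      { replace (D * (4 * K ^ 3 * h)) with ((K * D) * (4 * K ^ 2 * h)) by ring.
        assert (0 <= 4 * K ^ 2 * h) by (apply Rmult_le_pos; nra). nra. }
      assert (qc : q * c <= q * (16 * K ^ 3 * k + 1 * p)) by (apply Rmult_le_compat_l; lra).
      assert (0 <= D * (K ^ 3 * h)) by (apply Rmult_le_pos; [lra | apply Rmult_le_pos; lra]).
      assert (0 <= D * p) by nra.
      replace (D * (16 * K ^ 3 * h + 1 * (p / 2))) with (16 * (D * (K ^ 3 * h)) + D * p / 2) by field.
      lra.
    (* At distances above [1 / K] the Lipschitz bound exceeds 1 and is trivial. *)
    + generalize (cross_unit _ _ (ctr_unit _ _ _ _ _ _ C n x) (ctr_unit _ _ _ _ _ _ C n y)) (nrm_pos (vsub y x)).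
      assert (p0 : 0 < (1 / 2) ^ S m) by (apply pow_lt; lra).
      intros; assert (K * nrm (vsub y x) <= K ^ 3 * nrm (vsub y x)) by (apply Rmult_le_compat_r; lra).
      lra.
Qed.

Lemma near_radius_pos : 0 < near_radius K.
Proof. apply Rinv_0_lt_compat, Rmult_lt_0_compat; [lra | apply pow_lt; lra]. Qed.

Lemma near_cross n x y : nrm (vsub y x) <= 2 * K * near_radius K ->
  Rabs (cross (s n x) (s n y)) <= 1 / 2.
Proof.
  intros H; eapply Rle_trans; [apply stable_lipschitz |].
  apply Rle_trans with (16 * K ^ 3 * (2 * K * near_radius K)).
  - apply Rmult_le_compat_l; [| exact H]; apply Rmult_le_pos; [lra | apply pow_le; lra].
  - unfold near_radius; apply Req_le; field; lra.
Qed.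

Lemma near_tg n x y : nrm (vsub y x) <= 2 * K * near_radius K ->
  Rabs (tg (s n x) (s n y)) <= 32 * K ^ 3 * nrm (vsub y x).
Proof.
  intros H; destruct (tg_spec (s n x) (s n y)) as (_ & T & _).
  1,2: apply C. { apply near_cross, H. }
  generalize (stable_lipschitz n x y); lra.
Qed.

Lemma near_tg_small n x y : nrm (vsub y x) <= 2 * K * near_radius K ->
  Rabs (tg (s n x) (s n y)) <= 1.
Proof.
  intros H; destruct (tg_spec (s n x) (s n y)) as (_ & T & _).
  1,2: apply C. { apply near_cross, H. }
  generalize (near_cross n x y H); lra.
Qed.

Lemma nrm_rot u : nrm (rot u) = nrm u.
Proof. unfold nrm, rot; cbn; rewrite Rabs_Ropp; ring. Qed.

(* [w], [w'] are the vectors of the stable lines at [y], [P y] whose scalar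
   product with the unit vectors at [x], [P x] is 1. *)
Lemma tg_step n x y : nrm (vsub y x) <= near_radius K ->
  exists w nw, let t := tg (s n x) (s n y) in
  let t' := tg (s (n + k0)%nat (P n x)) (s (n + k0)%nat (P n y)) in
  w = vadd (s n x) (vscal t (rot (s n x))) /\
  nw = vdot (s (n + k0)%nat (P n x)) (mv (A n y) w) /\
  mdet (A n x) * t = nu n x * nw * t' -
    cross (mv (A n x) (s n x)) (mv (msub (A n y) (A n x)) w).
Proof.
  intros H.
  assert (R0 := near_radius_pos).
  assert (H1 : nrm (vsub y x) <= 2 * K * near_radius K) by nra.
  assert (H2 : nrm (vsub (P n y) (P n x)) <= 2 * K * near_radius K).
  { eapply Rle_trans; [apply (ctr_tame _ _ _ _ _ _ C n) |]; nra. }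
  destruct (tg_spec (s n x) (s n y)) as (N1 & _ & E1 & _).
  1,2: apply C. { apply near_cross, H1. }
  destruct (tg_spec (s (n + k0)%nat (P n x)) (s (n + k0)%nat (P n y))) as (N2 & _ & E2 & _).
  1,2: apply C. { apply near_cross, H2. }
  eexists; eexists; cbv zeta; split; [reflexivity |]; split; [reflexivity |].
  pose proof (ctr_inv _ _ _ _ _ _ C n x) as I; pose proof (ctr_inv _ _ _ _ _ _ C n y) as J.
  pose proof (ctr_unit _ _ _ _ _ _ C (n + k0)%nat (P n x)) as U.
  pose proof (ctr_unit _ _ _ _ _ _ C n x) as V.
  set (u := s n x) in *; set (u' := s (n + k0)%nat (P n x)) in *.
  set (v := s n y) in *; set (v' := s (n + k0)%nat (P n y)) in *.
  set (t := tg u v) in *; set (t' := tg u' v') in *; set (w := vadd u (vscal t (rot u))) in *.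
  set (w' := vadd u' (vscal t' (rot u'))) in *.
  set (d := vdot u v) in *; set (d' := vdot u' v') in *.
  (* [w] is [v / d] and [w'] is [v' / d'], so invariance of the stable lines makes [A_y w] a
     multiple of [w']. Pairing with [u'] reads off the factor, which is therefore [nw]. *)
  assert (Aw : mv (A n y) w = vscal (nu n y * d' / d) w').
  { assert (Ew : w = vscal (/ d) v).
    { rewrite E1; replace (vscal (/ d) (vscal d w)) with (vscal (/ d * d) w) by vec_ring.
      rewrite Rinv_l by exact N1; vec_ring. }
    rewrite Ew, mv_scal, J, E2; unfold Rdiv; vec_ring. }
  assert (W1 : vdot u' w' = 1).
  { rewrite <- U; unfold w', rot; vec_ring. }
  assert (W2 : cross u' w' = t').
  { transitivity (t' * vdot u' u'); [unfold w', rot; vec_ring | rewrite U; ring]. }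
  assert (W3 : cross u w = t).
  { transitivity (t * vdot u u); [unfold w, rot; vec_ring | rewrite V; ring]. }
  set (c := nu n y * d' / d) in *.
  replace (vdot u' (mv (A n y) w)) with c.
  2:{ rewrite Aw; transitivity (c * vdot u' w'); [rewrite W1; ring | vec_ring]. }
  rewrite <- W3, <- cross_mv, <- W2, I.
  transitivity (cross (mv (A n x) u) (mv (A n y) w) -
    cross (mv (A n x) u) (mv (msub (A n y) (A n x)) w)).
  - rewrite <- I; clear; generalize (A n x) (A n y) w u; vec_ring.
  - rewrite <- I; f_equal; rewrite Aw, I; generalize (nu n x) c w' u'; clear; vec_ring.
Qed.

Lemma nu_sqr_le n x : nu n x ^ 2 * mnrm (A n x) <= Rabs (mdet (A n x)) / 8.
Proof.
  eapply Rle_trans; [| apply (ctr_rate _ _ _ _ _ _ C n x x)].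
  rewrite <- Rabs_mult, Rabs_right; [apply Req_le; ring |].
  apply Rle_ge; replace (nu n x * nu n x) with (nu n x ^ 2) by ring; apply pow2_ge_0.
Qed.

Lemma nu_le n x : Rabs (nu n x) <= 4 * K.
Proof.
  replace (nu n x) with (vdot (s (n + k0)%nat (P n x)) (mv (A n x) (s n x))).
  - eapply Rle_trans; [apply vdot_le |].
    replace (4 * K) with (2 * (2 * K)) by ring.
    apply Rmult_le_compat; auto using nrm_pos, nrm_s, nrm_As.
  - rewrite (ctr_inv _ _ _ _ _ _ C).
    transitivity (nu n x * vdot (s (n + k0)%nat (P n x)) (s (n + k0)%nat (P n x))); [vec_ring |].
    rewrite (ctr_unit _ _ _ _ _ _ C); ring.
Qed.

(** The recursion of [tg_step] linearized at [y = x]: [nw] and [w] become [nu n x] and [s n x], and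
    the increment of [A] becomes [tv E h]. The right-hand side is linear in [h], hence given by a
    vector [l']. *)
Lemma slope_transport n x E l : tnrm E <= K -> nrm l <= slope_bound K ->
  exists l', nrm l' <= slope_bound K /\ forall h,
  mdet (A n x) * vdot l' h =
  nu n x ^ 2 * vdot l (mv (A n x) h) - cross (mv (A n x) (s n x)) (mv (tv E h) (s n x)).
Proof.
  intros HE Hl.
  set (psi := fun h => nu n x ^ 2 * vdot l (mv (A n x) h) -
                       cross (mv (A n x) (s n x)) (mv (tv E h) (s n x))).
  assert (D0 : 0 < Rabs (mdet (A n x))) by apply det_pos.
  assert (N0 : mdet (A n x) <> 0) by (intros Z; rewrite Z, Rabs_R0 in D0; lra).
  exists (vscal (/ mdet (A n x)) (psi (1, 0), psi (0, 1))); split.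
  (* The rate condition turns [slope_bound K] into an eighth, [8 * K ^ 3]; the wedge term adds
     [4 * K ^ 3]. The two coordinates together give [24 * K ^ 3], below [slope_bound K]. *)
  - assert (B : forall e, nrm e = 1 -> Rabs (psi e) <= Rabs (mdet (A n x)) * (12 * K ^ 3)).
    { intros e He; unfold psi, Rminus; eapply Rle_trans; [apply Rabs_triang |].
      rewrite Rabs_Ropp, Rabs_mult, (Rabs_right (nu n x ^ 2)) by (apply Rle_ge, pow2_ge_0).
      assert (X : Rabs (vdot l (mv (A n x) e)) <= slope_bound K * mnrm (A n x)).
      { eapply Rle_trans; [apply vdot_le |]; apply Rmult_le_compat; auto using nrm_pos.
        eapply Rle_trans; [apply nrm_mv |]; rewrite He; lra. }
      assert (Y : Rabs (cross (mv (A n x) (s n x)) (mv (tv E e) (s n x))) <= 2 * K * (K * 2)).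
      { eapply Rle_trans; [apply cross_le |]; apply Rmult_le_compat; auto using nrm_pos, nrm_As.
        eapply Rle_trans; [apply nrm_mv |]; apply Rmult_le_compat; auto using mnrm_pos, nrm_pos, nrm_s.
        eapply Rle_trans; [apply mnrm_tv |]; rewrite He; lra. }
      generalize (nu_sqr_le n x) (ctr_det _ _ _ _ _ _ C n x) (pow2_ge_0 (nu n x)).
      set (D := Rabs (mdet (A n x))) in *; intros.
      assert (nu n x ^ 2 * Rabs (vdot l (mv (A n x) e)) <= D / 8 * slope_bound K).
      { apply Rle_trans with (nu n x ^ 2 * (slope_bound K * mnrm (A n x))).
        - apply Rmult_le_compat_l; assumption.
        - replace (nu n x ^ 2 * (slope_bound K * mnrm (A n x))) with
            (nu n x ^ 2 * mnrm (A n x) * slope_bound K) by ring.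
          apply Rmult_le_compat_r; [generalize (nrm_pos l); lra | assumption]. }
      assert (2 * K * (K * 2) <= D * (4 * K ^ 3)).
      { replace (D * (4 * K ^ 3)) with (K * D * (4 * K ^ 2)) by ring. nra. }
      unfold slope_bound in *; lra. }
    rewrite nrm_scal, Rabs_inv; apply (div_det n x).
    rewrite <- Rmult_assoc, Rinv_r, Rmult_1_l by lra.
    assert (e1 : nrm (1, 0) = 1) by (unfold nrm; cbn; rewrite Rabs_R0, Rabs_R1; ring).
    assert (e2 : nrm (0, 1) = 1) by (unfold nrm; cbn; rewrite Rabs_R0, Rabs_R1; ring).
    generalize (B _ e1) (B _ e2); unfold slope_bound, nrm; cbn [fst snd].
    assert (0 <= Rabs (mdet (A n x)) * K ^ 3) by (apply Rmult_le_pos; [lra | apply pow_le; lra]).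
    lra.
  - intros h; transitivity (mdet (A n x) * / mdet (A n x) * vdot (psi (1, 0), psi (0, 1)) h).
    { vec_ring. }
    rewrite Rinv_r, Rmult_1_l by exact N0; unfold psi.
    generalize (nu n x ^ 2) (A n x) (s n x); clear; vec_ring.
Qed.

(** The error of the slope at [P n x] is inherited with weight [q]; the rest is the cost of
    linearizing the recursion. Since [q] also beats the expansion of distances, the relative error
    shrinks by a factor 4 before that cost is added. The constant [c] is independent of time, point
    and slope. *)
Lemma slope_step : exists c, 0 < c /\
  forall n x E l, tnrm E <= K -> nrm l <= slope_bound K ->
  exists l', nrm l' <= slope_bound K /\
  forall y, nrm (vsub y x) <= near_radius K -> exists q,
  0 <= q <= 1 / 8 /\ q * nrm (vsub (P n y) (P n x)) <= nrm (vsub y x) / 4 /\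
  Rabs (tg (s n x) (s n y) - vdot l' (vsub y x)) <=
    q * Rabs (tg (s (n + k0)%nat (P n x)) (s (n + k0)%nat (P n y)) - vdot l (vsub (P n y) (P n x))) +
    c * (mnrm (msub (msub (A n y) (A n x)) (tv E (vsub y x))) + nrm (vsub y x) ^ 2).
Proof.
  set (T := 32 * K ^ 3).
  assert (T0 : 0 < T) by (apply Rmult_lt_0_compat; [lra | apply pow_lt; lra]).
  (* [T] is the Lipschitz constant of [tg]. The summands of [cc] are the constants of [X1], [X3] and
     [X2] below; they come without a factor [D], which [1 <= K * D] supplies. *)
  set (cc := 4 * K * (2 * (4 * K + 2 * K * T)) * (T * K) + 2 * K * (K * (2 * T)) + 8 * K).
  assert (cc8 : 8 * K <= cc).
  { assert (0 <= 4 * K * (2 * (4 * K + 2 * K * T)) * (T * K)).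
    { repeat apply Rmult_le_pos; nra. }
    assert (0 <= 2 * K * (K * (2 * T))) by (repeat apply Rmult_le_pos; lra).
    unfold cc; lra. }
  exists (slope_bound K * K + K * cc); split.
  { apply Rplus_le_lt_0_compat; [apply Rmult_le_pos; [unfold slope_bound; fold T; nra |] |]; nra. }
  intros n x E l HE Hl.
  destruct (slope_transport n x E l HE Hl) as (l' & Hl' & Tr).
  exists l'; split; [exact Hl' |]; intros y Hy.
  set (D := Rabs (mdet (A n x))); assert (D0 : 0 < D) by apply det_pos.
  assert (D1 : 1 <= K * D) by apply C.
  exists (nu n x ^ 2 / D).
  assert (nu2 := nu_sqr_le n x); fold D in nu2.
  assert (a1 := ctr_norm _ _ _ _ _ _ C n x).
  assert (nu0 := pow2_ge_0 (nu n x)).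
  assert (R0 := near_radius_pos).
  assert (R1 : K * near_radius K <= 1).
  { unfold near_radius; apply (Rmult_le_reg_r (64 * K ^ 4)); [apply Rmult_lt_0_compat; [lra | apply pow_lt; lra] |].
    rewrite Rmult_assoc, Rinv_l by (apply Rgt_not_eq, Rmult_lt_0_compat; [lra | apply pow_lt; lra]).
    assert (K <= K ^ 4) by (rewrite <- (pow_1 K) at 1; apply Rle_pow; [exact K1 | lia]). lra. }
  assert (nuD : nu n x ^ 2 <= D / 8) by nra.
  assert (h0 : 0 <= nrm (vsub y x)) by apply nrm_pos.
  assert (Hy2 : nrm (vsub y x) <= 2 * K * near_radius K) by nra.
  assert (kK : nrm (vsub (P n y) (P n x)) <= K * nrm (vsub y x)) by apply (ctr_tame _ _ _ _ _ _ C n).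
  assert (Hk2 : nrm (vsub (P n y) (P n x)) <= 2 * K * near_radius K) by nra.
  split; [split |]; [| | split].
  - apply Rmult_le_pos; [exact nu0 | left; apply Rinv_0_lt_compat, D0].
  - apply (div_det n x); fold D; unfold Rdiv; rewrite (Rmult_comm _ (/ D)), <- Rmult_assoc, Rinv_r by lra; lra.
  - assert (S := step_dist n x y); apply (div_det n x); fold D.
    replace (D * (nu n x ^ 2 / D * nrm (vsub (P n y) (P n x)))) with (nu n x ^ 2 * nrm (vsub (P n y) (P n x))) by (field; lra).
    apply Rle_trans with (nu n x ^ 2 * (2 * mnrm (A n x) * nrm (vsub y x))).
    + apply Rmult_le_compat_l; [exact nu0 |]; apply S; nra.
    + replace (nu n x ^ 2 * (2 * mnrm (A n x) * nrm (vsub y x))) with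
        (nu n x ^ 2 * mnrm (A n x) * (2 * nrm (vsub y x))) by ring.
      replace (D * (nrm (vsub y x) / 4)) with (D / 8 * (2 * nrm (vsub y x))) by field.
      apply Rmult_le_compat_r; lra.
  - destruct (tg_step n x y Hy) as (w & nw & Ew & Enw & Et).
    assert (t1 := near_tg n x y Hy2); assert (ts := near_tg_small n x y Hy2).
    specialize (Tr (vsub y x)).
    assert (I := ctr_inv _ _ _ _ _ _ C n x).
    assert (U := ctr_unit _ _ _ _ _ _ C (n + k0)%nat (P n x)).
    assert (Enu : nu n x = vdot (s (n + k0)%nat (P n x)) (mv (A n x) (s n x))).
    { rewrite I; transitivity (nu n x * vdot (s (n + k0)%nat (P n x)) (s (n + k0)%nat (P n x))); [rewrite U; ring | vec_ring]. }
    fold T in t1.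
    assert (T2 := near_tg (n + k0) (P n x) (P n y) Hk2); fold T in T2.
    set (t := tg (s n x) (s n y)) in *; set (t' := tg (s (n + k0)%nat (P n x)) (s (n + k0)%nat (P n y))) in *.
    set (k := vsub (P n y) (P n x)) in *; set (h := vsub y x) in *.
    set (R := msub (msub (A n y) (A n x)) (tv E h)) in *.
    set (N := nrm h) in *.
    destruct (ctr_tame _ _ _ _ _ _ C n) as (TA & _ & TL & TQ).
    specialize (TA x); specialize (TL x y); specialize (TQ x y); fold h k N in TL, TQ.
    assert (su : nrm (s n x) <= 2) by apply nrm_s.
    assert (su' : nrm (s (n + k0)%nat (P n x)) <= 2) by apply nrm_s.
    assert (As := nrm_As n x).
    assert (ws : nrm (vsub w (s n x)) <= 2 * T * N).
    { replace (vsub w (s n x)) with (vscal t (rot (s n x))) by (rewrite Ew; vec_ring).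
      rewrite nrm_scal, nrm_rot; generalize (Rabs_pos t) (nrm_pos (s n x)); nra. }
    assert (wn : nrm w <= 4).
    { rewrite Ew; eapply Rle_trans; [apply nrm_add |].
      rewrite nrm_scal, nrm_rot; generalize (Rabs_pos t) (nrm_pos (s n x)); nra. }
    assert (dn : Rabs (nw - nu n x) <= 2 * (4 * K + 2 * K * T) * N).
    { replace (nw - nu n x) with (vdot (s (n + k0)%nat (P n x))
        (vadd (mv (msub (A n y) (A n x)) w) (mv (A n x) (vsub w (s n x))))).
      2:{ rewrite Enw, Enu; clear; vec_ring. }
      eapply Rle_trans; [apply vdot_le |].
      replace (2 * (4 * K + 2 * K * T) * N) with (2 * (K * N * 4 + K * (2 * T * N))) by ring.
      apply Rmult_le_compat; auto using nrm_pos.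
      eapply Rle_trans; [apply nrm_add |]; apply Rplus_le_compat;
        (eapply Rle_trans; [apply nrm_mv |]); apply Rmult_le_compat; auto using nrm_pos, mnrm_pos. }
    apply (div_det n x); fold D; unfold D at 1; rewrite <- Rabs_mult.
    (* The exact recursion minus its linearization. Beyond the inherited error, each term contains
       the remainder [R] of [A], the Taylor remainder of [P n], or a product of two first-order
       quantities. *)
    replace (mdet (A n x) * (t - vdot l' h)) with
      (nu n x ^ 2 * (t' - vdot l k) + nu n x ^ 2 * vdot l (vsub k (mv (A n x) h)) +
       (nu n x * (nw - nu n x) * t' - cross (mv (A n x) (s n x)) (mv R w) -
        cross (mv (A n x) (s n x)) (mv (tv E h) (vsub w (s n x))))).
    2:{ rewrite (Rmult_minus_distr_l (mdet _)), Et, Tr; unfold R; clear.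
        generalize (nu n x) (A n x) (A n y) (tv E h) t' k; vec_ring. }
    replace (D * (nu n x ^ 2 / D * Rabs (t' - vdot l k) + (slope_bound K * K + K * cc) * (mnrm R + N ^ 2)))
      with (nu n x ^ 2 * Rabs (t' - vdot l k) + D * (slope_bound K * K * (mnrm R + N ^ 2)) + K * D * (cc * (mnrm R + N ^ 2))) by (field; lra).
    assert (R2 : 0 <= mnrm R) by apply mnrm_pos.
    assert (N2 : 0 <= N ^ 2) by apply pow2_ge_0.
    assert (B0 : 0 <= slope_bound K) by (generalize (nrm_pos l); lra).
    eapply Rle_trans; [apply Rabs_triang |]; apply Rplus_le_compat;
      [eapply Rle_trans; [apply Rabs_triang |]; apply Rplus_le_compat |].
    + rewrite Rabs_mult, (Rabs_right (nu n x ^ 2)) by lra; lra.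
    + rewrite Rabs_mult, (Rabs_right (nu n x ^ 2)) by lra.
      apply Rle_trans with (D * (slope_bound K * (K * N ^ 2))).
      * apply Rmult_le_compat; auto using Rabs_pos; [lra |].
        eapply Rle_trans; [apply vdot_le |]; apply Rmult_le_compat; auto using nrm_pos.
      * apply Rmult_le_compat_l; [lra |]; rewrite Rmult_assoc.
        apply Rmult_le_compat_l; [lra |]; apply Rmult_le_compat_l; lra.
    + apply Rle_trans with (cc * (mnrm R + N ^ 2)).
      2:{ rewrite <- (Rmult_1_l (cc * _)) at 1; apply Rmult_le_compat_r; [| exact D1].
          apply Rmult_le_pos; lra. }
      unfold Rminus; eapply Rle_trans; [apply Rabs_triang |].
      assert (X1 : Rabs (nu n x * (nw - nu n x) * t') <= 4 * K * (2 * (4 * K + 2 * K * T) * N) * (T * (K * N))).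
      { rewrite !Rabs_mult; apply Rmult_le_compat; auto using Rabs_pos.
        - apply Rmult_le_pos; apply Rabs_pos.
        - apply Rmult_le_compat; auto using Rabs_pos, nu_le.
        - eapply Rle_trans; [apply T2 |]; apply Rmult_le_compat_l; lra. }
      assert (X2 : Rabs (cross (mv (A n x) (s n x)) (mv R w)) <= 2 * K * (mnrm R * 4)).
      { eapply Rle_trans; [apply cross_le |]; apply Rmult_le_compat; auto using nrm_pos.
        eapply Rle_trans; [apply nrm_mv |]; apply Rmult_le_compat_l; lra. }
      assert (X3 : Rabs (cross (mv (A n x) (s n x)) (mv (tv E h) (vsub w (s n x)))) <= 2 * K * (K * N * (2 * T * N))).
      { eapply Rle_trans; [apply cross_le |]; apply Rmult_le_compat; auto using nrm_pos.
        eapply Rle_trans; [apply nrm_mv |]; apply Rmult_le_compat; auto using nrm_pos, mnrm_pos.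
        eapply Rle_trans; [apply mnrm_tv |]; apply Rmult_le_compat_r; lra. }
      eapply Rle_trans; [apply Rplus_le_compat_r, Rabs_triang |]; rewrite !Rabs_Ropp.
      fold (nw - nu n x); fold (vsub w (s n x)).
      assert (X4 : 8 * K * mnrm R <= cc * mnrm R) by (apply Rmult_le_compat_r; lra).
      assert (X5 : 4 * K * (2 * (4 * K + 2 * K * T) * N) * (T * (K * N)) + 2 * K * (K * N * (2 * T * N)) <= cc * N ^ 2).
      { replace (4 * K * (2 * (4 * K + 2 * K * T) * N) * (T * (K * N)) + 2 * K * (K * N * (2 * T * N)))
          with ((cc - 8 * K) * N ^ 2) by (unfold cc; ring).
        apply Rmult_le_compat_r; lra. }
      lra.
Qed.
Lemma slope_zero n x y : nrm (vsub y x) <= near_radius K ->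
  Rabs (tg (s n x) (s n y)) <= slope_bound K * nrm (vsub y x).
Proof.
  intros H; assert (R0 := near_radius_pos).
  eapply Rle_trans; [apply (near_tg); nra |].
  apply Rmult_le_compat_r; [apply nrm_pos |].
  unfold slope_bound; assert (0 < K ^ 3) by (apply pow_lt; lra); lra.
Qed.

(** Induction on the number of blocks, starting from the slope 0. The radius shrinks with [m], since
    the images under the block must lie where the expansion at time [n + k0] holds. *)
Lemma slope_locally : (forall n, loc2 K (A n)) ->
  forall m n x0 e, 0 < e -> exists d, 0 < d /\ forall x, nrm (vsub x x0) <= d ->
  exists l, nrm l <= slope_bound K /\ forall y, nrm (vsub y x) <= d ->
  Rabs (tg (s n x) (s n y) - vdot l (vsub y x)) <=
    (slope_bound K * (1 / 2) ^ m + e) * nrm (vsub y x).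
Proof.
  intros HA m; induction m as [| m IH]; intros n x0 e He.
  - exists (near_radius K); split; [apply (near_radius_pos) |]; intros x _.
    exists vzero; split.
    { unfold nrm, vzero; cbn; rewrite Rabs_R0, Rplus_0_r; unfold slope_bound.
      apply Rmult_le_pos; [lra | apply pow_le; lra]. }
    intros y Hy; replace (_ - _) with (tg (s n x) (s n y)) by (unfold vdot, vzero; cbn; ring).
    generalize (slope_zero n x y Hy) (nrm_pos (vsub y x)); simpl; nra.
  - destruct (slope_step) as (c & c0 & St).
    destruct (IH (n + k0)%nat (P n x0) e He) as (d1 & d10 & H1).
    destruct (HA n x0 (e / (4 * c))) as (d2 & d20 & H2).
    { apply Rdiv_lt_0_compat; lra. }
    assert (R0 := near_radius_pos).
    (* [d1 / K] keeps the images within [d1]; the threshold [e / (4 * c)] makes the quadratic cost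
       at most [e / 4] times the distance, as the choice of [d2] does for the remainder of [A]. With
       the inherited quarter of [e] the total stays below [e]. *)
    set (d := Rmin (Rmin d2 (near_radius K)) (Rmin (d1 / K) (e / (4 * c)))).
    assert (dl1 := Rmin_l (Rmin d2 (near_radius K)) (Rmin (d1 / K) (e / (4 * c)))).
    assert (dl2 := Rmin_r (Rmin d2 (near_radius K)) (Rmin (d1 / K) (e / (4 * c)))).
    fold d in dl1, dl2.
    generalize (Rmin_l d2 (near_radius K)) (Rmin_r d2 (near_radius K))
      (Rmin_l (d1 / K) (e / (4 * c))) (Rmin_r (d1 / K) (e / (4 * c))); intros.
    assert (d0 : 0 < d).
    { repeat apply Rmin_glb_lt; [lra | exact R0 | apply Rdiv_lt_0_compat; lra ..]. }
    assert (Kd : K * d <= d1).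
    { replace d1 with (K * (d1 / K)) by (field; lra); apply Rmult_le_compat_l; lra. }
    assert (PL : forall y z, nrm (vsub y z) <= d -> nrm (vsub (P n y) (P n z)) <= d1).
    { intros y z Hyz; destruct (ctr_tame _ _ _ _ _ _ C n) as (_ & T2 & _).
      eapply Rle_trans; [apply T2 |]; eapply Rle_trans; [apply Rmult_le_compat_l, Hyz; lra | exact Kd]. }
    exists d; split; [exact d0 |]; intros x Hx.
    destruct (H2 x) as (E & HE & Ey); [lra |].
    destruct (H1 (P n x)) as (l & Hl & Ly); [auto |].
    destruct (St n x E l HE Hl) as (l' & Hl' & Sy).
    exists l'; split; [exact Hl' |]; intros y Hy.
    destruct (Sy y) as (q & q0 & qk & Q); [lra |].
    eapply Rle_trans; [apply Q |].
    specialize (Ly _ (PL _ _ Hy)).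
    assert (Ey' := Ey y ltac:(lra)).
    set (h := nrm (vsub y x)) in *; set (k := nrm (vsub (P n y) (P n x))) in *.
    assert (h0 : 0 <= h) by apply nrm_pos.
    assert (B0 : 0 <= slope_bound K) by (generalize (nrm_pos l); lra).
    set (p := (1 / 2) ^ m) in *; replace ((1 / 2) ^ S m) with (p / 2) by (unfold p; simpl; field).
    assert (p0 : 0 < p) by (apply pow_lt; lra).
    set (b := slope_bound K * p) in *.
    assert (b0 : 0 <= b) by (apply Rmult_le_pos; lra).
    replace (slope_bound K * (p / 2)) with (b / 2) by (unfold b; field).
    match goal with |- q * ?a + c * (?r + _) <= _ =>
      assert (X1 : q * a <= (b + e) * (h / 4)); [| assert (X2 : c * r <= e / 4 * h)] end.
    + apply Rle_trans with (q * ((b + e) * k)); [apply Rmult_le_compat_l; lra |].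
      replace (q * ((b + e) * k)) with ((b + e) * (q * k)) by ring.
      apply Rmult_le_compat_l; lra.
    + replace (e / 4 * h) with (c * (e / (4 * c) * h)) by (field; lra).
      apply Rmult_le_compat_l; lra.
    + assert (X3 : c * h ^ 2 <= e / 4 * h).
      { replace (e / 4 * h) with (c * (e / (4 * c) * h)) by (field; lra).
        apply Rmult_le_compat_l; [lra |]; replace (h ^ 2) with (h * h) by ring.
        apply Rmult_le_compat_r; lra. }
      nra.
Qed.

Lemma near_radius_le_1 : near_radius K <= 1.
Proof.
  unfold near_radius; rewrite <- Rinv_1; apply Rinv_le_contravar; [lra |].
  assert (1 <= K ^ 4) by (apply pow_R1_Rle; lra); lra.
Qed.

Lemma exponent_exists : exists b, 0 < b < 1 /\ forall r, 0 < r -> Rpower (K * r) b <= 2 * Rpower r b.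
Proof.
  assert (l2 : 0 < ln 2) by (rewrite <- ln_1; apply ln_increasing; lra).
  assert (l4 : ln 2 < ln (4 * K)) by (apply ln_increasing; lra).
  (* This exponent solves [(4 * K) ^ b = 2]; the factor 4 keeps it below 1 even for [K = 1]. *)
  exists (ln 2 / ln (4 * K)); split.
  - split; [apply Rdiv_lt_0_compat; lra |].
    apply (Rmult_lt_reg_r (ln (4 * K))); [lra |]; field_simplify; lra.
  - intros r r0; assert (b0 : 0 <= ln 2 / ln (4 * K)) by (left; apply Rdiv_lt_0_compat; lra).
    apply Rle_trans with (Rpower (4 * K * r) (ln 2 / ln (4 * K))).
    + apply Rle_Rpower_l; [exact b0 |]; split; nra.
    + rewrite <- Rpower_mult_distr by lra; apply Rmult_le_compat_r; [left; apply exp_pos |].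
      unfold Rpower; replace (ln 2 / ln (4 * K) * ln (4 * K)) with (ln 2) by (field; lra).
      rewrite exp_ln; lra.
Qed.

(** The factor 2 by which a block enlarges [r ^ b] still leaves half of the Hoelder term after the
    contraction by 4. The other half pays for the quadratic cost of linearization, as [h <= h ^ b]
    for [h <= 1]. *)
Lemma slope_holder b : 0 < b < 1 -> (forall r, 0 < r -> Rpower (K * r) b <= 2 * Rpower r b) ->
  (forall n, glob2 K (A n)) -> exists c, 0 <= c /\ forall m n x,
  exists l, nrm l <= slope_bound K /\ forall y, 0 < nrm (vsub y x) <= near_radius K ->
  Rabs (tg (s n x) (s n y) - vdot l (vsub y x)) <=
    (c * Rpower (nrm (vsub y x)) b + slope_bound K * (1 / 2) ^ m) * nrm (vsub y x).
Proof.
  intros Hb HR HA.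
  destruct (slope_step) as (c & c0 & St).
  assert (R0 := near_radius_pos).
  set (r0 := near_radius K) in *; set (B := slope_bound K) in *.
  assert (RK : 0 < r0 / K) by (apply Rdiv_lt_0_compat; lra).
  assert (B0 : 0 < B) by (apply Rmult_lt_0_compat; [lra | apply pow_lt; lra]).
  assert (rho0 : 0 < Rpower (r0 / K) b) by apply exp_pos.
  (* The first summand absorbs the cost of one step, the second makes the estimate trivial at
     distances of at least [r0 / K]. *)
  set (c1 := 4 * K * c + 2 * B / Rpower (r0 / K) b).
  assert (c1a : 4 * K * c <= c1).
  { unfold c1; assert (0 < 2 * B / Rpower (r0 / K) b) by (apply Rdiv_lt_0_compat; lra); lra. }
  assert (c1b : 2 * B / Rpower (r0 / K) b <= c1) by (unfold c1; nra).
  assert (c10 : 0 <= c1) by nra.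
  assert (r1 : r0 <= 1) by apply near_radius_le_1.
  exists c1; split; [exact c10 |].
  intros m; induction m as [| m IH]; intros n x.
  - exists vzero; split.
    { unfold nrm, vzero; cbn; rewrite Rabs_R0, Rplus_0_r; lra. }
    intros y [hp Hy]; replace (_ - _) with (tg (s n x) (s n y)) by (unfold vdot, vzero; cbn; ring).
    generalize (slope_zero n x y Hy); fold B; simpl.
    assert (0 <= c1 * Rpower (nrm (vsub y x)) b) by (apply Rmult_le_pos; [lra | left; apply exp_pos]).
    nra.
  - destruct (HA n x) as (E & HE & Ey).
    destruct (IH (n + k0)%nat (P n x)) as (l & Hl & Ly).
    destruct (St n x E l HE Hl) as (l' & Hl' & Sy).
    exists l'; split; [exact Hl' |]; intros y [hp Hy].
    specialize (Ly (P n y)); specialize (Ey y).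
    assert (kK : nrm (vsub (P n y) (P n x)) <= K * nrm (vsub y x)) by apply (ctr_tame _ _ _ _ _ _ C n).
    set (p := (1 / 2) ^ m) in *; replace ((1 / 2) ^ S m) with (p / 2) by (unfold p; simpl; field).
    assert (p0 : 0 < p) by (apply pow_lt; lra).
    destruct (Sy y Hy) as (q & q0 & qk & Q).
    assert (Bp : 0 < B * p) by (apply Rmult_lt_0_compat; lra).
    assert (rh : 0 < Rpower (nrm (vsub y x)) b) by apply exp_pos.
    destruct (Rle_lt_dec (nrm (vsub (P n y) (P n x))) r0) as [Hk | Hk].
    + assert (X1 : q * Rabs (tg (s (n + k0)%nat (P n x)) (s (n + k0)%nat (P n y)) - vdot l (vsub (P n y) (P n x)))
        <= (c1 * (2 * Rpower (nrm (vsub y x)) b) + B * p) * (nrm (vsub y x) / 4)).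
      (* The induction hypothesis concerns distinct points, as [Rpower 0 b] is 1 and not 0.
         Coinciding images make the inherited error vanish. *)
      { destruct (Rle_lt_or_eq_dec 0 (nrm (vsub (P n y) (P n x)))) as [kp | kz]; [apply nrm_pos | |].
        - apply Rle_trans with (q * ((c1 * (2 * Rpower (nrm (vsub y x)) b) + B * p) * nrm (vsub (P n y) (P n x)))).
          + apply Rmult_le_compat_l; [lra |]; eapply Rle_trans; [apply Ly; lra |].
            apply Rmult_le_compat_r; [lra |]; apply Rplus_le_compat_r, Rmult_le_compat_l; [lra |].
            eapply Rle_trans; [| apply HR, hp]; apply Rle_Rpower_l; lra.
          + match goal with |- q * (?u * ?v) <= _ => replace (q * (u * v)) with (u * (q * v)) by ring end.
            apply Rmult_le_compat_l; [| exact qk]; nra.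
        - symmetry in kz; apply nrm_eq0 in kz.
          assert (Pxy : P n y = P n x).
          { apply vsub_eq0, kz. }
          rewrite kz, Pxy; replace (tg _ _ - _) with 0.
          2:{ unfold tg, vdot, vzero; replace (cross _ _) with 0 by vec_ring; cbn; unfold Rdiv; ring. }
          rewrite Rabs_R0, Rmult_0_r; apply Rmult_le_pos; [nra | lra]. }
      eapply Rle_trans; [apply Q |].
      set (h := nrm (vsub y x)) in *; set (rho := Rpower h b) in *.
      assert (hr : h <= rho).
      { apply Rpower_ge_base; lra. }
      assert (X2 : c * (mnrm (msub (msub (A n y) (A n x)) (tv E (vsub y x))) + h ^ 2) <= c1 / 2 * rho * h).
      { apply Rle_trans with (c * (2 * K * h ^ 2)).
        - apply Rmult_le_compat_l; [lra |]; generalize (pow2_ge_0 h); nra.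
        - replace (c * (2 * K * h ^ 2)) with (2 * K * c * h * h) by ring.
          apply Rmult_le_compat_r; [lra |].
          apply Rle_trans with (c1 / 2 * h); [apply Rmult_le_compat_r; lra |].
          apply Rmult_le_compat_l; lra. }
      nra.
    (* The images are too far apart for the induction hypothesis, so the points are at distance at
       least [r0 / K]; the bounds on [tg] and on [l'] suffice there. *)
    + assert (hK : r0 / K <= nrm (vsub y x)).
      { apply (Rmult_le_reg_r K); [lra |]; unfold Rdiv; rewrite Rmult_assoc, Rinv_l; lra. }
      assert (rhoK : Rpower (r0 / K) b <= Rpower (nrm (vsub y x)) b) by (apply Rle_Rpower_l; lra).
      assert (T1 := slope_zero n x y Hy); fold B in T1.
      unfold Rminus; eapply Rle_trans; [apply Rabs_triang |]; rewrite Rabs_Ropp.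
      assert (V := vdot_le l' (vsub y x)).
      set (h := nrm (vsub y x)) in *; set (rho := Rpower h b) in *.
      assert (nrm l' * h <= B * h) by (apply Rmult_le_compat_r; lra).
      assert (2 * B <= c1 * rho).
      { apply Rle_trans with (2 * B / Rpower (r0 / K) b * Rpower (r0 / K) b).
        - right; field; lra.
        - apply Rmult_le_compat; try lra; left; apply Rdiv_lt_0_compat; lra. }
      nra.
Qed.

(** * Regularity of the projection onto the stable line *)

(* The product below is a coefficient of the orthogonal projection onto the
   line spanned by [s n y], which does not depend on the sign of [s n y]. *)
Lemma projection_expand e g n x y l : nrm (vsub y x) <= near_radius K ->
  Rabs (vdot e (s n y) * vdot g (s n y) - vdot e (s n x) * vdot g (s n x) -
    vdot (vscal (vdot e (s n x) * vdot g (rot (s n x)) + vdot e (rot (s n x)) * vdot g (s n x)) l)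
      (vsub y x)) <=
  8 * nrm e * nrm g * (Rabs (tg (s n x) (s n y) - vdot l (vsub y x)) +
    2 * (slope_bound K * nrm (vsub y x)) ^ 2).
Proof.
  intros H; assert (R0 := near_radius_pos).
  assert (H2 : nrm (vsub y x) <= 2 * K * near_radius K) by nra.
  destruct (tg_spec (s n x) (s n y)) as (N1 & _ & E1 & E2).
  1,2: apply C. { apply (near_cross), H2. }
  assert (T1 := slope_zero n x y H); assert (T2 := near_tg_small n x y H2).
  set (u := s n x) in *; set (v := s n y) in *; set (t := tg u v) in *.
  assert (su : nrm u <= 2) by apply (nrm_s).
  assert (sr : nrm (rot u) <= 2) by (rewrite nrm_rot; exact su).
  set (h := vsub y x) in *.
  set (W := vdot e u * vdot g (rot u) + vdot e (rot u) * vdot g u).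
  assert (dot : forall a z, nrm z <= 2 -> Rabs (vdot a z) <= 2 * nrm a).
  { intros a z Hz; eapply Rle_trans; [apply vdot_le |]; generalize (nrm_pos a); nra. }
  assert (prod : forall z z', nrm z <= 2 -> nrm z' <= 2 ->
    Rabs (vdot e z * vdot g z') <= 4 * nrm e * nrm g).
  { intros z z' Hz Hz'; rewrite Rabs_mult.
    replace (4 * nrm e * nrm g) with ((2 * nrm e) * (2 * nrm g)) by ring.
    apply Rmult_le_compat; auto using Rabs_pos. }
  assert (c0 : 0 <= nrm e * nrm g) by (apply Rmult_le_pos; apply nrm_pos).
  assert (WB : Rabs W <= 8 * nrm e * nrm g).
  { eapply Rle_trans; [apply Rabs_triang |].
    generalize (prod u (rot u) su sr) (prod (rot u) u sr su); lra. }
  set (d := vdot u v) in *.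
  assert (d2 : 0 <= d ^ 2 <= 1).
  { split; [apply pow2_ge_0 |]; generalize (pow2_ge_0 d) (pow2_ge_0 t); nra. }
  (* With [v = d * (u + t * rot u)] and [d ^ 2 * (1 + t ^ 2) = 1], the difference of the two
     products is [t * W] up to terms of order [t ^ 2]. *)
  replace (_ - _) with (W * (t - vdot l h) +
    d ^ 2 * (t ^ 2 * (vdot e (rot u) * vdot g (rot u) - vdot e u * vdot g u) - t ^ 3 * W)).
  2:{ transitivity (vdot e (vscal d (vadd u (vscal t (rot u)))) * vdot g (vscal d (vadd u (vscal t (rot u))))
        - d ^ 2 * (1 + t ^ 2) * (vdot e u * vdot g u) + (1 - d ^ 2 * (1 + t ^ 2)) * (t * W) - vdot (vscal W l) h).
      - unfold W; generalize d t (rot u); clear; vec_ring.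
      - rewrite <- E1, E2; ring. }
  eapply Rle_trans; [apply Rabs_triang |].
  rewrite Rmult_plus_distr_l; apply Rplus_le_compat.
  - rewrite Rabs_mult; apply Rmult_le_compat_r; [apply Rabs_pos | exact WB].
  - assert (t2 : 0 <= t ^ 2 <= (slope_bound K * nrm h) ^ 2).
    { split; [apply pow2_ge_0 |]; rewrite <- (pow2_abs t); apply pow_incr; split; [apply Rabs_pos | exact T1]. }
    rewrite Rabs_mult, (Rabs_right (d ^ 2)) by lra.
    assert (X : Rabs (t ^ 2 * (vdot e (rot u) * vdot g (rot u) - vdot e u * vdot g u) - t ^ 3 * W)
      <= 16 * nrm e * nrm g * t ^ 2).
    { unfold Rminus at 1; eapply Rle_trans; [apply Rabs_triang |]; rewrite Rabs_Ropp.
      replace (t ^ 3 * W) with (t ^ 2 * (t * W)) by ring.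
      rewrite !Rabs_mult, (Rabs_right (t ^ 2)) by lra.
      assert (Rabs (vdot e (rot u) * vdot g (rot u) - vdot e u * vdot g u) <= 8 * nrm e * nrm g).
      { unfold Rminus; eapply Rle_trans; [apply Rabs_triang |]; rewrite Rabs_Ropp.
        generalize (prod (rot u) (rot u) sr sr) (prod u u su su); lra. }
      assert (Rabs t * Rabs W <= 1 * (8 * nrm e * nrm g)) by (apply Rmult_le_compat; auto using Rabs_pos).
      nra. }
    apply Rle_trans with (1 * (16 * nrm e * nrm g * t ^ 2)).
    + apply Rmult_le_compat; auto using Rabs_pos; lra.
    + replace (8 * nrm e * nrm g * (2 * (slope_bound K * nrm h) ^ 2)) with
        (1 * (16 * nrm e * nrm g * (slope_bound K * nrm h) ^ 2)) by ring.
      apply Rmult_le_compat_l; [lra |]; apply Rmult_le_compat_l; lra.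
Qed.

Lemma projection_C1 n e g : (forall n, loc2 K (A n)) ->
  Ck 1 (fun y => vdot e (s n y) * vdot g (s n y)).
Proof.
  intros HA; apply C1_of_expansions; intros x0 e0 He0.
  assert (R0 := near_radius_pos).
  assert (N0 : 0 <= nrm e * nrm g) by (apply Rmult_le_pos; apply nrm_pos).
  set (c := 8 * nrm e * nrm g + 1); assert (c1 : 0 < c) by (unfold c; lra).
  set (B := slope_bound K).
  set (ep := e0 / (2 * c)); assert (ep0 : 0 < ep) by (apply Rdiv_lt_0_compat; lra).
  (* The number [m] of blocks is fixed first, to make the halved error small; only then is the
     radius for this [m] taken. *)
  destruct (half_pow_small B (ep / 2)) as (m & Hm); [lra |].
  destruct (slope_locally HA m n x0 (ep / 2)) as (d & d0 & Hd); [lra |]; fold B in Hd.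
  assert (B2 : 0 < 2 * B ^ 2 + 1) by (generalize (pow2_ge_0 B); lra).
  set (d' := Rmin d (Rmin (near_radius K) (ep / (2 * B ^ 2 + 1)))).
  assert (l1 : d' <= d) by apply Rmin_l.
  assert (l2 : d' <= near_radius K) by (eapply Rle_trans; [apply Rmin_r | apply Rmin_l]).
  assert (l3 : d' <= ep / (2 * B ^ 2 + 1)) by (eapply Rle_trans; [apply Rmin_r | apply Rmin_r]).
  exists d'; split.
  { repeat apply Rmin_glb_lt; [exact d0 | exact R0 | apply Rdiv_lt_0_compat; lra]. }
  intros x Hx; destruct (Hd x) as (l & _ & Hl); [lra |].
  eexists; intros y Hy; eapply Rle_trans; [apply (projection_expand e g n x y l); lra |].
  specialize (Hl y ltac:(lra)); fold B.
  set (h := nrm (vsub y x)) in *; assert (h0 : 0 <= h) by apply nrm_pos.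
  assert (X : 2 * (B * h) ^ 2 <= ep * h).
  { replace (2 * (B * h) ^ 2) with (2 * B ^ 2 * h * h) by ring.
    apply Rmult_le_compat_r; [exact h0 |].
    apply Rle_trans with ((2 * B ^ 2 + 1) * h); [apply Rmult_le_compat_r; lra |].
    replace ep with ((2 * B ^ 2 + 1) * (ep / (2 * B ^ 2 + 1))) by (field; lra).
    apply Rmult_le_compat_l; lra. }
  assert (Y : (B * (1 / 2) ^ m + ep / 2) * h <= ep * h) by (apply Rmult_le_compat_r; lra).
  replace (e0 * h) with (c * (2 * (ep * h))) by (unfold ep; field; lra).
  apply Rmult_le_compat; unfold c; try lra.
  generalize (Rabs_pos (tg (s n x) (s n y) - vdot l (vsub y x))) (pow2_ge_0 (B * h)); lra.
Qed.

Lemma projection_holder b n e g : 0 < b < 1 ->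
  (forall r, 0 < r -> Rpower (K * r) b <= 2 * Rpower r b) ->
  (forall n, glob2 K (A n)) -> Ck 1 (fun y => vdot e (s n y) * vdot g (s n y)) ->
  exists c, 0 <= c /\ forall x y, 0 < nrm (vsub y x) <= near_radius K / 2 ->
  Rabs (d1 (fun y => vdot e (s n y) * vdot g (s n y)) y -
        d1 (fun y => vdot e (s n y) * vdot g (s n y)) x) <= c * Rpower (2 * nrm (vsub y x)) b /\
  Rabs (d2 (fun y => vdot e (s n y) * vdot g (s n y)) y -
        d2 (fun y => vdot e (s n y) * vdot g (s n y)) x) <= c * Rpower (2 * nrm (vsub y x)) b.
Proof.
  intros Hb HR HA Cf; assert (R0 := near_radius_pos).
  destruct (slope_holder b Hb HR HA) as (c & c0 & Hc).
  assert (N0 : 0 <= nrm e * nrm g) by (apply Rmult_le_pos; apply nrm_pos).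
  set (B := slope_bound K) in *; assert (B2 := pow2_ge_0 B).
  set (c' := 8 * nrm e * nrm g * (c + 2 * B ^ 2)).
  assert (c'0 : 0 <= c') by (apply Rmult_le_pos; lra).
  exists (4 * c'); split; [lra |].
  apply (holder_of_expansions _ b c' (near_radius K) (8 * nrm e * nrm g * B)); try assumption; [lra |].
  intros m x; destruct (Hc m n x) as (l & _ & Hl).
  eexists; intros y Hy; eapply Rle_trans; [apply (projection_expand e g n x y l); lra |].
  specialize (Hl y Hy); fold B.
  assert (hr := Rpower_ge_base (nrm (vsub y x)) b ltac:(generalize (near_radius_le_1); lra) Hb).
  set (h := nrm (vsub y x)) in *; set (rho := Rpower h b) in *.
  assert (X : 2 * (B * h) ^ 2 <= 2 * B ^ 2 * rho * h).
  { replace (2 * (B * h) ^ 2) with (2 * B ^ 2 * h * h) by ring.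
    apply Rmult_le_compat_r; [lra |]; apply Rmult_le_compat_l; lra. }
  replace ((c' * rho + 8 * nrm e * nrm g * B * (1 / 2) ^ m) * h) with
    (8 * nrm e * nrm g * ((c * rho + B * (1 / 2) ^ m) * h + 2 * B ^ 2 * rho * h)) by (unfold c'; ring).
  apply Rmult_le_compat_l; lra.
Qed.

(** [nrm] is at most twice [enorm]: two points of the Euclidean ball of radius [near_radius K / 8]
    are at l1 distance at most [near_radius K / 2], and [2 * nrm] becomes [4 * enorm], whence the
    factor [Rpower 4 b]. *)
Lemma holder_on_of_bound x0 b c (f : vec -> R) : 0 < b -> 0 <= c ->
  (forall x y, 0 < nrm (vsub y x) <= near_radius K / 2 ->
    Rabs (f y - f x) <= c * Rpower (2 * nrm (vsub y x)) b) ->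
  holder_on x0 (near_radius K / 8) b f.
Proof.
  intros b0 c0 Hf; assert (R0 := near_radius_pos).
  exists (c * Rpower 4 b); unfold in_ball; intros y z Hy Hz N.
  assert (E0 : 0 < enorm (vsub y z)) by (apply enorm_neq0; intros E; apply N, vsub_eq0, E).
  assert (n0 := enorm_le_nrm (vsub y z)).
  assert (n1 := nrm_le_enorm (vsub y z)).
  assert (n2 : nrm (vsub y z) <= near_radius K / 2).
  { eapply Rle_trans; [apply (nrm_sub_triang y x0 z) |]; rewrite (nrm_sub_sym x0).
    generalize (nrm_le_enorm (vsub y x0)) (nrm_le_enorm (vsub z x0)); lra. }
  eapply Rle_trans; [apply Hf; lra |].
  rewrite Rmult_assoc, Rpower_mult_distr by lra.
  apply Rmult_le_compat_l; [exact c0 |]; apply Rle_Rpower_l; lra.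
Qed.
End Core.

Lemma cross_eq0_parallel u w : u <> vzero -> cross u w = 0 -> w = vscal (vdot u w / vdot u u) u.
Proof.
  intros Hu Hc.
  assert (D : vdot u u <> 0).
  { rewrite <- enorm_sqr; apply pow_nonzero; generalize (enorm_neq0 u Hu); lra. }
  assert (E : vscal (vdot u u) w = vadd (vscal (vdot u w) u) (vscal (cross u w) (rot u))).
  { unfold rot; vec_ring. }
  rewrite Hc in E.
  transitivity (vscal (/ vdot u u) (vscal (vdot u u) w)).
  - transitivity (vscal (/ vdot u u * vdot u u) w); [rewrite Rinv_l by exact D; vec_ring |].
    generalize (vdot u u); clear; vec_ring.
  - rewrite E; unfold Rdiv, rot; generalize (vdot u u) (vdot u w); clear; vec_ring.
Qed.

(** * Cones in coordinates *)

(* Up to the common factor [cross h v], [hcoord] and [vcoord] are the lengths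
   of the components of a vector along the lines spanned by [h] and [v]. *)
Definition hcoord (h v z : vec) : R := enorm h * cross z v.
Definition vcoord (h v z : vec) : R := enorm v * cross h z.

Definition is_frame (H V : subfield) (x h v : vec) : Prop :=
  cross h v <> 0 /\ spans H x h /\ spans V x v.

Lemma frame_exists H V x : line_splitting H V -> exists h v, is_frame H V x h v.
Proof.
  intros (_ & _ & S); destruct (S x) as ((h & h0 & Hh) & (v & v0 & Hv) & I & _).
  exists h, v; split; [| split; assumption]; intros Z.
  apply v0, I.
  - apply Hh; eexists; apply cross_eq0_parallel; eassumption.
  - apply Hv; exists 1; vec_ring.
Qed.

Lemma frame_decomp H V x h v z : is_frame H V x h v ->
  exists v1 v2, H x v1 /\ V x v2 /\ z = vadd v1 v2.
Proof.
  intros (c0 & Hh & Hv).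
  exists (vscal (cross z v / cross h v) h), (vscal (cross h z / cross h v) v).
  split; [apply Hh; eexists; reflexivity |]; split; [apply Hv; eexists; reflexivity |].
  transitivity (vscal (/ cross h v) (vadd (vscal (cross z v) h) (vscal (cross h z) v))).
  - transitivity (vscal (/ cross h v) (vscal (cross h v) z)).
    + transitivity (vscal (/ cross h v * cross h v) z); [rewrite Rinv_l by exact c0; vec_ring |].
      generalize (cross h v); clear; vec_ring.
    + f_equal; vec_ring.
  - unfold Rdiv; generalize (/ cross h v); vec_ring.
Qed.

Lemma frame_coords H V x h v z v1 v2 : is_frame H V x h v ->
  H x v1 -> V x v2 -> z = vadd v1 v2 ->
  Rabs (hcoord h v z) = Rabs (cross h v) * enorm v1 /\
  Rabs (vcoord h v z) = Rabs (cross h v) * enorm v2.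
Proof.
  intros (c0 & Hh & Hv) H1 H2 ->; apply Hh in H1; apply Hv in H2.
  destruct H1 as [a ->], H2 as [b ->]; unfold hcoord, vcoord.
  rewrite !enorm_scal, !Rabs_mult, !(Rabs_right (enorm _)) by (apply Rle_ge, enorm_pos).
  replace (cross (vadd (vscal a h) (vscal b v)) v) with (a * cross h v) by vec_ring.
  replace (cross h (vadd (vscal a h) (vscal b v))) with (b * cross h v) by vec_ring.
  rewrite !Rabs_mult; split; ring.
Qed.

Lemma frame_rel H V x h v z (Rel : R -> R -> Prop) : is_frame H V x h v ->
  (forall c a b, 0 < c -> (Rel a b <-> Rel (c * a) (c * b))) ->
  (exists v1 v2, H x v1 /\ V x v2 /\ z = vadd v1 v2 /\ Rel (enorm v1) (enorm v2)) <->
  Rel (Rabs (hcoord h v z)) (Rabs (vcoord h v z)).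
Proof.
  intros Fr Hom; assert (c0 : 0 < Rabs (cross h v)) by apply Rabs_pos_lt, Fr.
  split.
  - intros (v1 & v2 & H1 & H2 & E & HR).
    destruct (frame_coords _ _ _ _ _ _ _ _ Fr H1 H2 E) as [-> ->].
    exact (proj1 (Hom _ (enorm v1) (enorm v2) c0) HR).
  - intros HR; destruct (frame_decomp _ _ _ _ _ z Fr) as (v1 & v2 & H1 & H2 & E).
    exists v1, v2; repeat split; try assumption.
    destruct (frame_coords _ _ _ _ _ _ _ _ Fr H1 H2 E) as [E1 E2].
    rewrite E1, E2 in HR; exact (proj2 (Hom _ _ _ c0) HR).
Qed.

Section Cones.
Context {H V : subfield} {mu : R} {x h v : vec}.
Context (Fr : is_frame H V x h v).

Lemma Ks_coords z : Ks H V mu x z <-> Rabs (hcoord h v z) <= mu * Rabs (vcoord h v z).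
Proof.
  apply (frame_rel H V x h v z (fun a b => a <= mu * b) Fr).
  intros c a b c0; split; intros E.
  - replace (mu * (c * b)) with (c * (mu * b)) by ring; apply Rmult_le_compat_l; lra.
  - apply (Rmult_le_reg_l c); [exact c0 |]; lra.
Qed.

Lemma Ku_coords z : Ku H V mu x z <-> Rabs (vcoord h v z) <= mu * Rabs (hcoord h v z).
Proof.
  apply (frame_rel H V x h v z (fun a b => b <= mu * a) Fr).
  intros c a b c0; split; intros E.
  - replace (mu * (c * a)) with (c * (mu * a)) by ring; apply Rmult_le_compat_l; lra.
  - apply (Rmult_le_reg_l c); [exact c0 |]; lra.
Qed.

Lemma bdKu_coords z : bdKu H V mu x z <-> Rabs (vcoord h v z) = mu * Rabs (hcoord h v z).
Proof.
  apply (frame_rel H V x h v z (fun a b => b = mu * a) Fr).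
  intros c a b c0; split; intros E.
  - rewrite E; ring.
  - apply (Rmult_eq_reg_l c); lra.
Qed.

Lemma intKu_coords z : z <> vzero -> intKu H V mu x z ->
  Rabs (vcoord h v z) < mu * Rabs (hcoord h v z).
Proof.
  intros z0 [Z | I]; [contradiction |]; revert I.
  apply (frame_rel H V x h v z (fun a b => b < mu * a) Fr).
  intros c a b c0; split; intros E.
  - replace (mu * (c * a)) with (c * (mu * a)) by ring; apply Rmult_lt_compat_l; lra.
  - apply (Rmult_lt_reg_l c); [exact c0 |]; lra.
Qed.

Lemma coords_zero z : hcoord h v z = 0 -> vcoord h v z = 0 -> z = vzero.
Proof.
  intros E1 E2; destruct (frame_decomp _ _ _ _ _ z Fr) as (v1 & v2 & H1 & H2 & E).
  destruct (frame_coords _ _ _ _ _ _ _ _ Fr H1 H2 E) as [A B].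
  rewrite E1, Rabs_R0 in A; rewrite E2, Rabs_R0 in B.
  assert (c0 : 0 < Rabs (cross h v)) by apply Rabs_pos_lt, Fr.
  symmetry in A, B.
  apply Rmult_integral in A; apply Rmult_integral in B.
  rewrite E, (enorm_eq0 v1), (enorm_eq0 v2) by lra.
  unfold vadd, vzero; cbn; rewrite Rplus_0_r; reflexivity.
Qed.
End Cones.

Lemma hcoord_comb h v a b z w :
  hcoord h v (vadd (vscal a z) (vscal b w)) = a * hcoord h v z + b * hcoord h v w.
Proof. unfold hcoord; generalize (enorm h); vec_ring. Qed.

Lemma vcoord_comb h v a b z w :
  vcoord h v (vadd (vscal a z) (vscal b w)) = a * vcoord h v z + b * vcoord h v w.
Proof. unfold vcoord; generalize (enorm v); vec_ring. Qed.

Lemma Ks_scal H V mu x c z : line_splitting H V -> Ks H V mu x z -> Ks H V mu x (vscal c z).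
Proof.
  intros LS; destruct (frame_exists H V x LS) as (h & v & Fr).
  rewrite !(Ks_coords Fr); intros Hz.
  replace (hcoord h v (vscal c z)) with (c * hcoord h v z) by (unfold hcoord; generalize (enorm h); vec_ring).
  replace (vcoord h v (vscal c z)) with (c * vcoord h v z) by (unfold vcoord; generalize (enorm v); vec_ring).
  rewrite !Rabs_mult; replace (mu * (Rabs c * Rabs (vcoord h v z))) with
    (Rabs c * (mu * Rabs (vcoord h v z))) by ring.
  apply Rmult_le_compat_l; [apply Rabs_pos | exact Hz].
Qed.

Lemma intKs_Ks H V mu x z : line_splitting H V -> intKs H V mu x z -> Ks H V mu x z.
Proof.
  intros LS [-> | (v1 & v2 & H1 & H2 & E & L)].
  - destruct (frame_exists H V x LS) as (h & v & Fr); apply (Ks_coords Fr).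
    replace (hcoord h v vzero) with 0 by (unfold hcoord; replace (cross vzero v) with 0 by vec_ring; ring).
    replace (vcoord h v vzero) with 0 by (unfold vcoord; replace (cross h vzero) with 0 by vec_ring; ring).
    rewrite Rabs_R0; lra.
  - exists v1, v2; repeat split; auto; lra.
Qed.

Lemma intKu_Ku H V mu x z : line_splitting H V -> intKu H V mu x z -> Ku H V mu x z.
Proof.
  intros LS [-> | (v1 & v2 & H1 & H2 & E & L)].
  - destruct (frame_exists H V x LS) as (h & v & Fr); apply (Ku_coords Fr).
    replace (hcoord h v vzero) with 0 by (unfold hcoord; replace (cross vzero v) with 0 by vec_ring; ring).
    replace (vcoord h v vzero) with 0 by (unfold vcoord; replace (cross h vzero) with 0 by vec_ring; ring).
    rewrite Rabs_R0; lra.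
  - exists v1, v2; repeat split; auto; lra.
Qed.

Lemma vangle_dot p b a : p <> vzero -> b <> vzero -> 0 <= a <= PI -> a <= vangle p b ->
  vdot p b <= cos a * (enorm p * enorm b).
Proof.
  intros Hp Hb Ha Hang.
  assert (N : 0 < enorm p * enorm b) by (apply Rmult_lt_0_compat; apply enorm_neq0; assumption).
  set (r := vdot p b / (enorm p * enorm b)).
  assert (Er : vdot p b = r * (enorm p * enorm b)).
  { unfold r, Rdiv; rewrite Rmult_assoc, Rinv_l; lra. }
  assert (r1 : -1 <= r <= 1).
  { assert (r ^ 2 <= 1).
    { apply (Rmult_le_reg_r ((enorm p * enorm b) ^ 2)); [apply pow_lt; exact N |].
      replace (r ^ 2 * (enorm p * enorm b) ^ 2) with (vdot p b ^ 2) by (rewrite Er; ring).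
      rewrite Rmult_1_l, Rpow_mult_distr, !enorm_sqr, <- cross_sqr_vdot_sqr.
      generalize (pow2_ge_0 (cross p b)); lra. }
    nra. }
  rewrite Er; apply Rmult_le_compat_r; [lra |].
  rewrite <- (cos_acos r r1); apply cos_decr_1; try lra; try apply acos_bound.
  exact Hang.
Qed.

(* A segment joining [p] in the interior of [K^u] to [q] in [K^s] crosses the
   boundary of [K^u] at a point [b], and [angle(p, b) <= angle(p, q)]. *)
Lemma cone_transversal H V mu x al p q : 0 < mu < 1 -> line_splitting H V ->
  0 < al <= PI / 2 -> p <> vzero -> intKu H V mu x p -> Ks H V mu x q ->
  (forall b, bdKu H V mu x b -> b <> vzero -> al <= vangle p b) ->
  sin al * (enorm p * enorm q) <= Rabs (cross p q).
Proof.
  intros Hmu LS Hal Hp Ip Iq Hb.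
  destruct (frame_exists H V x LS) as (h & v & Fr).
  apply (intKu_coords Fr) in Ip; [| exact Hp]; apply (Ks_coords Fr) in Iq.
  (* Replacing [q] by its opposite if necessary, the angle between [p] and [q] is not obtuse. *)
  assert (Hcase : exists q', vdot p q' >= 0 /\ enorm q' = enorm q /\ Rabs (cross p q') = Rabs (cross p q)
    /\ Rabs (hcoord h v q') <= mu * Rabs (vcoord h v q')).
  { destruct (Rle_lt_dec 0 (vdot p q)) as [D | D].
    - exists q; repeat split; auto; lra.
    - exists (vscal (-1) q).
      replace (vdot p (vscal (-1) q)) with (- vdot p q) by vec_ring.
      replace (cross p (vscal (-1) q)) with (- cross p q) by vec_ring.
      replace (hcoord h v (vscal (-1) q)) with (- hcoord h v q) by (unfold hcoord; generalize (enorm h); vec_ring).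
      replace (vcoord h v (vscal (-1) q)) with (- vcoord h v q) by (unfold vcoord; generalize (enorm v); vec_ring).
      rewrite enorm_scal, Rabs_m1, !Rabs_Ropp; repeat split; auto; lra. }
  destruct Hcase as (q' & D & <- & <- & Iq'); clear Iq q.
  destruct (Req_dec (enorm q') 0) as [Z | Z].
  { rewrite Z, !Rmult_0_r; apply Rabs_pos. }
  assert (vq : vcoord h v q' <> 0).
  { intros E; rewrite E, Rabs_R0, Rmult_0_r in Iq'.
    apply Z; replace q' with vzero; [apply enorm_zero |]; symmetry; apply (coords_zero Fr); [| exact E].
    apply Rabs_eq_0; generalize (Rabs_pos (hcoord h v q')); lra. }
  set (z := fun t => vadd (vscal (1 - t) p) (vscal t q')).
  destruct (IVT (fun t => Rabs (vcoord h v (z t)) - mu * Rabs (hcoord h v (z t))) 0 1) as (t & Ht & Et).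
  - intros t; unfold z; apply continuity_pt_ext with (fun t =>
      Rabs ((1 - t) * vcoord h v p + t * vcoord h v q') - mu * Rabs ((1 - t) * hcoord h v p + t * hcoord h v q')).
    + intros r; rewrite vcoord_comb, hcoord_comb; reflexivity.
    + reg.
  - lra.
  - unfold z; rewrite vcoord_comb, hcoord_comb; replace (1 - 0) with 1 by ring.
    rewrite !Rmult_1_l, !Rmult_0_l, !Rplus_0_r; lra.
  - unfold z; rewrite vcoord_comb, hcoord_comb; replace (1 - 1) with 0 by ring.
    rewrite !Rmult_1_l, !Rmult_0_l, !Rplus_0_l.
    assert (vq' := Rabs_pos_lt _ vq).
    cut (mu * Rabs (hcoord h v q') < Rabs (vcoord h v q')); [lra |].
    apply Rle_lt_trans with (mu * (mu * Rabs (vcoord h v q'))).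
    + apply Rmult_le_compat_l; lra.
    + assert (mu * mu < 1) by nra; nra.
  - assert (t0 : t <> 0).
    { intros ->; unfold z in Et; rewrite vcoord_comb, hcoord_comb in Et.
      replace (1 - 0) with 1 in Et by ring; rewrite !Rmult_1_l, !Rmult_0_l, !Rplus_0_r in Et; lra. }
    set (b := z t) in *.
    (* Because [p] and [q'] form no obtuse angle, adding [(1 - t) * p] to [t * q'] does not shorten
       it. *)
    assert (bq : t * enorm q' <= enorm b).
    { assert (X : (t * enorm q') ^ 2 <= enorm b ^ 2).
      { rewrite Rpow_mult_distr, !enorm_sqr.
        replace (vdot b b) with ((1 - t) ^ 2 * vdot p p + 2 * t * (1 - t) * vdot p q' + t ^ 2 * vdot q' q')
          by (unfold b, z; vec_ring).
        assert (0 <= (1 - t) ^ 2 * vdot p p) by (rewrite <- enorm_sqr; apply Rmult_le_pos; apply pow2_ge_0).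
        assert (0 <= 2 * t * (1 - t) * vdot p q') by (apply Rmult_le_pos; nra).
        lra. }
      generalize (enorm_pos b); nra. }
    assert (q0 : 0 < enorm q') by (generalize (enorm_pos q'); lra).
    assert (b0 : 0 < enorm b) by nra.
    assert (bz : b <> vzero) by (intros E; rewrite E, enorm_zero in b0; lra).
    assert (PI0 := PI_RGT_0).
    assert (A1 : vdot p b <= cos al * (enorm p * enorm b)).
    { apply vangle_dot; auto; [lra |]; apply Hb; auto; apply (bdKu_coords Fr); lra. }
    (* The opposite of [b] also lies on the boundary. The two angle bounds together bound the
       absolute value of the cosine, and hence the sine from below. *)
    assert (A2 : vdot p (vscal (-1) b) <= cos al * (enorm p * enorm (vscal (-1) b))).
    { apply vangle_dot; auto; [| lra |].
      - intros E; apply bz; replace b with (vscal (-1) (vscal (-1) b)) by vec_ring; rewrite E; vec_ring.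
      - apply Hb.
        + apply (bdKu_coords Fr).
          replace (hcoord h v (vscal (-1) b)) with (- hcoord h v b) by (unfold hcoord; generalize (enorm h) b; clear; vec_ring).
          replace (vcoord h v (vscal (-1) b)) with (- vcoord h v b) by (unfold vcoord; generalize (enorm v) b; clear; vec_ring).
          rewrite !Rabs_Ropp; lra.
        + intros E; apply bz; replace b with (vscal (-1) (vscal (-1) b)) by (generalize b; clear; vec_ring); rewrite E; vec_ring. }
    rewrite enorm_scal, Rabs_m1, Rmult_1_l in A2.
    replace (vdot p (vscal (-1) b)) with (- vdot p b) in A2 by (generalize b; clear; vec_ring).
    assert (c0 : 0 <= cos al) by (apply cos_ge_0; lra).
    assert (s0 : 0 < sin al) by (apply sin_gt_0; lra).
    set (N := enorm p * enorm b) in *.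
    assert (N0 : 0 <= N) by (apply Rmult_le_pos; apply enorm_pos).
    assert (X : (sin al * N) ^ 2 <= cross p b ^ 2).
    { assert (E := cross_sqr_vdot_sqr p b); rewrite <- !enorm_sqr, <- Rpow_mult_distr in E; fold N in E.
      assert (vdot p b ^ 2 <= (cos al * N) ^ 2) by nra.
      assert (S := sin2_cos2 al); unfold Rsqr in S.
      replace ((sin al * N) ^ 2) with ((sin al * sin al) * N ^ 2) by ring.
      replace (sin al * sin al) with (1 - cos al * cos al) by lra.
      nra. }
    assert (Y : sin al * N <= t * Rabs (cross p q')).
    { replace (t * Rabs (cross p q')) with (Rabs (cross p b)).
      - rewrite <- (pow2_abs (cross p b)) in X; apply sqr_le_inv; [apply Rabs_pos | exact X].
      - replace (cross p b) with (t * cross p q') by (unfold b, z; vec_ring).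
        rewrite Rabs_mult, (Rabs_right t) by lra; reflexivity. }
    apply (Rmult_le_reg_l t); [lra |]; eapply Rle_trans; [| exact Y]; unfold N.
    replace (t * (sin al * (enorm p * enorm q'))) with (sin al * (enorm p * (t * enorm q'))) by ring.
    apply Rmult_le_compat_l; [lra |]; apply Rmult_le_compat_l; [apply enorm_pos | exact bq].
Qed.

(** * Iterates *)

Fixpoint Fit (F : nat -> vec -> vec) (n k : nat) (x : vec) : vec :=
  match k with O => x | S j => F (n + j)%nat (Fit F n j x) end.

Fixpoint MFit (F : nat -> vec -> vec) (n k : nat) (x : vec) : mat :=
  match k with O => mone | S j => mm (jac (F (n + j)%nat) (Fit F n j x)) (MFit F n j x) end.

Lemma Fit_add F n j k x : Fit F (n + j) k (Fit F n j x) = Fit F n (j + k) x.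
Proof.
  induction k as [| k IH]; [rewrite Nat.add_0_r; reflexivity |].
  rewrite Nat.add_succ_r; cbn [Fit]; rewrite IH, Nat.add_assoc; reflexivity.
Qed.

Lemma mm_assoc A B D : mm (mm A B) D = mm A (mm B D).
Proof. vec_ring. Qed.

Lemma mm_one_r A : mm A mone = A.
Proof. vec_ring. Qed.

Lemma mv_one u : mv mone u = u.
Proof. vec_ring. Qed.

Lemma MFit_add F n j k x :
  mm (MFit F (n + j) k (Fit F n j x)) (MFit F n j x) = MFit F n (j + k) x.
Proof.
  induction k as [| k IH].
  - rewrite Nat.add_0_r; cbn [MFit]; generalize (MFit F n j x); vec_ring.
  - rewrite Nat.add_succ_r; cbn [MFit].
    rewrite mm_assoc, IH, Fit_add, Nat.add_assoc; reflexivity.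
Qed.

Lemma msub_self A : msub A A = ((0, 0), (0, 0)).
Proof. vec_ring. Qed.

Lemma nrm_00 : nrm (0, 0) = 0.
Proof. unfold nrm; cbn; rewrite Rabs_R0; ring. Qed.

Lemma mnrm_0 : mnrm ((0, 0), (0, 0)) = 0.
Proof. unfold mnrm; cbn [fst snd]; rewrite nrm_00; ring. Qed.

Lemma tame_id : tame 2 (fun x => x) (fun _ => mone).
Proof.
  split; [| split; [| split]].
  - intros _; unfold mnrm, nrm, mone; cbn; rewrite Rabs_R0, Rabs_R1; lra.
  - intros x y; generalize (nrm_pos (vsub y x)); lra.
  - intros x y; rewrite msub_self, mnrm_0; generalize (nrm_pos (vsub y x)); lra.
  - intros x y; replace (vsub _ _) with (0, 0) by vec_ring; rewrite nrm_00.
    generalize (pow2_ge_0 (nrm (vsub y x))); lra.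
Qed.

Lemma mone_expand y x : msub (msub mone mone) (tv (((0, 0), (0, 0)), ((0, 0), (0, 0))) (vsub y x)) =
  ((0, 0), (0, 0)).
Proof. vec_ring. Qed.

Lemma tnrm_0 : tnrm (((0, 0), (0, 0)), ((0, 0), (0, 0))) = 0.
Proof. unfold tnrm; cbn [fst snd]; rewrite mnrm_0; ring. Qed.

Lemma loc2_id : loc2 2 (fun _ => mone).
Proof.
  intros x0 e He; exists 1; split; [lra |]; intros x _.
  eexists; split; [rewrite tnrm_0; lra |]; intros y _; rewrite mone_expand, mnrm_0.
  generalize (nrm_pos (vsub y x)); nra.
Qed.

Lemma glob2_id : glob2 2 (fun _ => mone).
Proof.
  intros x; eexists; split; [rewrite tnrm_0; lra |]; intros y; rewrite mone_expand, mnrm_0.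
  generalize (pow2_ge_0 (nrm (vsub y x))); nra.
Qed.

Lemma iterate_tame F K : 1 <= K -> (forall n, tame K (F n) (jac (F n))) ->
  forall k, exists L, 1 <= L /\ forall n, tame L (Fit F n k) (MFit F n k).
Proof.
  intros K1 T k; induction k as [| k (L & L1 & IH)].
  - exists 2; split; [lra |]; intros n; exact tame_id.
  - exists (2 * K * L ^ 2); split; [assert (1 <= L ^ 2) by nra; nra |]; intros n.
    exact (tame_comp L K _ _ _ _ L1 K1 (IH n) (T (n + k)%nat)).
Qed.

Lemma iterate_loc2 F K : 1 <= K -> (forall n, tame K (F n) (jac (F n))) ->
  (forall n, loc2 K (jac (F n))) ->
  forall k, exists L, forall n, loc2 L (MFit F n k).
Proof.
  intros K1 T D k; induction k as [| k (L & IH)].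
  - exists 2; intros n; exact loc2_id.
  - destruct (iterate_tame F K K1 T k) as (L' & L1 & T').
    assert (m1 := Rmax_l L L'); assert (m2 := Rmax_r L L').
    exists (2 * K * Rmax L L' ^ 2); intros n.
    refine (loc2_comp (Rmax L L') K _ _ _ _ _ K1 (tame_mono _ _ _ _ m2 (T' n))
      (T (n + k)%nat) (loc2_mono _ _ _ m1 (IH n)) (D (n + k)%nat)); lra.
Qed.

Lemma iterate_glob2 F K : 1 <= K -> (forall n, tame K (F n) (jac (F n))) ->
  (forall n, glob2 K (jac (F n))) ->
  forall k, exists L, forall n, glob2 L (MFit F n k).
Proof.
  intros K1 T D k; induction k as [| k (L & IH)].
  - exists 2; intros n; exact glob2_id.
  - destruct (iterate_tame F K K1 T k) as (L' & L1 & T').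
    assert (m1 := Rmax_l L L'); assert (m2 := Rmax_r L L').
    exists (4 * K * Rmax L L' ^ 3); intros n.
    refine (glob2_comp (Rmax L L') K _ _ _ _ _ K1 (tame_mono _ _ _ _ m2 (T' n))
      (T (n + k)%nat) (glob2_mono _ _ _ m1 (IH n)) (D (n + k)%nat)); lra.
Qed.

(** The product is the Jacobian of the composite by [tame_jac_eq], and the composite is the
    identity. *)
Lemma tame_left_inverse K L P Q A B : 1 <= K -> 1 <= L -> tame K P A -> tame L Q B ->
  (forall x, Q (P x) = x) -> forall x, mm (B (P x)) (A x) = mone.
Proof.
  intros K1 L1 TA TB E x.
  rewrite <- (tame_jac_eq _ _ _ x (tame_comp K L P Q A B K1 L1 TA TB)).
  unfold jac, mone, d1, d2, comp1, comp2; destruct x as [x1 x2]; cbn [fst snd].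
  rewrite !(Derive_ext (fun t => fst (Q (P (t, x2)))) (fun t => t)) by (intros t; rewrite E; reflexivity).
  rewrite !(Derive_ext (fun t => fst (Q (P (x1, t)))) (fun t => x1)) by (intros t; rewrite E; reflexivity).
  rewrite !(Derive_ext (fun t => snd (Q (P (t, x2)))) (fun t => x2)) by (intros t; rewrite E; reflexivity).
  rewrite !(Derive_ext (fun t => snd (Q (P (x1, t)))) (fun t => t)) by (intros t; rewrite E; reflexivity).
  rewrite !Derive_const, !Derive_id; reflexivity.
Qed.

(** * Stable lines *)

(** [cd_tr] is the quantitative form of the angle condition: after one map, an unstable vector makes
    an angle with sine at least [c0] with every vector of the stable cone. *)
Record cone_dynamics (F G : nat -> vec -> vec) (mu eta : R) (H V : subfield) (K c0 : R) : Prop := {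
  cd_split : line_splitting H V;
  cd_mu : 0 < mu < 1;
  cd_eta : 1 < eta;
  cd_K : 1 <= K;
  cd_c0 : 0 < c0;
  cd_FG : forall n x, F n (G n x) = x;
  cd_GF : forall n x, G n (F n x) = x;
  cd_tF : forall n, tame K (F n) (jac (F n));
  cd_tG : forall n, tame K (G n) (jac (G n));
  cd_u : forall n x u, Ku H V mu x u -> Ku H V mu (F n x) (mv (jac (F n) x) u);
  cd_s : forall n x u, Ks H V mu x u -> Ks H V mu (G n x) (mv (jac (G n) x) u);
  cd_gu : forall n x u, Ku H V mu x u -> eta * enorm u <= enorm (mv (jac (F n) x) u);
  cd_gs : forall n x u, Ks H V mu x u -> eta * enorm u <= enorm (mv (jac (G n) x) u);
  cd_tr : forall n x u q, Ku H V mu x u -> Ks H V mu (F n x) q ->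
    c0 * (enorm (mv (jac (F n) x) u) * enorm q) <= Rabs (cross (mv (jac (F n) x) u) q) }.

(** The stable direction described forwards: the whole future orbit of [u] stays in the stable
    cones. [Es_stab] relates it to the intersection of backward images. *)
Definition stab (F : nat -> vec -> vec) (H V : subfield) (mu : R) (n : nat) (x u : vec) : Prop :=
  forall k, Ks H V mu (Fit F n k x) (mv (MFit F n k x) u).

Lemma pow_unbounded eta b : 1 < eta -> exists k, b <= eta ^ k.
Proof.
  intros H; destruct (Pow_x_infinity eta) with (b := b) as (N & HN).
  { rewrite Rabs_right; lra. }
  exists N; specialize (HN N (le_n N)); rewrite Rabs_right in HN; [lra |].
  apply Rle_ge, pow_le; lra.
Qed.

Lemma unit_polar u : vdot u u = 1 -> exists t, - PI <= t <= PI /\ u = (cos t, sin t).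
Proof.
  destruct u as [a b]; unfold vdot; cbn [fst snd]; intros E.
  assert (a1 : -1 <= a <= 1) by nra.
  assert (A := acos_bound a).
  assert (S : sin (acos a) = Rabs b).
  { rewrite sin_acos by exact a1; replace (1 - Rsqr a) with (Rsqr b) by (unfold Rsqr; lra).
    apply sqrt_Rsqr_abs. }
  destruct (Rle_lt_dec 0 b) as [B | B].
  - exists (acos a); split; [lra |]; rewrite cos_acos, S, Rabs_right by lra; reflexivity.
  - exists (- acos a); split; [lra |].
    rewrite cos_neg, sin_neg, cos_acos, S, Rabs_left, Ropp_involutive by lra; reflexivity.
Qed.

Section Stable.
Context {F G : nat -> vec -> vec} {mu eta : R} {H V : subfield} {K c0 : R}.
Context (D : cone_dynamics F G mu eta H V K c0).
Let K1 : 1 <= K := cd_K _ _ _ _ _ _ _ _ D.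
Let LS : line_splitting H V := cd_split _ _ _ _ _ _ _ _ D.
Let eta1 : 1 < eta := cd_eta _ _ _ _ _ _ _ _ D.

Lemma jac_FG n x : mm (jac (F n) (G n x)) (jac (G n) x) = mone.
Proof.
  exact (tame_left_inverse _ _ _ _ _ _ K1 K1 (cd_tG _ _ _ _ _ _ _ _ D n)
    (cd_tF _ _ _ _ _ _ _ _ D n) (cd_FG _ _ _ _ _ _ _ _ D n) x).
Qed.

Lemma jac_GF n x : mm (jac (G n) (F n x)) (jac (F n) x) = mone.
Proof.
  exact (tame_left_inverse _ _ _ _ _ _ K1 K1 (cd_tF _ _ _ _ _ _ _ _ D n)
    (cd_tG _ _ _ _ _ _ _ _ D n) (cd_GF _ _ _ _ _ _ _ _ D n) x).
Qed.

Lemma mv_GF n x u : mv (jac (G n) (F n x)) (mv (jac (F n) x) u) = u.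
Proof. rewrite <- mv_mm, jac_GF; apply mv_one. Qed.

Lemma mv_FG n x u : mv (jac (F n) x) (mv (jac (G n) (F n x)) u) = u.
Proof.
  assert (E := jac_FG n (F n x)); rewrite (cd_GF _ _ _ _ _ _ _ _ D) in E.
  rewrite <- mv_mm, E; apply mv_one.
Qed.

(** The inverse maps preserve the stable cones, so a vector in the cone at time [k] comes from one
    whose orbit is in the cones at all earlier times. *)
Lemma pullback n x k w : Ks H V mu (Fit F n k x) w ->
  exists u, w = mv (MFit F n k x) u /\
  forall j, (j <= k)%nat -> Ks H V mu (Fit F n j x) (mv (MFit F n j x) u).
Proof.
  revert w; induction k as [| k IH]; intros w Hw.
  - exists w; split; [symmetry; apply mv_one |]; intros j Hj; replace j with 0%nat by lia.
    cbn [Fit MFit]; rewrite mv_one; exact Hw.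
  - cbn [Fit] in Hw; assert (Hw' := cd_s _ _ _ _ _ _ _ _ D (n + k)%nat _ _ Hw).
    rewrite (cd_GF _ _ _ _ _ _ _ _ D) in Hw'.
    destruct (IH _ Hw') as (u & Eu & Hu); exists u.
    assert (Ew : w = mv (MFit F n (S k) x) u).
    { cbn [MFit]; rewrite mv_mm, <- Eu, mv_FG; reflexivity. }
    split; [exact Ew |]; intros j Hj.
    destruct (Nat.eq_dec j (S k)) as [-> | N]; [rewrite <- Ew; exact Hw | apply Hu; lia].
Qed.

(** Pull back a vector of [V] from time [k] and normalize. The unit vector is given by its angle so
    that compactness of a real interval applies to the sequence in [k]. *)
Lemma finite_stable n x k : exists t, - PI <= t <= PI /\
  forall j, (j <= k)%nat -> Ks H V mu (Fit F n j x) (mv (MFit F n j x) (cos t, sin t)).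
Proof.
  destruct (proj2 (proj2 LS) (Fit F n k x)) as ((h & _ & Hh) & (v & v0 & Hv) & _).
  destruct (pullback n x k v) as (u & Eu & Hu).
  { exists (vscal 0 v), v; split; [apply Hh; exists 0; vec_ring |].
    split; [apply Hv; exists 1; vec_ring |]; split; [vec_ring |].
    rewrite enorm_scal, Rabs_R0, Rmult_0_l; apply Rmult_le_pos; [generalize (cd_mu _ _ _ _ _ _ _ _ D); lra | apply enorm_pos]. }
  assert (u0 : 0 < enorm u).
  { apply enorm_neq0; intros ->; apply v0; rewrite Eu; generalize (MFit F n k x); vec_ring. }
  destruct (unit_polar (vscal (/ enorm u) u)) as (t & Ht & Et).
  { transitivity (/ enorm u * / enorm u * vdot u u); [generalize (/ enorm u); vec_ring |].
    rewrite <- enorm_sqr; field; lra. }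
  exists t; split; [exact Ht |]; intros j Hj; rewrite <- Et, mv_scal.
  apply Ks_scal, Hu; assumption.
Qed.

Lemma stable_exists n x : exists u, vdot u u = 1 /\ stab F H V mu n x u.
Proof.
  set (th := fun k => proj1_sig (constructive_indefinite_description _ (finite_stable n x k))).
  assert (Hth : forall k, - PI <= th k <= PI /\ forall j, (j <= k)%nat ->
    Ks H V mu (Fit F n j x) (mv (MFit F n j x) (cos (th k), sin (th k)))).
  { intros k; exact (proj2_sig (constructive_indefinite_description _ (finite_stable n x k))). }
  destruct (Bolzano_Weierstrass th (fun t => - PI <= t <= PI) (compact_P3 (- PI) PI)
    (fun k => proj1 (Hth k))) as (l & Hl).
  exists (cos l, sin l); split.
  { unfold vdot; cbn [fst snd]; generalize (sin2_cos2 l); unfold Rsqr; lra. }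
  intros k; destruct (frame_exists H V (Fit F n k x) LS) as (h & v & Fr).
  apply (Ks_coords Fr); set (M := MFit F n k x) in *.
  set (phi := fun t => Rabs (hcoord h v (mv M (cos t, sin t))) - mu * Rabs (vcoord h v (mv M (cos t, sin t)))).
  assert (E : forall t, mv M (cos t, sin t) =
    vadd (vscal (cos t) (mv M (1, 0))) (vscal (sin t) (mv M (0, 1)))).
  { intros t; generalize M (cos t) (sin t); clear; vec_ring. }
  assert (Cphi : continuity_pt phi l).
  { apply continuity_pt_ext with (fun t =>
      Rabs (cos t * hcoord h v (mv M (1, 0)) + sin t * hcoord h v (mv M (0, 1))) -
      mu * Rabs (cos t * vcoord h v (mv M (1, 0)) + sin t * vcoord h v (mv M (0, 1)))).
    - intros t; unfold phi; rewrite E, hcoord_comb, vcoord_comb; reflexivity.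
    - reg. }
  (* Were [phi] positive at the limit angle, it would be positive at nearby angles [th p] with
     [p >= k], where the cone condition at time [k] makes it nonpositive. *)
  apply Rnot_lt_le; intros L.
  assert (P0 : 0 < phi l) by (unfold phi; lra).
  destruct (Cphi (phi l) P0) as (d & d0 & Hd).
  destruct (Hl (disc l (mkposreal d d0)) k) as (p & Hp & Dp).
  { exists (mkposreal d d0); intros t Ht; exact Ht. }
  assert (Pp : phi (th p) <= 0).
  { assert (S := proj2 (Hth p) k Hp); apply (Ks_coords Fr) in S; unfold phi; fold M in S; lra. }
  destruct (Req_dec (th p) l) as [Z | Z]; [rewrite Z in Pp; lra |].
  specialize (Hd (th p)); cbn in Hd; unfold R_dist, D_x, no_cond in Hd; unfold disc in Dp; cbn in Dp.
  assert (X : Rabs (phi (th p) - phi l) < phi l).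
  { apply Hd; split; [split; [exact I | intros Y; apply Z; symmetry; exact Y] | exact Dp]. }
  apply Rabs_def2 in X; lra.
Qed.

Lemma unstable_growth n x u : Ku H V mu x u -> forall k,
  Ku H V mu (Fit F n k x) (mv (MFit F n k x) u) /\ eta ^ k * enorm u <= enorm (mv (MFit F n k x) u).
Proof.
  intros Hu k; induction k as [| k [IH1 IH2]]; cbn [Fit MFit].
  - rewrite mv_one; simpl; split; [exact Hu | lra].
  - rewrite mv_mm; split; [apply (cd_u _ _ _ _ _ _ _ _ D), IH1 |].
    eapply Rle_trans; [| apply (cd_gu _ _ _ _ _ _ _ _ D), IH1].
    simpl; rewrite Rmult_assoc; apply Rmult_le_compat_l; lra.
Qed.

Lemma stable_decay n x u : stab F H V mu n x u -> forall k,
  eta ^ k * enorm (mv (MFit F n k x) u) <= enorm u.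
Proof.
  intros Hu k; induction k as [| k IH]; [cbn [MFit]; rewrite mv_one; simpl; lra |].
  assert (S := cd_gs _ _ _ _ _ _ _ _ D (n + k)%nat _ _ (Hu (S k))); cbn [Fit MFit] in *.
  rewrite mv_mm, mv_GF in S; rewrite mv_mm.
  eapply Rle_trans; [| exact IH]; simpl.
  rewrite (Rmult_comm eta), Rmult_assoc; apply Rmult_le_compat_l; [apply pow_le; lra | exact S].
Qed.

Lemma unstable_exists x : exists u, u <> vzero /\ Ku H V mu x u.
Proof.
  destruct (proj2 (proj2 LS) x) as ((h & h0 & Hh) & (v & _ & Hv) & _).
  exists h; split; [exact h0 |]; exists h, (vscal 0 v).
  split; [apply Hh; exists 1; vec_ring |]; split; [apply Hv; exists 0; vec_ring |].
  split; [vec_ring |].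
  rewrite enorm_scal, Rabs_R0, Rmult_0_l; apply Rmult_le_pos; [generalize (cd_mu _ _ _ _ _ _ _ _ D); lra | apply enorm_pos].
Qed.

(** Two independent stable vectors would span the plane, so all iterates of every vector would stay
    bounded; those of an unstable vector grow like [eta ^ k]. *)
Lemma stable_unique n x u w : stab F H V mu n x u -> stab F H V mu n x w -> cross u w = 0.
Proof.
  intros Hu Hw; destruct (Req_dec (cross u w) 0) as [Z | Z]; [exact Z | exfalso].
  destruct (unstable_exists x) as (z & z0 & Hz); apply enorm_neq0 in z0.
  set (a := cross z w / cross u w); set (b := cross u z / cross u w).
  assert (Ez : z = vadd (vscal a u) (vscal b w)).
  { transitivity (vscal (/ cross u w) (vscal (cross u w) z)).
    - transitivity (vscal (/ cross u w * cross u w) z); [rewrite Rinv_l by exact Z; vec_ring |].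
      generalize (cross u w); clear; vec_ring.
    - replace (vscal (cross u w) z) with (vadd (vscal (cross z w) u) (vscal (cross u z) w)) by (clear; vec_ring).
      unfold a, b, Rdiv; generalize (/ cross u w) (cross z w) (cross u z); clear; vec_ring. }
  set (c := 2 * Rabs a * enorm u + 2 * Rabs b * enorm w).
  destruct (pow_unbounded eta (c / enorm z + 1) eta1) as (k & Hk).
  destruct (unstable_growth n x z Hz k) as [_ Gz].
  assert (Du := stable_decay n x u Hu k); assert (Dw := stable_decay n x w Hw k).
  assert (p1 : 1 <= eta ^ k) by (apply pow_R1_Rle; lra).
  assert (X : enorm (mv (MFit F n k x) z) <= c).
  { eapply Rle_trans; [apply enorm_le_nrm |]; rewrite Ez, mv_add, !mv_scal.
    eapply Rle_trans; [apply nrm_add |]; rewrite !nrm_scal.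
    assert (L : forall v, eta ^ k * enorm (mv (MFit F n k x) v) <= enorm v ->
      nrm (mv (MFit F n k x) v) <= 2 * enorm v).
    { intros v Hv; eapply Rle_trans; [apply nrm_le_enorm |].
      generalize (enorm_pos (mv (MFit F n k x) v)); nra. }
    unfold c; generalize (L u Du) (L w Dw) (Rabs_pos a) (Rabs_pos b); nra. }
  assert (Y : (c / enorm z + 1) * enorm z <= eta ^ k * enorm z) by (apply Rmult_le_compat_r; lra).
  replace ((c / enorm z + 1) * enorm z) with (c + enorm z) in Y by (field; lra).
  lra.
Qed.

Lemma stab_scal n x c u : stab F H V mu n x u -> stab F H V mu n x (vscal c u).
Proof. intros Hu k; rewrite mv_scal; apply Ks_scal; [exact LS | apply Hu]. Qed.

Lemma stab_push n j x u : stab F H V mu n x u ->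
  stab F H V mu (n + j) (Fit F n j x) (mv (MFit F n j x) u).
Proof.
  intros Hu k; rewrite <- mv_mm, MFit_add, Fit_add; apply Hu.
Qed.

Definition stable_vec (n : nat) (x : vec) : vec :=
  proj1_sig (constructive_indefinite_description _ (stable_exists n x)).

Lemma stable_vec_unit n x : vdot (stable_vec n x) (stable_vec n x) = 1.
Proof. exact (proj1 (proj2_sig (constructive_indefinite_description _ (stable_exists n x)))). Qed.

Lemma stable_vec_stab n x : stab F H V mu n x (stable_vec n x).
Proof. exact (proj2 (proj2_sig (constructive_indefinite_description _ (stable_exists n x)))). Qed.

Lemma stab_stable_vec n x u : stab F H V mu n x u <-> u = vscal (vdot (stable_vec n x) u) (stable_vec n x).
Proof.
  split; intros Hu.
  - assert (Un := stable_vec_unit n x).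
    assert (N : stable_vec n x <> vzero).
    { intros E; rewrite E in Un; unfold vdot, vzero in Un; cbn in Un; lra. }
    assert (E := cross_eq0_parallel _ _ N (stable_unique n x _ _ (stable_vec_stab n x) Hu)).
    rewrite Un in E; unfold Rdiv in E; rewrite Rinv_1, Rmult_1_r in E; exact E.
  - rewrite Hu; apply stab_scal, stable_vec_stab.
Qed.

Definition stable_rate (k n : nat) (x : vec) : R :=
  vdot (stable_vec (n + k) (Fit F n k x)) (mv (MFit F n k x) (stable_vec n x)).

Lemma det_jac n x : 1 <= K ^ 2 * Rabs (mdet (jac (F n) x)).
Proof.
  assert (E : Rabs (mdet (jac (G n) (F n x))) * Rabs (mdet (jac (F n) x)) = 1).
  { rewrite <- Rabs_mult, <- mdet_mm, jac_GF; unfold mdet, cross, mone; cbn.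
    replace (1 * 1 - 0 * 0) with 1 by ring; apply Rabs_R1. }
  rewrite <- E; apply Rmult_le_compat_r; [apply Rabs_pos |].
  eapply Rle_trans; [apply mdet_le |]; replace (K ^ 2) with (K * K) by ring.
  apply Rmult_le_compat; auto using mnrm_pos; apply (cd_tG _ _ _ _ _ _ _ _ D).
Qed.

Lemma det_MFit n k x : 1 <= (K ^ 2) ^ k * Rabs (mdet (MFit F n k x)).
Proof.
  induction k as [| k IH].
  - cbn [MFit]; unfold mdet, cross, mone; cbn; replace (1 * 1 - 0 * 0) with 1 by ring.
    rewrite Rabs_R1; lra.
  - cbn [MFit]; rewrite mdet_mm, Rabs_mult.
    replace ((K ^ 2) ^ S k * (Rabs (mdet (jac (F (n + k)%nat) (Fit F n k x))) * Rabs (mdet (MFit F n k x))))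
      with ((K ^ 2 * Rabs (mdet (jac (F (n + k)%nat) (Fit F n k x)))) * ((K ^ 2) ^ k * Rabs (mdet (MFit F n k x))))
      by (simpl; ring).
    generalize (det_jac (n + k) (Fit F n k x)); nra.
Qed.

Lemma stable_rate_inv k n x : mv (MFit F n k x) (stable_vec n x) =
  vscal (stable_rate k n x) (stable_vec (n + k) (Fit F n k x)).
Proof. apply stab_stable_vec, stab_push, stable_vec_stab. Qed.

Lemma enorm_unit u : vdot u u = 1 -> enorm u = 1.
Proof. intros E; apply enorm_unique; [lra |]; rewrite E; ring. Qed.

Lemma stable_rate_decay k n x : eta ^ k * Rabs (stable_rate k n x) <= 1.
Proof.
  assert (E := stable_decay n x _ (stable_vec_stab n x) k).
  rewrite stable_rate_inv, enorm_scal, !enorm_unit, Rmult_1_r in E by apply stable_vec_unit.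
  exact E.
Qed.

(* In the basis [u, s] with [u] unstable and [s] stable, [det M] and [|M|] are
   comparable to [nu |M u|] and [|M u|] because [M u] and [M s] are transverse. *)
Lemma stable_rate_norm k n x :
  Rabs (stable_rate (S k) n x) * mnrm (MFit F n (S k) x) <=
  24 / c0 * Rabs (mdet (MFit F n (S k) x)).
Proof.
  assert (c0p := cd_c0 _ _ _ _ _ _ _ _ D).
  destruct (unstable_exists x) as (u & u0 & Hu).
  assert (Inv := stable_rate_inv (S k) n x).
  assert (Tr : c0 * (enorm (mv (MFit F n (S k) x) u) * enorm (mv (MFit F n (S k) x) (stable_vec n x)))
    <= Rabs (cross (mv (MFit F n (S k) x) u) (mv (MFit F n (S k) x) (stable_vec n x)))).
  { assert (S1 := stable_vec_stab n x (S k)).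
    set (q := mv (MFit F n (S k) x) (stable_vec n x)) in *.
    (* Blocks have length [S k], so that [M u] is the image of an unstable vector under a last map
       and transversality applies. *)
    cbn [MFit]; rewrite mv_mm; apply (cd_tr _ _ _ _ _ _ _ _ D); [apply unstable_growth, Hu | exact S1]. }
  destruct (unstable_growth n x u Hu (S k)) as [_ Gr].
  assert (Dt := det_MFit n (S k) x).
  assert (p1 : 1 <= eta ^ S k) by (apply pow_R1_Rle; lra).
  assert (Un := stable_vec_unit n x).
  assert (Rd := stable_rate_decay (S k) n x).
  set (M := MFit F n (S k) x) in *; set (s := stable_vec n x) in *.
  set (nu := stable_rate (S k) n x) in *.
  assert (Eq : enorm (mv M s) = Rabs nu).
  { rewrite Inv, enorm_scal, enorm_unit, Rmult_1_r by apply stable_vec_unit; reflexivity. }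
  rewrite Eq, cross_mv, Rabs_mult in Tr.
  apply enorm_neq0 in u0.
  assert (D0 : 0 < Rabs (mdet M)).
  { destruct (Rle_lt_or_eq_dec 0 _ (Rabs_pos (mdet M))) as [L | E]; [exact L | rewrite <- E in Dt; lra]. }
  assert (Mu0 : 0 < enorm (mv M u)) by nra.
  assert (nu1 : Rabs nu <= 1) by (generalize (Rabs_pos nu); nra).
  (* If [u] and [s] were parallel, transversality of their images would force [nu = 0], and [s]
     would be in the kernel of the invertible [M]. *)
  assert (X : 0 < Rabs (cross u s)).
  { apply Rabs_pos_lt; intros Z; rewrite Z, Rabs_R0, Rmult_0_r in Tr.
    assert (nu0 : Rabs nu = 0).
    { generalize (Rabs_pos nu); intros [L | L]; [| symmetry; exact L].
      assert (0 < c0 * (enorm (mv M u) * Rabs nu)) by (repeat apply Rmult_lt_0_compat; assumption).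
      lra. }
    rewrite nu0 in Eq; apply enorm_eq0 in Eq.
    assert (Z2 : cross (mv M (rot s)) (mv M s) = 0) by (rewrite Eq; generalize (mv M (rot s)); vec_ring).
    rewrite cross_mv in Z2; replace (cross (rot s) s) with (-1) in Z2.
    - assert (mdet M = 0) by lra; rewrite H0, Rabs_R0 in D0; lra.
    - transitivity (- vdot s s); [rewrite Un; ring | unfold rot; generalize s; clear; vec_ring]. }
  (* Cramer's rule writes [cross u s] times [z] in the basis [u], [s]. The image of [s] has length
     at most 1 and [u] is not contracted, so [M u] dominates. *)
  assert (Col : forall z, nrm z = 1 -> nrm (mv M z) * Rabs (cross u s) <= 6 * nrm (mv M u)).
  { intros z Hz.
    rewrite Rmult_comm, <- nrm_scal.
    replace (vscal (cross u s) (mv M z)) with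
      (vadd (vscal (cross z s) (mv M u)) (vscal (cross u z) (mv M s))) by (generalize M s; clear; vec_ring).
    eapply Rle_trans; [apply nrm_add |]; rewrite !nrm_scal.
    assert (B1 := cross_le z s); assert (B2 := cross_le u z); rewrite Hz in B1, B2.
    assert (s2 := nrm_unit s Un).
    assert (u2 : nrm u <= 2 * nrm (mv M u)).
    { eapply Rle_trans; [apply nrm_le_enorm |]; generalize (enorm_le_nrm (mv M u)); nra. }
    assert (m2 : nrm (mv M s) <= 2) by (eapply Rle_trans; [apply nrm_le_enorm |]; rewrite Eq; lra).
    assert (Rabs (cross z s) * nrm (mv M u) <= 2 * nrm (mv M u)).
    { apply Rmult_le_compat_r; [apply nrm_pos | lra]. }
    assert (Rabs (cross u z) * nrm (mv M s) <= (2 * nrm (mv M u)) * 2).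
    { apply Rmult_le_compat; auto using Rabs_pos, nrm_pos; lra. }
    lra. }
  assert (e1 : nrm (1, 0) = 1) by (unfold nrm; cbn; rewrite Rabs_R0, Rabs_R1; ring).
  assert (e2 : nrm (0, 1) = 1) by (unfold nrm; cbn; rewrite Rabs_R0, Rabs_R1; ring).
  assert (MN : mnrm M * Rabs (cross u s) <= 12 * nrm (mv M u)).
  { replace (mnrm M) with (nrm (mv M (1, 0)) + nrm (mv M (0, 1))).
    - generalize (Col _ e1) (Col _ e2); lra.
    - generalize M; clear; intros [[a b] [c d]]; unfold mnrm, nrm, mv, vdot; cbn [fst snd].
      rewrite !Rmult_1_r, !Rmult_0_r, !Rplus_0_r, !Rplus_0_l; ring. }
  apply (Rmult_le_reg_r (Rabs (cross u s))); [exact X |].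
  apply Rle_trans with (Rabs nu * (12 * (2 * enorm (mv M u)))).
  - rewrite Rmult_assoc; apply Rmult_le_compat_l; [apply Rabs_pos |].
    eapply Rle_trans; [exact MN |]; generalize (nrm_le_enorm (mv M u)); lra.
  - apply (Rmult_le_reg_l c0); [exact c0p |].
    replace (c0 * (24 / c0 * Rabs (mdet M) * Rabs (cross u s))) with (24 * (Rabs (mdet M) * Rabs (cross u s))) by (field; lra).
    replace (c0 * (Rabs nu * (12 * (2 * enorm (mv M u))))) with (24 * (c0 * (enorm (mv M u) * Rabs nu))) by ring.
    apply Rmult_le_compat_l; [lra | exact Tr].
Qed.

(** The length [k] is fixed before the constant. [J] stays free above [L], so that it can later be
    raised to dominate the second-order constants of blocks of this length. *)
Lemma stable_contracting : exists k L, forall J, L <= J ->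
  contracting k J stable_vec (stable_rate k) (fun n => Fit F n k) (fun n => MFit F n k).
Proof.
  assert (c0p := cd_c0 _ _ _ _ _ _ _ _ D).
  (* [192 = 8 * 24] turns the bound of [stable_rate_norm] into [ctr_rate]. The summand 2 is for
     [ctr_norm]: an unstable vector is stretched at least twice, which offsets the factor between
     the norms. *)
  destruct (pow_unbounded eta (192 / c0 + 2) eta1) as (k & Hk).
  assert (q0 : 0 < 192 / c0) by (apply Rdiv_lt_0_compat; lra).
  destruct (iterate_tame F K K1 (cd_tF _ _ _ _ _ _ _ _ D) (S k)) as (L & L1 & TL).
  assert (Hk' : 192 / c0 + 2 <= eta ^ S k).
  { simpl; generalize (pow_R1_Rle eta k); intros; nra. }
  exists (S k), (Rmax L ((K ^ 2) ^ S k)); intros J HJ.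
  assert (J1 : L <= J) by (eapply Rle_trans; [apply Rmax_l | exact HJ]).
  assert (J2 : (K ^ 2) ^ S k <= J) by (eapply Rle_trans; [apply Rmax_r | exact HJ]).
  split.
  - lra.
  - intros n; apply tame_mono with L; auto.
  - apply stable_vec_unit.
  - intros n x; apply stable_rate_inv.
  - intros n x; destruct (unstable_exists x) as (u & u0 & Hu); apply enorm_neq0 in u0.
    destruct (unstable_growth n x u Hu (S k)) as [_ Gr].
    assert (X := Rle_trans _ _ _ (enorm_le_nrm _) (nrm_mv (MFit F n (S k) x) u)).
    assert (Y := nrm_le_enorm u).
    assert (mnrm (MFit F n (S k) x) * nrm u <= mnrm (MFit F n (S k) x) * (2 * enorm u)).
    { apply Rmult_le_compat_l; [apply mnrm_pos | exact Y]. }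
    assert (2 * enorm u <= eta ^ S k * enorm u) by (apply Rmult_le_compat_r; lra).
    apply (Rmult_le_reg_r (2 * enorm u)); lra.
  - intros n x; eapply Rle_trans; [apply (det_MFit n (S k) x) |].
    apply Rmult_le_compat_r; [apply Rabs_pos | exact J2].
  - intros n x y.
    assert (N := stable_rate_norm k n x); assert (Rd := stable_rate_decay (S k) n y).
    set (d := Rabs (mdet (MFit F n (S k) x))) in *.
    assert (d0 : 0 <= d) by apply Rabs_pos.
    assert (r0 := Rabs_pos (stable_rate (S k) n y)).
    set (r := Rabs (stable_rate (S k) n y)) in *.
    assert (192 / c0 * r <= 1) by nra.
    replace (_ * r * _) with (r * (Rabs (stable_rate (S k) n x) * mnrm (MFit F n (S k) x))) by ring.
    apply Rle_trans with (r * (24 / c0 * d)); [apply Rmult_le_compat_l; assumption |].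
    replace (r * (24 / c0 * d)) with (192 / c0 * r * (d / 8)) by (field; lra).
    rewrite <- (Rmult_1_l (d / 8)) at 2; apply Rmult_le_compat_r; lra.
Qed.
End Stable.

(** * The stable bundle *)

Lemma cone_dynamics_of_condition F G mu eta H V M :
  (forall n, torus_Ck_diffeo 2 (F n) (G n)) -> cone_condition_with F G mu eta H V ->
  (forall n, DerivBoundV 2 M (F n) /\ DerivBoundV 2 M (G n)) ->
  exists c0, cone_dynamics F G mu eta H V (4 * M + 1) c0.
Proof.
  intros HD (Hmu & Heta & LS & (al & al0 & Hal) & Hgu & Hgs) HM.
  assert (M0 : 0 <= M) by exact (DerivBound_pos _ _ _ (proj1 (proj1 (HM 0%nat)))).
  assert (PI0 := PI_RGT_0).
  (* Lowering the angle to at most a right angle makes its cosine nonnegative, as [cone_transversal]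
     requires; [sin a] becomes the transversality constant. *)
  set (a := Rmin al (PI / 2)).
  assert (a0 : 0 < a) by (apply Rmin_glb_lt; lra).
  assert (a1 : a <= al) by apply Rmin_l.
  assert (a2 : a <= PI / 2) by apply Rmin_r.
  exists (sin a); split; try assumption.
  - lra.
  - apply sin_gt_0; lra.
  - intros n; apply HD.
  - intros n; apply HD.
  - intros n; apply tame_mono with (4 * M); [lra |]; apply tame_jac; [apply (HD n) | apply HM].
  - intros n; apply tame_mono with (4 * M); [lra |]; apply tame_jac; [apply (HD n) | apply HM].
  - intros n x u Hu; apply intKu_Ku; [exact LS |]; apply (Hal n x), Hu.
  - intros n x u Hu; apply intKs_Ks; [exact LS |]; apply (Hal n x), Hu.
  - intros n x u q Hu Hq; change (mv (jac (F n) x) u) with (Dmap (F n) x u).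
    destruct (proj1 (Hal n x) u Hu) as [Int Ang].
    destruct (Req_dec (enorm (Dmap (F n) x u)) 0) as [Z | Z].
    + rewrite Z, Rmult_0_l, Rmult_0_r; apply Rabs_pos.
    + assert (N : Dmap (F n) x u <> vzero) by (intros E; apply Z; rewrite E; apply enorm_zero).
      apply cone_transversal with H V mu (F n x); auto.
      intros b Hb b0; apply Rle_trans with al; [exact a1 | apply Ang; assumption].
Qed.

Fixpoint MG (G : nat -> vec -> vec) (n : nat) (y : vec) : mat :=
  match n with O => mone | S m => mm (MG G m (G m y)) (jac (G m) y) end.

Section Bundle.
Context {F G : nat -> vec -> vec} {mu eta : R} {H V : subfield} {K c0 : R}.
Context (D : cone_dynamics F G mu eta H V K c0).

Lemma Fcomp_Fit n x : Fcomp F n x = Fit F 0 n x.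
Proof. induction n as [| n IH]; [reflexivity |]; cbn [Fcomp Fit]; rewrite IH; reflexivity. Qed.

Lemma Gcomp_Fit n x : Gcomp G n (Fit F 0 n x) = x.
Proof.
  revert x; induction n as [| n IH]; intros x; [reflexivity |].
  cbn [Gcomp Fit]; rewrite Nat.add_0_l, (cd_GF _ _ _ _ _ _ _ _ D); apply IH.
Qed.

Lemma Fit_Gcomp n y : Fit F 0 n (Gcomp G n y) = y.
Proof.
  revert y; induction n as [| n IH]; intros y; [reflexivity |].
  cbn [Gcomp Fit]; rewrite Nat.add_0_l, IH; apply D.
Qed.

Lemma Gcomp_tame n : exists L, 1 <= L /\ tame L (Gcomp G n) (MG G n).
Proof.
  assert (K1 := cd_K _ _ _ _ _ _ _ _ D).
  induction n as [| n (L & L1 & IH)].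
  - exists 2; split; [lra | exact tame_id].
  - exists (2 * L * K ^ 2); split; [assert (1 <= K ^ 2) by nra; nra |].
    exact (tame_comp K L _ _ _ _ K1 L1 (cd_tG _ _ _ _ _ _ _ _ D n) IH).
Qed.

Lemma Es_stab x u : Es H V mu F G x u <-> stab F H V mu 0 x u.
Proof.
  assert (K1 := cd_K _ _ _ _ _ _ _ _ D).
  assert (Inv : forall n, (forall v, Dmap (Gcomp G n) (Fit F 0 n x) (mv (MFit F 0 n x) v) = v) /\
    (forall v, mv (MFit F 0 n x) (Dmap (Gcomp G n) (Fit F 0 n x) v) = v)).
  { intros n; destruct (Gcomp_tame n) as (L & L1 & TG).
    destruct (iterate_tame F K K1 (cd_tF _ _ _ _ _ _ _ _ D) n) as (J & J1 & TF).
    assert (E : forall v, Dmap (Gcomp G n) (Fit F 0 n x) v = mv (MG G n (Fit F 0 n x)) v).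
    { intros v; rewrite <- (tame_jac_eq _ _ _ _ TG); reflexivity. }
    split; intros v; rewrite E, <- mv_mm.
    - rewrite (tame_left_inverse _ _ _ _ _ _ J1 L1 (TF 0%nat) TG (Gcomp_Fit n)); apply mv_one.
    - assert (I := tame_left_inverse _ _ _ _ _ _ L1 J1 TG (TF 0%nat) (Fit_Gcomp n) (Fit F 0 n x)).
      cbv beta in I; rewrite Gcomp_Fit in I; rewrite I; apply mv_one. }
  split.
  - intros HE.
    assert (S : forall k, (1 <= k)%nat -> Ks H V mu (Fit F 0 k x) (mv (MFit F 0 k x) u)).
    { intros k Hk; destruct (HE k Hk) as (w & Hw & Ew); rewrite Fcomp_Fit in Hw, Ew.
      rewrite Ew, (proj2 (Inv k)); exact Hw. }
    (* The intersection defining [Es] starts at time 1; the cone condition at time 0 follows by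
       pulling back from time 1. *)
    intros [| k]; [| apply S; lia].
    assert (S1 := S 1%nat (le_n 1)); cbn [Fit MFit] in *; rewrite mm_one_r in S1; rewrite mv_one.
    apply (cd_s _ _ _ _ _ _ _ _ D 0%nat) in S1; rewrite Nat.add_0_r in S1.
    rewrite (mv_GF D), (cd_GF _ _ _ _ _ _ _ _ D) in S1; exact S1.
  - intros HS n _; exists (mv (MFit F 0 n x) u); rewrite Fcomp_Fit; split; [apply HS |].
    symmetry; apply Inv.
Qed.

(** The orthogonal projection of the stable unit vector at [x0] onto the stable line at [y]. It
    ignores the sign of [stable_vec D 0 y], is [C^1] on the whole plane, and is nonzero as long as
    the two lines are not orthogonal, in particular near [x0]. *)
Definition line_vec (x0 y : vec) : vec :=
  vscal (vdot (stable_vec D 0 x0) (stable_vec D 0 y)) (stable_vec D 0 y).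

Lemma comp1_line_vec x0 : comp1 (line_vec x0) =
  fun y => vdot (stable_vec D 0 x0) (stable_vec D 0 y) * vdot (1, 0) (stable_vec D 0 y).
Proof.
  apply functional_extensionality; intros y; unfold comp1, line_vec.
  generalize (stable_vec D 0 y) (stable_vec D 0 x0); clear; vec_ring.
Qed.

Lemma comp2_line_vec x0 : comp2 (line_vec x0) =
  fun y => vdot (stable_vec D 0 x0) (stable_vec D 0 y) * vdot (0, 1) (stable_vec D 0 y).
Proof.
  apply functional_extensionality; intros y; unfold comp2, line_vec.
  generalize (stable_vec D 0 y) (stable_vec D 0 x0); clear; vec_ring.
Qed.

Lemma line_vec_spans k J x0 y :
  contracting k J (stable_vec D) (stable_rate D k) (fun n => Fit F n k) (fun n => MFit F n k) ->
  nrm (vsub y x0) <= near_radius J ->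
  line_vec x0 y <> vzero /\ spans (Es H V mu F G) y (line_vec x0 y).
Proof.
  intros C Hy; assert (R0 := near_radius_pos C); assert (J1 := ctr_K _ _ _ _ _ _ C).
  destruct (tg_spec (stable_vec D 0 x0) (stable_vec D 0 y)) as (N & _).
  1,2: apply stable_vec_unit.
  { apply (near_cross C); nra. }
  assert (Un := stable_vec_unit D 0 y).
  unfold line_vec; set (c := vdot (stable_vec D 0 x0) (stable_vec D 0 y)) in *.
  split.
  - intros E; apply (f_equal enorm) in E.
    rewrite enorm_scal, enorm_zero, enorm_unit, Rmult_1_r in E by exact Un.
    apply N, Rabs_eq_0, E.
  - intros u; rewrite Es_stab, (stab_stable_vec D); split.
    + intros E; exists (vdot (stable_vec D 0 y) u / c); rewrite E at 1.
      transitivity (vscal (vdot (stable_vec D 0 y) u / c * c) (stable_vec D 0 y)).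
      * f_equal; field; exact N.
      * generalize (vdot (stable_vec D 0 y) u / c) c; clear; vec_ring.
    + intros (a & ->); transitivity (vscal (a * c * vdot (stable_vec D 0 y) (stable_vec D 0 y)) (stable_vec D 0 y)).
      * rewrite Un; generalize a c (stable_vec D 0 y); clear; vec_ring.
      * f_equal; generalize c (stable_vec D 0 y); clear; vec_ring.
Qed.
End Bundle.

Theorem theorem2 (F G : nat -> vec -> vec) (mu eta : R) (H V : subfield) :
  (forall n, torus_Ck_diffeo 2 (F n) (G n)) ->
  cone_condition_with F G mu eta H V ->
  (exists M : R, forall n, DerivBoundV 2 M (F n) /\ DerivBoundV 2 M (G n)) ->
  C1_line_field (Es H V mu F G) /\
  ((forall n, torus_Ck_diffeo 3 (F n) (G n)) ->
   (exists M : R, forall n, DerivBoundV 3 M (F n) /\ DerivBoundV 3 M (G n)) ->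
   exists beta : R, 0 < beta < 1 /\ C1beta_line_field beta (Es H V mu F G)).
Proof.
  intros HD HC (M & HM).
  assert (M0 : 0 <= M) by exact (DerivBound_pos _ _ _ (proj1 (proj1 (HM 0%nat)))).
  destruct (cone_dynamics_of_condition F G mu eta H V M HD HC HM) as (c0 & D).
  destruct (stable_contracting D) as (k & L & HL).
  assert (K1 : 1 <= 8 * M + 1) by lra.
  assert (TF : forall n, tame (8 * M + 1) (F n) (jac (F n))).
  { intros n; apply tame_mono with (4 * M + 1); [lra | apply D]. }
  destruct (iterate_loc2 F (8 * M + 1) K1 TF) with (k := k) as (J & HJ).
  { intros n; apply loc2_mono with (8 * M); [lra |]; apply loc2_jac; [apply (HD n) | apply HM]. }
  assert (W1 : forall x0, CkV 1 (line_vec D x0)).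
  { intros x0.
    assert (C := HL _ (Rmax_l L J)).
    assert (HA : forall n, loc2 (Rmax L J) (MFit F n k)) by (intros n; eapply loc2_mono; [apply Rmax_r | apply HJ]).
    split; [rewrite comp1_line_vec | rewrite comp2_line_vec]; apply (projection_C1 C), HA. }
  split.
  - assert (C := HL L (Rle_refl L)); assert (R0 := near_radius_pos C).
    (* Half the radius, because balls are Euclidean and [nrm] is at most twice [enorm]. *)
    intros x0; exists (near_radius L / 2); split; [lra |].
    exists (line_vec D x0); split; [apply W1 |]; intros y Hy; apply (line_vec_spans D k L); [exact C |].
    unfold in_ball in Hy; generalize (nrm_le_enorm (vsub y x0)); lra.
  - intros HD3 (M3 & HM3).
    assert (m1 := Rmax_l (8 * M + 1) (8 * M3)); assert (m2 := Rmax_r (8 * M + 1) (8 * M3)).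
    destruct (iterate_glob2 F (Rmax (8 * M + 1) (8 * M3))) with (k := k) as (J3 & HJ3); [lra | ..].
    { intros n; eapply tame_mono; [exact m1 | apply TF]. }
    { intros n; eapply glob2_mono; [exact m2 |]; apply glob2_jac; [apply (HD3 n) | apply HM3]. }
    (* The block length is that of the [C^2] part; only the constant grows, to cover the global
       second-order expansions of the blocks. *)
    assert (C := HL _ (Rmax_l L J3)).
    assert (HA : forall n, glob2 (Rmax L J3) (MFit F n k)) by (intros n; eapply glob2_mono; [apply Rmax_r | apply HJ3]).
    destruct (exponent_exists C) as (b & Hb & HR).
    exists b; split; [exact Hb |]; intros x0.
    assert (R0 := near_radius_pos C).
    exists (near_radius (Rmax L J3) / 8); split; [lra |].
    exists (line_vec D x0); split; [apply W1 |].
    destruct (W1 x0) as [W11 W12]; rewrite comp1_line_vec in *; rewrite comp2_line_vec in *.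
    destruct (projection_holder C b 0 _ _ Hb HR HA W11) as (c1 & c10 & H1).
    destruct (projection_holder C b 0 _ _ Hb HR HA W12) as (c2 & c20 & H2).
    assert (b0 := proj1 Hb).
    split; [exact (holder_on_of_bound C x0 b c1 _ b0 c10 (fun x y h => proj1 (H1 x y h))) |].
    split; [exact (holder_on_of_bound C x0 b c1 _ b0 c10 (fun x y h => proj2 (H1 x y h))) |].
    split; [exact (holder_on_of_bound C x0 b c2 _ b0 c20 (fun x y h => proj1 (H2 x y h))) |].
    split; [exact (holder_on_of_bound C x0 b c2 _ b0 c20 (fun x y h => proj2 (H2 x y h))) |].
    intros y Hy; apply (line_vec_spans D k (Rmax L J3)); [exact C |].
    unfold in_ball in Hy; generalize (nrm_le_enorm (vsub y x0)); lra.
Qed.
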